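(* Let $n\ge 1$ be fixed, let $|\psi_t\rangle=e^{-itH}|\psi_0\rangle$ be a family of clock states as in the context, and let $\Pi=\sum_{E\in\mathsf{Sp}_n}\pi_E|E,n\rangle\langle E,n|$ be a fixed filter with $0\le\pi_E\le 1$ and $P_{\rm succ}=\sum_{E\in\mathsf{Sp}_n}\pi_E\,p_{E,n}>0$. For $m\ge1$ let $F^\Pi_{\rm PM}(m)$ be the optimal probabilistic-metrology fidelity and $F^\Pi_{\rm CL}(m)$ the optimal probabilistic-cloning fidelity for $m$ output copies with filter $\Pi$, and set $$F^\Pi(m):=\frac{\Delta V^*}{\sqrt{(2\pi)^r\det\widetilde{\mathbf\Sigma}}}\left(\sum_{E\in\mathsf{Sp}_n}\sqrt{p_{E,n}\,\frac{\pi_E}{P_{\rm succ}}}\right)^2,$$ where $\widetilde{\mathbf\Sigma}=\mathbf K\mathbf\Sigma\mathbf K^t$ (with $\mathbf\Sigma$ depending on $m$) and $\Delta V^*=\gcd\{[\mathbf K]_r\}$ is the greatest common divisor of all $r\times r$ minors of $\mathbf K$. Then, as $m\to\infty$, $$\frac{F^\Pi_{\rm PM}(m)}{F^\Pi(m)}\longrightarrow 1\qquad\text{and}\qquad \frac{F^\Pi_{\rm CL}(m)}{F^\Pi(m)}\longrightarrow 1 .$$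
   Context: Clock states. $\mathcal H$ is a Hilbert space of finite dimension $d\ge2$ with orthonormal basis $|0\rangle,\dots,|d-1\rangle$; $H|j\rangle=e_j|j\rangle$ with real, pairwise distinct $e_j$ and $e_0=0$; $|\psi_0\rangle=\sum_{j=0}^{d-1}\sqrt{p_j}|j\rangle$ with all $p_j>0$, $\sum_jp_j=1$; $|\psi_t\rangle=e^{-itH}|\psi_0\rangle$, $t\in\mathbb R$; $|\Psi^n_t\rangle=|\psi_t\rangle^{\otimes n}$. Energies. $\mathscr P_n$ is the set of $\mathbf n=(n_1,\dots,n_{d-1})^t\in\mathbb Z^{d-1}$ with $n_j\ge0$ and $\sum_{j=1}^{d-1}n_j\le n$; put $n_0=n-\sum_{j\ge1}n_j$ and $E_{\mathbf n}=\sum_{j=1}^{d-1}e_jn_j$. $\mathsf{Sp}_n=\{E_{\mathbf n}:\mathbf n\in\mathscr P_n\}$ is the set of distinct total energies of $n$ clocks. $p_{\mathbf n,n}=n!\prod_{j=0}^{d-1}p_j^{n_j}/n_j!$ and $p_{E,n}=\sum_{\mathbf n\in\mathscr P_n:\,E_{\mathbf n}=E}p_{\mathbf n,n}$. $|E,n\rangle$ is the unit vector proportional to the projection of $|\psi_0\rangle^{\otimes n}$ onto the eigenspace of the total Hamiltonian (the sum of $n$ copies of $H$) with eigenvalue $E$, so that $|\Psi^n_t\rangle=\sum_{E\in\mathsf{Sp}_n}e^{-iEt}\sqrt{p_{E,n}}\,|E,n\rangle$. Rationally independent units. Let $r$ be the minimal number of real numbers $\varepsilon_1,\dots,\varepsilon_r$,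 linearly independent over $\mathbb Q$, such that $e_j=\sum_{l=1}^r\varepsilon_lk_{lj}$ with $k_{lj}\in\mathbb Z$ for all $j=1,\dots,d-1$. Fix such units; $\mathbf K$ is the $r\times(d-1)$ integer matrix with entries $k_{lj}$. For given $m$, $\mathbf\Sigma$ is the $(d-1)\times(d-1)$ matrix with $\Sigma_{jj}=mp_j(1-p_j)$ and $\Sigma_{jl}=-mp_jp_l$ for $j\ne l$ ($1\le j,l\le d-1$). Filtered state. $|\Psi^{n,\Pi}_t\rangle=\Pi^{1/2}|\Psi^n_t\rangle/\sqrt{P_{\rm succ}}$, where $P_{\rm succ}=\langle\Psi^n_t|\Pi|\Psi^n_t\rangle$ does not depend on $t$. Probabilistic metrology fidelity. $F^\Pi_{\rm PM}(m)$ is the supremum, over all POVMs $M$ on $\mathbb R$ acting on $\mathcal H^{\otimes n}$ and all probability distributions $(\hat p_{E,m})_{E\in\mathsf{Sp}_m}$, of $$\inf_{t\in\mathbb R}\int_{\mathbb R}\langle\Psi^{n,\Pi}_t|M(d\hat t)|\Psi^{n,\Pi}_t\rangle\,\left|\langle\hat\Psi^m_{\hat t}|\Psi^m_t\rangle\right|^2,\qquad |\hat\Psi^m_{\hat t}\rangle=\sum_{E\in\mathsf{Sp}_m}e^{-iE\hat t}\sqrt{\hat p_{E,m}}\,|E,m\rangle .$$ Probabilistic cloning fidelity. $F^\Pi_{\rm CL}(m)$ is the supremum, over all completely positive trace-preserving maps $\mathscr D$ from operators on $\mathcal H^{\otimes n}$ to operators on $\mathcal H^{\otimes m}$, of $\inf_{t\in\mathbb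 R}\langle\Psi^m_t|\mathscr D\big(|\Psi^{n,\Pi}_t\rangle\langle\Psi^{n,\Pi}_t|\big)|\Psi^m_t\rangle$. *)

(* Defs.v *)
From mathcomp Require Import all_boot all_order all_algebra.
From mathcomp Require Import spectral sesquilinear.
From mathcomp.real_closed Require Export complex.
From mathcomp Require Import all_classical all_reals all_analysis.

Set Implicit Arguments.
Unset Strict Implicit.
Unset Printing Implicit Defensive.

Import Order.TTheory GRing.Theory Num.Theory.
Import numFieldNormedType.Exports.

Local Open Scope classical_set_scope.
Local Open Scope complex_scope.
Local Open Scope sesquilinear_scope.
Local Open Scope ring_scope.

(* Kets are column vectors over R[i]; the bra of v is v^t*.  The dimension d of
   the single-clock space is written d1.+1, so that d1 = d - 1; the level j >= 1
   is lift ord0 j' with j' : 'I_d1. *)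

Definition braket (R : realType) (N : nat) (u v : 'cV[R[i]]_N) : R[i] :=
  (u^t* *m v) 0 0.

Definition ketbra (R : realType) (N : nat) (u v : 'cV[R[i]]_N) : 'M[R[i]]_N :=
  u *m v^t*.

Definition normalize (R : realType) (N : nat) (v : 'cV[R[i]]_N) : 'cV[R[i]]_N :=
  (sqrtC (braket v v))^-1 *: v.

(* In the order of R[i], 0 <= z means that z is real and nonnegative; hence a
   positive operator is in particular Hermitian. *)
Definition psdmx (R : realType) (N : nat) (A : 'M[R[i]]_N) : Prop :=
  forall v : 'cV[R[i]]_N, 0 <= braket v (A *m v).

Definition cexp (R : realType) (z : R[i]) : R[i] :=
  (expR (complex.Re z))%:C * (cos (complex.Im z) +i* sin (complex.Im z)).

(* f(A) by the spectral theorem, for a normal operator A *)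
Definition mxfun (R : realType) (N : nat) (f : R[i] -> R[i]) (A : 'M[R[i]]_N) :
    'M[R[i]]_N :=
  invmx (spectralmx A) *m diag_mx (map_mx f (spectral_diag A)) *m spectralmx A.

Definition hamiltonian (R : realType) (d1 : nat) (e : 'I_d1.+1 -> R) :
    'M[R[i]]_d1.+1 :=
  diag_mx (\row_j (e j)%:C).

Definition psi0 (R : realType) (d1 : nat) (p : 'I_d1.+1 -> R) :
    'cV[R[i]]_d1.+1 :=
  \col_j (Num.sqrt (p j))%:C.

Definition psi (R : realType) (d1 : nat) (e p : 'I_d1.+1 -> R) (t : R) :
    'cV[R[i]]_d1.+1 :=
  mxfun (fun z => cexp (- 'i%C * t%:C * z)) (hamiltonian e) *m psi0 p.

(* The n-fold tensor power of a space with basis indexed by 'I_d has its product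
   basis indexed by {ffun 'I_n -> 'I_d}, enumerated through enum_val. *)
Definition tdim (d n : nat) : nat := #|{ffun 'I_n -> 'I_d}|.

Definition tindex (d n : nat) (x : 'I_(tdim d n)) : {ffun 'I_n -> 'I_d} :=
  enum_val x.

Definition tensor_power (R : realType) (d n : nat) (v : 'cV[R[i]]_d) :
    'cV[R[i]]_(tdim d n) :=
  \col_x \prod_(k < n) v (tindex x k) 0.

(* A acting on the k-th tensor factor, the identity on the others *)
Definition at_factor (R : realType) (d n : nat) (k : 'I_n) (A : 'M[R[i]]_d) :
    'M[R[i]]_(tdim d n) :=
  \matrix_(x, y) (A (tindex x k) (tindex y k) *
    [forall l, (l != k) ==> (tindex x l == tindex y l)]%:R).

Definition total_hamiltonian (R : realType) (d1 : nat) (e : 'I_d1.+1 -> R)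
    (n : nat) : 'M[R[i]]_(tdim d1.+1 n) :=
  \sum_(k < n) at_factor k (hamiltonian e).

Definition Psi (R : realType) (d1 : nat) (e p : 'I_d1.+1 -> R) (n : nat)
    (t : R) : 'cV[R[i]]_(tdim d1.+1 n) :=
  tensor_power n (psi e p t).

Definition is_occupation (d1 n : nat) (nn : {ffun 'I_d1 -> 'I_n.+1}) : bool :=
  (\sum_(j < d1) nn j <= n)%N.

Definition energy (R : realType) (d1 : nat) (e : 'I_d1.+1 -> R) (n : nat)
    (nn : {ffun 'I_d1 -> 'I_n.+1}) : R :=
  \sum_(j < d1) e (lift ord0 j) *+ nn j.

Definition Sp (R : realType) (d1 : nat) (e : 'I_d1.+1 -> R) (n : nat) : seq R :=
  undup [seq energy e nn | nn <- enum (@is_occupation d1 n)].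

Definition multinomial (R : realType) (d1 : nat) (p : 'I_d1.+1 -> R) (n : nat)
    (nn : {ffun 'I_d1 -> 'I_n.+1}) : R :=
  let n0 := (n - \sum_(j < d1) nn j)%N in
  n`!%:R * (p ord0 ^+ n0 / n0`!%:R *
    \prod_(j < d1) (p (lift ord0 j) ^+ nn j / (nn j)`!%:R)).

Definition pE (R : realType) (d1 : nat) (e p : 'I_d1.+1 -> R) (n : nat)
    (E : R) : R :=
  \sum_(nn : {ffun 'I_d1 -> 'I_n.+1} | is_occupation nn && (energy e nn == E))
    multinomial p nn.

(* eigenspace and proj_ortho act on row vectors, whence the transpositions. *)
Definition eigenprojector (R : realType) (N : nat) (A : 'M[R[i]]_N) (a : R[i]) :
    'M[R[i]]_N :=
  (proj_ortho (eigenspace A^T a))^T.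

Definition ketE (R : realType) (d1 : nat) (e p : 'I_d1.+1 -> R) (n : nat)
    (E : R) : 'cV[R[i]]_(tdim d1.+1 n) :=
  normalize (eigenprojector (total_hamiltonian e n) E%:C
               *m tensor_power n (psi0 p)).

Definition filter_op (R : realType) (d1 : nat) (e p : 'I_d1.+1 -> R) (n : nat)
    (w : R -> R) : 'M[R[i]]_(tdim d1.+1 n) :=
  \sum_(E <- Sp e n) (w E)%:C *: ketbra (ketE e p n E) (ketE e p n E).

Definition filtered (R : realType) (d1 : nat) (e p : 'I_d1.+1 -> R) (n : nat)
    (w : R -> R) (t : R) : 'cV[R[i]]_(tdim d1.+1 n) :=
  let W := filter_op e p n w in
  (sqrtC (braket (Psi e p n t) (W *m Psi e p n t)))^-1
    *: (mxfun sqrtC W *m Psi e p n t).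

Definition Psucc (R : realType) (d1 : nat) (e p : 'I_d1.+1 -> R) (n : nat)
    (w : R -> R) : R :=
  \sum_(E <- Sp e n) w E * pE e p n E.

Definition povm_dist (R : realType) (N : nat)
    (M : set (measurableTypeR R) -> 'M[R[i]]_N) (v : 'cV[R[i]]_N) :
    set (measurableTypeR R) -> \bar R :=
  fun B => (complex.Re (braket v (M B *m v)))%:E.

Definition is_povm (R : realType) (N : nat)
    (M : set (measurableTypeR R) -> 'M[R[i]]_N) : Prop :=
  [/\ forall B, measurable B -> psdmx (M B),
      M [set: measurableTypeR R] = 1%:M
    & forall v, semi_sigma_additive (povm_dist M v)].

Definition guess (R : realType) (d1 : nat) (e p : 'I_d1.+1 -> R) (m : nat)
    (phat : R -> R) (t : R) : 'cV[R[i]]_(tdim d1.+1 m) :=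
  \sum_(E <- Sp e m)
    (cexp (- 'i%C * E%:C * t%:C) * (Num.sqrt (phat E))%:C) *: ketE e p m E.

Definition is_distribution (R : realType) (s : seq R) (q : R -> R) : Prop :=
  (forall E, E \in s -> 0 <= q E) /\ \sum_(E <- s) q E = 1.

Definition pm_fidelity (R : realType) (d1 : nat) (e p : 'I_d1.+1 -> R)
    (n : nat) (w : R -> R) (m : nat)
    (M : set (measurableTypeR R) -> 'M[R[i]]_(tdim d1.+1 n)) (phat : R -> R)
    (t : R) : R :=
  fine (\int[povm_dist M (filtered e p n w t)]_that
    (complex.Re (`|braket (guess e p m phat that) (Psi e p m t)| ^+ 2))%:E).

(* The numbers under inf and sup, here and below, lie in [0, 1]. *)
Definition F_PM (R : realType) (d1 : nat) (e p : 'I_d1.+1 -> R) (n : nat)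
    (w : R -> R) (m : nat) : R :=
  sup [set F | exists (M : set (measurableTypeR R) -> 'M[R[i]]_(tdim d1.+1 n))
                    (phat : R -> R),
    [/\ is_povm M, is_distribution (Sp e m) phat
      & F = inf (range (pm_fidelity e p w m M phat))]].

(* id_k (x) D maps positive operators to positive operators for all k *)
Definition completely_positive (R : realType) (N N' : nat)
    (D : 'M[R[i]]_N -> 'M[R[i]]_N') : Prop :=
  forall (k : nat) (X : 'M[R[i]]_(\sum_(i < k) N)),
    psdmx X -> psdmx (\mxblock_(i < k, j < k) D (submxblock X i j)).

Definition is_channel (R : realType) (N N' : nat)
    (D : {linear 'M[R[i]]_N -> 'M[R[i]]_N'}) : Prop :=
  completely_positive D /\ forall X, \tr (D X) = \tr X.

Definition cl_fidelity (R : realType) (d1 : nat) (e p : 'I_d1.+1 -> R)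
    (n : nat) (w : R -> R) (m : nat)
    (D : 'M[R[i]]_(tdim d1.+1 n) -> 'M[R[i]]_(tdim d1.+1 m)) (t : R) : R :=
  complex.Re (braket (Psi e p m t)
    (D (ketbra (filtered e p n w t) (filtered e p n w t)) *m Psi e p m t)).

Definition F_CL (R : realType) (d1 : nat) (e p : 'I_d1.+1 -> R) (n : nat)
    (w : R -> R) (m : nat) : R :=
  sup [set F | exists2 D : {linear 'M[R[i]]_(tdim d1.+1 n) ->
                                   'M[R[i]]_(tdim d1.+1 m)},
    is_channel D & F = inf (range (cl_fidelity e p w D))].

Definition rational_units (R : realType) (d1 : nat) (e : 'I_d1.+1 -> R)
    (r : nat) (eps : 'I_r -> R) (K : 'M[int]_(r, d1)) : Prop :=
  (forall c : 'I_r -> rat,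
     \sum_(l < r) ratr (c l) * eps l = 0 -> forall l, c l = 0) /\
  (forall j : 'I_d1, e (lift ord0 j) = \sum_(l < r) eps l * (K l j)%:~R).

Definition minimal_units (R : realType) (d1 : nat) (e : 'I_d1.+1 -> R)
    (r : nat) (eps : 'I_r -> R) (K : 'M[int]_(r, d1)) : Prop :=
  rational_units e eps K /\
  forall (r' : nat) (eps' : 'I_r' -> R) (K' : 'M[int]_(r', d1)),
    rational_units e eps' K' -> (r <= r')%N.

(* A choice of r columns of K is a strictly increasing f. *)
Definition minors_gcd (d1 r : nat) (K : 'M[int]_(r, d1)) : nat :=
  \big[gcdn/0%N]_(f : {ffun 'I_r -> 'I_d1} |
      [forall i : 'I_r, forall j : 'I_r, (i < j)%N ==> (f i < f j)%N])
    `|\det (colsub f K)|%N.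

Definition Sigma (R : realType) (d1 : nat) (p : 'I_d1.+1 -> R) (m : nat) :
    'M[R]_d1 :=
  \matrix_(j, l) (if j == l
    then m%:R * p (lift ord0 j) * (1 - p (lift ord0 j))
    else - (m%:R * p (lift ord0 j) * p (lift ord0 l))).

Definition Sigma_tilde (R : realType) (d1 : nat) (p : 'I_d1.+1 -> R) (r : nat)
    (K : 'M[int]_(r, d1)) (m : nat) : 'M[R]_r :=
  let KR : 'M[R]_(r, d1) := map_mx intr K in
  KR *m Sigma p m *m KR^T.

Definition F_asym (R : realType) (d1 : nat) (e p : 'I_d1.+1 -> R) (n : nat)
    (w : R -> R) (r : nat) (K : 'M[int]_(r, d1)) (m : nat) : R :=
  (minors_gcd K)%:R
    / Num.sqrt ((2 * pi) ^+ r * \det (Sigma_tilde p K m))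
  * (\sum_(E <- Sp e n)
       Num.sqrt (pE e p n E * (w E / Psucc e p n w))) ^+ 2.

(* Main.v *)
Require Import Defs.
From HB Require Import structures.
From mathcomp Require Import all_boot all_order all_algebra.
From mathcomp Require Import perm spectral sesquilinear.
From mathcomp Require Import all_classical all_reals all_analysis.
From mathcomp Require Import measurable_realfun zify ring lra.
Set Implicit Arguments.
Unset Strict Implicit.
Unset Printing Implicit Defensive.
Import Order.TTheory GRing.Theory Num.Theory.
Import numFieldNormedType.Exports.
Local Open Scope classical_set_scope.
Local Open Scope complex_scope.
Local Open Scope sesquilinear_scope.
Local Open Scope ring_scope.

(** The bounds meet because the output distribution is flat at the scale that matters. Differences
    of input energies are lattice vectors of bounded size, whereas [p_{F,m}] varies over distances
    of order sqrt m. The upper bound sees only the maximum and the lower bound only values near the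
    mean; both are l / D to leading order. The box is therefore chosen once, after the tolerance and
    before m: wide enough that translating it by an input difference loses only a small boundary
    layer, and then fixed, so that convergence at finitely many lattice points is enough.

    The infimum over all real times has no period to exploit, since the energies may be
    incommensurable. It is bounded by an average over finitely many times chosen to cancel the
    finitely many nonzero frequencies that occur exactly. The same cancellation makes a finite set
    of clock states resolve the identity on their span, so the optimal measurement is atomic.

    The change of units is forced: if the steps of the walk generated a proper sublattice, the
    characteristic function would have modulus 1 away from the origin of the Fourier box, and its
    powers would not decay there. *)

(** Expanding the energies of a clock in units that generate Z^r turns the energy
    distribution of m clocks into the law of a lattice random walk after m steps,
    for which Fourier inversion yields a local limit theorem: with
    D = (2 pi sqrt m)^r, the supremum of D * p_{F,m} over all F is asymptotically
    at most l = sqrt ((2 pi)^r / det Cov), and D * p_{F,m} tends to l at every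
    lattice point within bounded distance of the mean.  The two fidelities are
    squeezed between matching bounds.
    - Upper bound: average the cloning fidelity over finitely many times, so that
      only the terms with E' - E = F' - F survive, and bound these by complete
      positivity; this gives max_F p_{F,m} * (\sum_E c_E)^2, where c_E are the
      amplitudes of the filtered state.
    - A metrology protocol is, up to discretisation, a measure-and-prepare channel.
    - Lower bound: the covariant measurement together with the guess whose weights
      are uniform on a large box of lattice points around the mean attains
      p * (\sum_E c_E)^2 up to a factor close to 1, with p the least of the p_{F,m}
      over the box.
    Finally l / D is the prefactor of the asymptotic formula: passing to units that
    generate Z^r divides K by a square matrix B with |det B| the gcd of its minors. *)

(** * Iterated integrals and Gaussian integrals *)

Section OneDim.
Variable R : realType.
Let mu := @lebesgue_measure R.

(** The integrand is a constant multiple of the normal density of mean [- b] and deviation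
    [1 / sqrt a], whose mass is 1. *)
Lemma gauss_integral_shift (a b : R) : 0 < a ->
  mu.-integrable setT (EFin \o (fun x => expR (- (a / 2 * (x + b) ^+ 2)))) /\
  Rintegral mu setT (fun x => expR (- (a / 2 * (x + b) ^+ 2)))
  = Num.sqrt (2 * pi / a).
Proof.
move=> a0; set s := (Num.sqrt a)^-1.
have s0 : s != 0 by rewrite invr_eq0 gt_eqF // sqrtr_gt0.
have s2 : s ^+ 2 = a^-1 by rewrite /s exprVn sqr_sqrtr // ltW.
set k := Num.sqrt (2 * pi / a).
have k0 : 0 < k by rewrite sqrtr_gt0 divr_gt0 // mulr_gt0 // pi_gt0.
have E : (fun x => expR (- (a / 2 * (x + b) ^+ 2))) =
         (fun x => k * normal_pdf (- b) s x).
  apply/funext => x; rewrite normal_pdfE // /normal_peak /normal_fun s2 opprK.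
  have -> : a^-1 * pi *+ 2 = 2 * pi / a by rewrite mulr2n; ring.
  rewrite [RHS]mulrA mulfV ?gt_eqF // mul1r; congr expR.
  have -> : a^-1 *+ 2 = 2 / a by rewrite mulr2n; ring.
  by rewrite invf_div; ring.
have I := integrable_normal_pdf (- b) s.
rewrite E; split.
  rewrite (_ : _ \o _ = fun x => (k%:E * (normal_pdf (- b) s x)%:E)%E); last first.
    by apply/funext => x /=; rewrite EFinM.
  by apply: integrableZl.
rewrite RintegralZl //.
by rewrite /Rintegral integral_normal_pdf /= mulr1.
Qed.

(** Dominated convergence with moving domains: each domain is absorbed into the integrand as a
    restriction, so that all integrals run over the whole line. *)
Lemma cvg_Rintegral_dominated (D_ : nat -> set R) (D : set R)
    (g_ : nat -> R -> R) (g h : R -> R) :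
  (forall n, measurable (D_ n)) -> measurable D ->
  (forall n, measurable_fun setT (g_ n)) ->
  mu.-integrable setT (EFin \o h) ->
  (forall x, 0 <= h x) ->
  (forall n x, D_ n x -> `|g_ n x| <= h x) ->
  (forall x, (g_ n \_ (D_ n)) x @[n --> \oo] --> (g \_ D) x) ->
  Rintegral mu (D_ n) (g_ n) @[n --> \oo] --> Rintegral mu D g.
Proof.
move=> mD_ mD mg ih h0 gh gc.
have mr n : measurable_fun setT (g_ n \_ (D_ n)).
  apply/(measurable_restrictT _ (mD_ n)).
  exact: measurable_funTS.
have dom n x : `|(g_ n \_ (D_ n)) x| <= h x.
  rewrite patchE; case: ifPn => [/set_mem/gh //|_]; by rewrite normr0.
have cE x : (EFin \o (g_ n \_ (D_ n))) x @[n --> \oo] --> (EFin \o (g \_ D)) x.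
  by apply: cvg_EFin; [apply: nearW|apply: gc].
have mgD : measurable_fun setT (g \_ D).
  apply/measurable_EFinP.
  apply: (emeasurable_fun_cvg (fun n => EFin \o (g_ n \_ (D_ n)))) => //.
  by move=> n; apply/measurable_EFinP.
have [] := @dominated_convergence _ _ R mu setT measurableT
  (fun n => EFin \o (g_ n \_ (D_ n))) (EFin \o (g \_ D)) (EFin \o h)
  _ _ _ ih _.
- by move=> n; apply/measurable_EFinP; exact: (mr n).
- exact/measurable_EFinP.
- by apply: aeW => x _; exact: cE.
- by apply: aeW => x n _; rewrite /= lee_fin.
move=> I _ C.
rewrite -(fineK (integrable_fin_num measurableT I)) in C.
rewrite Rintegral_mkcond.
under eq_fun do rewrite Rintegral_mkcond.
exact: fine_cvg C.
Qed.

End OneDim.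

(* Integrals over R^r and over boxes are iterated one-dimensional integrals, so
   that no product measure on row vectors is needed; continuity of integrands is
   sequential and coordinatewise. *)
Definition consv (R : realType) r (x : R) (u : 'rV[R]_r) : 'rV[R]_r.+1 :=
  row_mx (x%:M : 'rV_1) u.

Fixpoint nint (R : realType) (D : set R) r : ('rV[R]_r -> R) -> R :=
  match r with
  | 0 => fun f => f 0
  | r'.+1 => fun f => nint D (fun u : 'rV[R]_r' =>
      Rintegral (@lebesgue_measure R) D (fun x => f (consv x u)))
  end.

Definition sqcont (R : realType) r (f : 'rV[R]_r -> R) : Prop :=
  forall (u_ : nat -> 'rV[R]_r) (u : 'rV[R]_r),
    (forall i, u_ n 0 i @[n --> \oo] --> u 0 i) ->
    f (u_ n) @[n --> \oo] --> f u.

Definition bdcont (R : realType) r (f : 'rV[R]_r -> R) : Prop :=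
  sqcont f /\ exists B : R, forall u, `|f u| <= B.

Definition normsq (R : realType) r (u : 'rV[R]_r) : R := \sum_i (u 0 i) ^+ 2.

Section Nested.
Variable R : realType.
Let mu := @lebesgue_measure R.

Lemma consvl r (x : R) (u : 'rV[R]_r) (j : 'I_1) :
  consv x u 0 (@lshift 1 r j) = x.
Proof. by rewrite /consv (@row_mxEl _ 1 1 r) mxE !ord1 eqxx mulr1n. Qed.

Lemma consvr r (x : R) (u : 'rV[R]_r) (j : 'I_r) :
  consv x u 0 (@rshift 1 r j) = u 0 j.
Proof. by rewrite /consv (@row_mxEr _ 1 1 r). Qed.

Lemma consv_cvg r (x_ : nat -> R) (x : R) (u_ : nat -> 'rV[R]_r) (u : 'rV[R]_r) :
  x_ n @[n --> \oo] --> x ->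
  (forall i, u_ n 0 i @[n --> \oo] --> u 0 i) ->
  forall i, (consv (x_ n) (u_ n)) 0 i @[n --> \oo] --> (consv x u) 0 i.
Proof.
move=> cx cu i; case: (@split_ordP 1 r i) => j ->.
  by rewrite consvl; under eq_fun do rewrite consvl.
rewrite consvr; under eq_fun do rewrite consvr.
exact: cu.
Qed.

Lemma normsq_consv r (x : R) (u : 'rV[R]_r) :
  normsq (consv x u) = x ^+ 2 + normsq u.
Proof.
rewrite /normsq (@big_split_ord _ _ _ 1 r) /= big_ord1 consvl; congr (_ + _).
by apply: eq_bigr => i _; rewrite consvr.
Qed.

Lemma consv_dom r (D : set R) (x : R) (u : 'rV[R]_r) :
  D x -> (forall i, D (u 0 i)) -> forall i, D (consv x u 0 i).
Proof.
move=> Dx Du i; case: (@split_ordP 1 r i) => j ->; first by rewrite consvl.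
rewrite consvr; exact: Du.
Qed.

Lemma sqcont_measurable r (f : 'rV[R]_r.+1 -> R) (u : 'rV[R]_r) :
  sqcont f -> measurable_fun setT (fun x => f (consv x u)).
Proof.
move=> cf; apply: continuous_measurable_fun => x.
apply/(@cvg_nbhsP _ R^o) => x_ cx; apply: cf; apply: consv_cvg => // i.
exact: cvg_cst.
Qed.

Section Finite.
Variables (D : set R) (mD : measurable D) (fD : (mu D < +oo)%E).

Lemma integrable_restrict_cst (B : R) :
  mu.-integrable setT (EFin \o (cst B \_ D)).
Proof.
rewrite -restrict_EFin; refine (proj1 (@integrable_mkcond _ _ _ mu _ _ mD) _).
apply: measurable_bounded_integrable => //.
by exists `|B|; split; [exact: num_real|move=> y By x _; exact: ltW].
Qed.

Lemma bdcont_integrable r (f : 'rV[R]_r.+1 -> R) (u : 'rV[R]_r) :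
  bdcont f -> mu.-integrable D (EFin \o (fun x => f (consv x u))).
Proof.
move=> [cf [B hB]]; apply: measurable_bounded_integrable => //.
  by apply: measurable_funTS; exact: sqcont_measurable.
by exists B; split; [exact: num_real|move=> y By x _; apply: le_trans (hB _) (ltW By)].
Qed.

(** Closure of the class under integrating out a coordinate, which keeps every stage of [nint]
    meaningful. Continuity is dominated convergence with a constant bound on a domain of finite
    measure. *)
Lemma bdcont_step r (f : 'rV[R]_r.+1 -> R) :
  bdcont f -> bdcont (fun u => Rintegral mu D (fun x => f (consv x u))).
Proof.
move=> bf; have [cf [B hB]] := bf; split.
  move=> u_ u cu.
  apply: (cvg_Rintegral_dominated (D_ := fun=> D) (h := cst B \_ D)) => //.
  - by move=> n; exact: sqcont_measurable.
  - exact: integrable_restrict_cst.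
  - by move=> x; rewrite patchE; case: ifP => // _; exact: le_trans (hB 0).
  - move=> n x Dx; rewrite patchE mem_set //; exact: hB.
  - move=> x; rewrite patchE; under eq_fun do rewrite patchE.
    case: ifP => _; last exact: cvg_cst.
    apply: cf; apply: consv_cvg => //; exact: cvg_cst.
exists (B * fine (mu D)) => u.
refine (le_trans (@le_normr_Rintegral _ _ _ mu _ _ mD (bdcont_integrable u bf)) _).
rewrite -Rintegral_cst //; apply: le_Rintegral => //.
- have := integrable_abse (bdcont_integrable u bf).
  by congr (_.-integrable _ _).
- apply: measurable_bounded_integrable => //.
  by exists `|B|; split => // y By x _; exact: ltW.
Qed.

Lemma le_nint r (f g : 'rV[R]_r -> R) : bdcont f -> bdcont g ->
  (forall u : 'rV[R]_r, (forall i, D (u 0 i)) -> f u <= g u) -> nint D f <= nint D g.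
Proof.
elim: r f g => [|r IH] f g bf bg fg /=; first by apply: fg; case.
apply: IH; try exact: bdcont_step.
move=> u Du; apply: le_Rintegral => //; try exact: bdcont_integrable.
by move=> x Dx; apply: fg; exact: consv_dom.
Qed.

Lemma eq_nint r (f g : 'rV[R]_r -> R) : f =1 g -> nint D f = nint D g.
Proof. by move=> /funext ->. Qed.

Lemma bdcontD r (f g : 'rV[R]_r -> R) : bdcont f -> bdcont g ->
  bdcont (fun u => f u + g u).
Proof.
move=> [cf [B hB]] [cg [B' hB']]; split.
  by move=> u_ u cu; apply: cvgD; [exact: cf|exact: cg].
by exists (B + B') => u; rewrite (le_trans (ler_normD _ _)) // lerD.
Qed.

Lemma bdcontZ r (c : R) (f : 'rV[R]_r -> R) : bdcont f ->
  bdcont (fun u => c * f u).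
Proof.
move=> [cf [B hB]]; split.
  by move=> u_ u cu; apply: cvgM; [exact: cvg_cst|exact: cf].
by exists (`|c| * B) => u; rewrite normrM ler_wpM2l.
Qed.

Lemma bdcont_cst r (c : R) : bdcont (fun _ : 'rV[R]_r => c).
Proof. by split; [move=> *; exact: cvg_cst|exists `|c|]. Qed.

Lemma nintD r (f g : 'rV[R]_r -> R) : bdcont f -> bdcont g ->
  nint D (fun u => f u + g u) = nint D f + nint D g.
Proof.
elim: r f g => [//|r IH] f g bf bg /=.
rewrite -IH; try exact: bdcont_step.
apply: eq_nint => u; apply: RintegralD => //; exact: bdcont_integrable.
Qed.

Lemma nintZ r (c : R) (f : 'rV[R]_r -> R) : bdcont f ->
  nint D (fun u => c * f u) = c * nint D f.
Proof.
elim: r f => [//|r IH] f bf /=.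
rewrite -IH; last exact: bdcont_step.
apply: eq_nint => u; apply: RintegralZl => //; exact: bdcont_integrable.
Qed.

Lemma bdcont_sum r (I : Type) (s : seq I) (F : I -> 'rV[R]_r -> R) :
  (forall i, bdcont (F i)) -> bdcont (fun u => \sum_(i <- s) F i u).
Proof.
move=> bF; elim: s => [|i s IH].
  by under eq_fun do rewrite big_nil; exact: bdcont_cst.
by under eq_fun do rewrite big_cons; exact: bdcontD.
Qed.

Lemma nint0 r : nint D (fun _ : 'rV[R]_r => 0) = 0.
Proof.
elim: r => [//|r IH] /=; rewrite -[RHS]IH; apply: eq_nint => u.
by rewrite Rintegral_cst // mul0r.
Qed.

Lemma nint_sum r (I : Type) (s : seq I) (F : I -> 'rV[R]_r -> R) :
  (forall i, bdcont (F i)) ->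
  nint D (fun u => \sum_(i <- s) F i u) = \sum_(i <- s) nint D (F i).
Proof.
move=> bF; elim: s => [|i s IH].
  by rewrite big_nil -[RHS](nint0 r); apply: eq_nint => u; rewrite big_nil.
rewrite big_cons -IH -nintD //; last exact: bdcont_sum.
by apply: eq_nint => u; rewrite big_cons.
Qed.

End Finite.

(** The Gaussian bound factorises over the coordinates, so integrating one out leaves a bound of the
    same shape in the others, with [B] multiplied by a one-dimensional Gaussian integral; hence the
    induction. *)
Lemma nint_cvg r (D_ : nat -> set R) (f_ : nat -> 'rV[R]_r -> R)
    (f : 'rV[R]_r -> R) (c B : R) : 0 < c ->
  (forall n, measurable (D_ n)) -> (forall n, (mu (D_ n) < +oo)%E) ->
  (forall x, \forall n \near \oo, D_ n x) ->
  (forall n, bdcont (f_ n)) ->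
  (forall n (u : 'rV[R]_r), (forall i, D_ n (u 0 i)) ->
     `|f_ n u| <= B * expR (- (c * normsq u))) ->
  (forall u, f_ n u @[n --> \oo] --> f u) ->
  nint (D_ n) (f_ n) @[n --> \oo] --> nint setT f.
Proof.
move=> c0 mD fD HD; elim: r f_ f B => [|r IH] f_ f B bf df cf /=; first exact: cf.
(* The sign of [B] follows from the domination at the origin, which lies in [D_ n] for large [n]. *)
have B0 : 0 <= B.
  have [n _ /(_ n (leqnn n)) Dn0] := HD 0.
  have := df n 0; have -> : normsq (0 : 'rV[R]_r.+1) = 0.
    by rewrite /normsq big1 // => i _; rewrite mxE expr0n.
  rewrite mulr0 oppr0 expR0 mulr1 => h; apply: le_trans (h _) => // i.
  by rewrite mxE.
pose h x : R := expR (- (c * x ^+ 2)).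
have ih : mu.-integrable setT (EFin \o h).
  have c20 : 0 < 2 * c by rewrite mulr_gt0.
  have [I _] := gauss_integral_shift 0 c20.
  congr (_.-integrable _ _): I; apply/funext => x /=; congr (expR _)%:E.
  by rewrite addr0 [2 * c]mulrC mulfK.
have iBh b : mu.-integrable setT (EFin \o (fun x => b * h x)).
  rewrite (_ : _ \o _ = fun x => (b%:E * (h x)%:E)%E); last first.
    by apply/funext => x /=; rewrite EFinM.
  exact: integrableZl.
have h0 x : 0 <= h x by exact: expR_ge0.
apply: (IH _ _ (B * Rintegral mu setT h)).
- by move=> n; exact: bdcont_step.
- move=> n u Du; rewrite mulrAC.
  refine (le_trans (@le_normr_Rintegral _ _ _ mu _ _ (mD n) (bdcont_integrable (mD n) (fD n) u (bf n))) _).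
  rewrite -RintegralZl // Rintegral_mkcond; apply: le_Rintegral => //.
  + rewrite -restrict_EFin; refine (proj1 (@integrable_mkcond _ _ _ mu _ _ (mD n)) _).
    have := integrable_abse (bdcont_integrable (mD n) (fD n) u (bf n)).
    by congr (_.-integrable _ _).
  move=> x _; rewrite patchE; case: ifPn => [/set_mem Dx|_]; last first.
    by rewrite !mulr_ge0 // expR_ge0.
  apply: le_trans (df n _ _) _; first exact: consv_dom.
  by rewrite normsq_consv mulrDr opprD expRD mulrA mulrAC.
- move=> u.
  have HDu : \forall n \near \oo, forall i, D_ n (u 0 i).
    by apply: filter_forall => i; exact: HD.
  have [N _ HN] := HDu.
  (* The domination at [consv x u] requires [u] to lie in the box, which is known only from [N] on;
     the earlier domains are emptied. *)
  pose D' n := if (N <= n)%N then D_ n else set0.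
  suff : Rintegral mu (D' n) (fun x => f_ n (consv x u)) @[n --> \oo]
         --> Rintegral mu setT (fun x => f (consv x u)).
    apply: cvg_trans; apply: near_eq_cvg; exists N => // n Nn /=.
    by rewrite /D' Nn.
  apply: (cvg_Rintegral_dominated (h := fun x => (B * expR (- (c * normsq u))) * h x)).
  + by move=> n; rewrite /D'; case: ifP.
  + exact: measurableT.
  + by move=> n; apply: sqcont_measurable; case: (bf n).
  + exact: iBh.
  + by move=> x; rewrite !mulr_ge0 // expR_ge0.
  + move=> n x; rewrite /D'; case: ifP => // Nn Dx.
    apply: le_trans (df n _ _) _; first by apply: consv_dom => //; exact: HN.
    by rewrite normsq_consv mulrDr opprD expRD mulrA mulrAC.
  + move=> x; rewrite patchE in_setT.
    apply: cvg_trans (cf (consv x u)); apply: near_eq_cvg.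
    near=> n; rewrite patchE mem_set //; rewrite /D' ifT; near: n; first exact: HD.
    by exists N.
Unshelve. all: by end_near.
Qed.

End Nested.

(** * Gaussian integrals in several variables, by Schur complements *)

Section GaussN.
Variable R : realType.
Let mu := @lebesgue_measure R.

Definition qform r (A : 'M[R]_r) (u : 'rV[R]_r) : R := (u *m A *m u^T) 0 0.

(** Completing the square in the first coordinate; what remains is the form of the Schur
    complement. *)
Lemma qform_consv r (a : R) (b : 'rV[R]_r) (C : 'M[R]_r) x u : a != 0 ->
  qform (block_mx (a%:M : 'M[R]_1) b b^T C : 'M[R]_r.+1) (consv x u) =
  a * (x + (b *m u^T) 0 0 / a) ^+ 2 + qform (C - a^-1 *: (b^T *m b)) u.
Proof.
move=> a0; rewrite /qform /consv (@mul_row_block _ 1 1 r 1 r) (@tr_row_mx _ 1 1 r).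
rewrite (@mul_row_col _ 1 1 r 1) mulmxDl mulmxDl !tr_scalar_mx.
rewrite mulmxBr mulmxBl -scalemxAr -scalemxAl.
set be := (b *m u^T) 0 0.
have ub : (u *m b^T) 0 0 = be.
  by rewrite /be -[u *m b^T]trmxK trmx_mul trmxK mxE.
rewrite -!scalar_mxM mul_scalar_mx !mul_mx_scalar -!scalemxAl.
rewrite [in u *m (_ *m _)]mulmxA -[u *m b^T *m b *m _]mulmxA.
rewrite !mxE.
have -> : \sum_j u 0 j * b^T j 0 = be by rewrite -ub mxE.
have -> : \sum_j b 0 j * u^T j 0 = be by rewrite /be mxE.
have -> : \sum_j (u *m b^T) 0 j * (b *m u^T) j 0 = be * be by rewrite big_ord1 ub.
by rewrite eqxx mulr1n; field.
Qed.

Definition posdefmx r (A : 'M[R]_r) : Prop :=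
  A^T = A /\ forall u, u != 0 -> 0 < qform A u.

Lemma posdef_schur r (A : 'M[R]_r.+1) : posdefmx A ->
  exists a b (C : 'M[R]_r), [/\ A = block_mx (a%:M : 'M[R]_1) b b^T C, 0 < a,
    \det A = a * \det (C - a^-1 *: (b^T *m b)) &
    posdefmx (C - a^-1 *: (b^T *m b))].
Proof.
move=> [sA pA].
pose B : 'M[R]_(1 + r) := A.
have sB : B^T = B by [].
set a := (ulsubmx B) 0 0; set b := ursubmx B; set C := drsubmx B.
have EA : A = block_mx (a%:M : 'M[R]_1) b b^T C.
  have E1 : ulsubmx B = a%:M by rewrite [LHS]mx11_scalar.
  have E2 : dlsubmx B = b^T by rewrite /b trmx_ursub sB.
  by rewrite -E1 -E2; exact: (esym (submxK B)).
have sC : C^T = C by rewrite /C trmx_drsub sB.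
have a0 : 0 < a.
  have e0 : delta_mx 0 ord0 != 0 :> 'rV[R]_r.+1.
    by apply/eqP => /matrixP /(_ 0 ord0) /eqP; rewrite !mxE !eqxx oner_eq0.
  have := pA _ e0; rewrite /qform -rowE trmx_delta -colE !mxE.
  rewrite /a !mxE; congr (0 < A _ _); exact/val_inj.
have an0 : a != 0 by rewrite gt_eqF.
exists a, b, C; split => //.
  rewrite {1}EA.
  have -> : block_mx (a%:M : 'M[R]_1) b b^T C =
     block_mx 1%:M 0 (a^-1 *: b^T) 1%:M *m
     block_mx (a%:M : 'M[R]_1) b 0 (C - a^-1 *: (b^T *m b)).
    rewrite (@mulmx_block _ 1 r 1 r 1 r) !mul1mx !mul0mx !addr0.
    congr (block_mx _ _ _ _); first by rewrite mul_mx_scalar scalerA divff // scale1r.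
    by rewrite -scalemxAl addrC subrK.
  rewrite det_mulmx (@det_lblock _ 1 r) (@det_ublock _ 1 r) !det1 !mul1r.
  by rewrite det_scalar1.
split.
  by rewrite linearB linearZ /= trmx_mul trmxK sC.
move=> u u0.
(* The first coordinate is chosen to annihilate the square in [qform_consv], so that only the Schur
   complement is tested. *)
have := pA (consv (- ((b *m u^T) 0 0 / a)) u).
rewrite EA qform_consv // addNr expr0n /= mulr0 add0r; apply.
apply: contra u0 => /eqP /(congr1 (@rsubmx _ 1 1 r)).
by rewrite /consv (@row_mxKr _ 1 1 r) linear0 => ->.
Qed.

(** Each integration yields [sqrt (2 pi / a)] for a pivot [a] and passes to the Schur complement,
    while the determinant is the product of the pivots; its positivity comes out of the same
    induction. *)
Lemma nint_gauss r (A : 'M[R]_r) (k : R) : posdefmx A ->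
  0 < \det A /\
  nint setT (fun u => k * expR (- (2^-1 * qform A u)))
  = k * Num.sqrt ((2 * pi) ^+ r / \det A).
Proof.
elim: r A k => [|r IH] A k pA.
  rewrite /= det_mx00 ltr01 /qform !mul0mx mxE mulr0 oppr0 expR0.
  by rewrite expr0 divr1 sqrtr1.
have [a [b [C [EA a0 dA pS]]]] := posdef_schur pA.
have [dS _] := IH _ 0 pS.
split; first by rewrite dA mulr_gt0.
rewrite /=.
have -> : (fun u : 'rV[R]_r => Rintegral mu setT (fun x =>
      k * expR (- (2^-1 * qform A (consv x u))))) =
   fun u => (k * Num.sqrt (2 * pi / a)) *
     expR (- (2^-1 * qform (C - a^-1 *: (b^T *m b)) u)).
  apply/funext => u.
  have [I E] := gauss_integral_shift ((b *m u^T) 0 0 / a) a0.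
  set S := qform _ u; rewrite mulrAC -E -RintegralZl //.
  congr Rintegral; apply/funext => x.
  rewrite EA qform_consv ?gt_eqF // -/S mulrDr opprD expRD.
  rewrite [expR _ * expR _]mulrC mulrA; congr (_ * expR (- _)).
  by rewrite mulrA [2^-1 * a]mulrC.
rewrite (proj2 (IH _ _ pS)) dA -mulrA -sqrtrM.
  by congr (_ * Num.sqrt _); rewrite exprS; field; rewrite !gt_eqF.
by rewrite divr_ge0 ?ltW // mulr_gt0 // pi_gt0.
Qed.

End GaussN.

(** * Trigonometric bounds and characteristic functions *)

Section Trig.
Variable R : realType.
Implicit Types x y : R.

Lemma normr_sin_le x : `|sin x| <= `|x|.
Proof.
wlog x0 : x / 0 <= x.
  move=> H; case: (leP 0 x) => [/H //|/ltW x0].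
  by have := H (- x); rewrite oppr_ge0 sinN !normrN; apply.
have [c _] := @MVT_segment R sin cos 0 x x0
  (fun z _ => is_derive_sin z) (continuous_subspaceT (@continuous_sin R)).
rewrite sin0 !subr0 => ->.
by rewrite normrM ler_piMl // cos_max.
Qed.

Lemma cosE_half x : 1 - cos x = 2 * sin (x / 2) ^+ 2.
Proof.
have {1}-> : x = x / 2 + x / 2 by rewrite -splitr.
by rewrite cosD; have := cos2Dsin2 (x / 2); rewrite !expr2 => h; lra.
Qed.

Lemma cos_ge1B x : 1 - cos x <= x ^+ 2 / 2.
Proof.
rewrite cosE_half.
have := normr_sin_le (x / 2); rewrite normrM (ger0_norm (_ : 0 <= 2^-1)) // => h.
have h2 : `|sin (x / 2)| ^+ 2 <= (`|x| / 2) ^+ 2.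
  by rewrite lerXn2r // nnegrE ?divr_ge0.
by move: h2; rewrite expr_div_n !real_normK ?num_real // => h2; lra.
Qed.

Lemma sin_approx x : `|sin x - x| <= `|x| ^+ 3.
Proof.
wlog x0 : x / 0 <= x.
  move=> H; case: (leP 0 x) => [/H //|/ltW x0].
  by have := H (- x); rewrite oppr_ge0 sinN -opprD !normrN; apply.
have [c /[!in_itv]/= /andP[c0 cx]] := @MVT_segment R sin cos 0 x x0
  (fun z _ => is_derive_sin z) (continuous_subspaceT (@continuous_sin R)).
rewrite sin0 !subr0 => ->.
rewrite -[X in _ - X]mul1r -mulrBl normrM exprSr ler_wpM2r //.
rewrite distrC ger0_norm ?subr_ge0 ?cos_le1 // real_normK ?num_real //.
apply: le_trans (cos_ge1B c) _.
have : c ^+ 2 <= x ^+ 2 by rewrite lerXn2r.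
by have := sqr_ge0 x; lra.
Qed.

Lemma cos_approx x : `|cos x - (1 - x ^+ 2 / 2)| <= x ^+ 4.
Proof.
set z := x / 2.
have -> : cos x - (1 - x ^+ 2 / 2) = - (2 * ((sin z - z) * (sin z + z))).
  have := cosE_half x; rewrite -/z => h.
  have -> : cos x = 1 - 2 * sin z ^+ 2 by rewrite -h; ring.
  by rewrite (_ : x = 2 * z); [field|rewrite /z; field].
rewrite normrN !normrM (ger0_norm (_ : 0 <= 2)) //.
have h1 := sin_approx z.
have h2 : `|sin z + z| <= 2 * `|z|.
  apply: le_trans (ler_normD _ _) _; have := normr_sin_le z; lra.
have h3 : `|sin z - z| * `|sin z + z| <= `|z| ^+ 3 * (2 * `|z|).
  by apply: ler_pM.
have -> : x ^+ 4 = 16 * `|z| ^+ 4.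
  rewrite (_ : `|z| ^+ 4 = z ^+ 4); last first.
    by rewrite (exprM _ 2 2) real_normK ?num_real // -exprM.
  by rewrite /z; field.
have : 0 <= `|z| ^+ 4 by rewrite exprn_ge0.
rewrite [in X in X -> _]exprS => h4.
have -> : `|z| ^+ 4 = `|z| ^+ 3 * `|z| by rewrite exprSr.
rewrite mulrC in h4.
lra.
Qed.

Lemma cos_lower x : `|x| <= pi -> x ^+ 2 / 128 <= 1 - cos x.
Proof.
wlog x0 : x / 0 <= x.
  move=> H; case: (leP 0 x) => [/H //|/ltW x0].
  by have := H (- x); rewrite oppr_ge0 cosN normrN sqrrN; apply.
rewrite ger0_norm // => xpi; rewrite cosE_half; set z := x / 2.
have z0 : 0 <= z by rewrite divr_ge0.
(* With [z = x / 2] the bound [z / 8] gives the constant: [2 (z / 8)^2 = x^2 / 128]. Up to 1/2 the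
   cubic approximation even gives [z / 2]; beyond, monotonicity gives [sin z >= 1 / 4], and
   [z <= pi / 2 < 2]. *)
suff h : z / 8 <= sin z.
  have : (z / 8) ^+ 2 <= sin z ^+ 2.
    by rewrite lerXn2r // nnegrE ?divr_ge0 // (le_trans _ h) // divr_ge0.
  rewrite (_ : x = 2 * z); last by rewrite /z; field.
  have -> : (2 * z) ^+ 2 / 128 = 2 * (z / 8) ^+ 2 by field.
  lra.
have hs y : 0 <= y -> y <= 2^-1 -> y / 2 <= sin y.
  move=> y0 y1; have := sin_approx y; rewrite (ger0_norm y0) ler_norml => /andP[h _].
  have : y ^+ 3 <= y / 4.
    rewrite exprSr mulrC ler_wpM2l //.
    have : y ^+ 2 <= 2^-1 ^+ 2 by rewrite lerXn2r // nnegrE.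
    by rewrite exprVn -natrX.
  by lra.
case: (leP z 2^-1) => [zs|zl]; first by have := hs z z0 zs; lra.
have pi2 := @pihalf_ge1 R; have zpi : z <= pi / 2 by rewrite /z ler_pM2r.
have pi2' := @pihalf_lt2 R.
have : sin 2^-1 <= sin z.
  rewrite le_eqVlt; apply/orP; right; rewrite ltr_sin // in_itv /=; apply/andP; split => //; lra.
have := hs 2^-1; rewrite lexx invr_ge0 ler0n => /(_ isT isT); lra.
Qed.

Lemma expRN_approx y : 0 <= y -> `|expR (- y) - (1 - y)| <= y ^+ 2.
Proof.
move=> y0; rewrite ger0_norm; last by rewrite subr_ge0 expR_ge1Dx.
rewrite expRN; have h := expR_ge1Dx y.
have y1 : 0 < 1 + y by lra.
have : (expR y)^-1 <= (1 + y)^-1 by rewrite lef_pV2 // posrE expR_gt0.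
have : (1 + y)^-1 <= 1 - y + y ^+ 2.
  rewrite invf_ple ?posrE //; last by nra.
  rewrite invf_ple ?posrE //; last by nra.
  rewrite -[leLHS]mul1r ler_pdivrMr //.
  have : 0 <= y ^+ 3 by rewrite exprn_ge0.
  rewrite exprS; nra.
lra.
Qed.

Lemma periodicz (f : R -> R) u : periodic f u ->
  forall x (l : int), f (x + u * l%:~R) = f x.
Proof.
move=> pf; have pn (n : nat) x : f (x + u * n%:R) = f x.
  elim: n => [|n IH]; first by rewrite mulr0 addr0.
  by rewrite -IH -addn1 natrD mulrDr mulr1 addrA pf.
move=> x [n|n]; first exact: pn.
by rewrite NegzE intrN mulrN -[LHS](pn n.+1) subrK.
Qed.

End Trig.

Lemma cvg_sumr (R : realType) (I : Type) (s : seq I) (P : pred I)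
    (f : I -> nat -> R) (l : I -> R) :
  (forall i, P i -> f i n @[n --> \oo] --> l i) ->
  \sum_(i <- s | P i) f i n @[n --> \oo] --> \sum_(i <- s | P i) l i.
Proof.
move=> h; elim: s => [|i s IH].
  by rewrite big_nil; under eq_fun do rewrite big_nil; exact: cvg_cst.
rewrite big_cons; under eq_fun do rewrite big_cons.
by case: ifP => // Pi; apply: cvgD => //; exact: h.
Qed.

Section CosIntegral.
Variable R : realType.
Let mu := @lebesgue_measure R.
Variables (s : R) (s0 : 0 < s).
Let D : set R := `[- (pi * s), pi * s].

Let pis : 0 < pi * s. Proof. by rewrite mulr_gt0 // pi_gt0. Qed.

Lemma mu_box : mu D = (2 * pi * s)%:E.
Proof.
rewrite /mu lebesgue_measure_itv /= lte_fin gtrN // -EFinB.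
by congr (_%:E); ring.
Qed.

Lemma box_finite : (mu D < +oo)%E. Proof. by rewrite mu_box ltry. Qed.

Lemma box_measurable : measurable D. Proof. exact: measurable_itv. Qed.

(** For [l] nonzero the primitive takes equal values at the two ends, which lie [l] full periods
    apart. The phase [g] will carry the other coordinates of a scalar product in [nint_cos]. *)
Lemma Rintegral_cos (l : int) (g : R) :
  Rintegral mu D (fun x => cos (l%:~R * x / s + g))
  = (2 * pi * s) * (l == 0)%:R * cos g.
Proof.
case: eqVneq => [->|l0].
  under eq_Rintegral do rewrite mul0r mul0r add0r.
  rewrite Rintegral_cst; last exact: box_measurable.
  by rewrite mulr1 mulrC; congr (_ * _); exact: (congr1 fine mu_box).
have lR : l%:~R != 0 :> R by rewrite intr_eq0.
have sn0 : s != 0 by rewrite gt_eqF.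
pose F x := s / l%:~R * sin (l%:~R * x / s + g).
have dF (x : R) : is_derive x 1 F (cos (l%:~R * x / s + g)).
  pose h x := l%:~R * x / s + g.
  have dh : is_derive x 1 h (l%:~R / s).
    have dk := is_deriveD (is_deriveZ (l%:~R / s) (is_derive_id x 1)) (is_derive_cst g x 1).
    have -> : h = (l%:~R / s) \*: (@id R) + cst g.
      apply/funext => y; change (l%:~R * y / s + g = (l%:~R / s) * y + g); ring.
    by apply: is_derive_eq dk _; rewrite addr0 /GRing.scale /= mulr1.
  have dsh : is_derive x 1 (sin \o h) (cos (h x) * (l%:~R / s)).
    exact: is_derive1_comp.
  rewrite /F (_ : (fun x => _) = (s / l%:~R) \*: (sin \o h)); last by [].
  apply: (is_derive_eq (is_deriveZ _ dsh)).
  change (s / l%:~R * (cos (h x) * (l%:~R / s)) = cos (h x)).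
  by field; rewrite lR sn0.
have cF (x : R) : {for x, continuous F}.
  by apply: differentiable_continuous; apply/derivable1_diffP; apply: ex_derive.
rewrite mulr0 mul0r /Rintegral (@continuous_FTC2 _ _ F).
- rewrite /= /F.
  have -> : l%:~R * (pi * s) / s + g = (l%:~R * - (pi * s) / s + g) + (pi *+ 2) * l%:~R.
    by rewrite mulr2n; field.
  by rewrite periodicz ?subrr //; exact: sinD2pi.
- by rewrite gtrN.
- apply: continuous_subspaceT => x.
  apply: (@continuous_cvg _ _ _ _ _ _ cos); first exact: continuous_cos.
  apply: cvgD; last exact: cvg_cst.
  by apply: cvgM; [apply: cvgM; [exact: cvg_cst|exact: cvg_id]|exact: cvg_cst].
- split.
  + by move=> x _; exact: ex_derive.
  + by apply: cvg_at_right_filter; exact: cF.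
  + by apply: cvg_at_left_filter; exact: cF.
- by move=> x _; rewrite derive1E; exact: derive_val.
Qed.

Definition dotp r (k : 'rV[int]_r) (u : 'rV[R]_r) : R :=
  \sum_i (k 0 i)%:~R * u 0 i.

Lemma dotp_consv r (k : 'rV[int]_r.+1) (x : R) (u : 'rV[R]_r) :
  dotp k (consv x u) = (k 0 0)%:~R * x + dotp (\row_i k 0 (rshift 1 i)) u.
Proof.
rewrite /dotp (@big_split_ord _ _ _ 1 r) /= big_ord1 consvl; congr (_%:~R * _ + _).
  by congr (k _ _); exact/val_inj.
by apply: eq_bigr => i _; rewrite consvr mxE.
Qed.

Lemma dotp_cvg r (k : 'rV[int]_r) (u_ : nat -> 'rV[R]_r) (u : 'rV[R]_r) :
  (forall i, u_ n 0 i @[n --> \oo] --> u 0 i) ->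
  dotp k (u_ n) @[n --> \oo] --> dotp k u.
Proof.
move=> cu; apply: cvg_sumr => i _.
by apply: cvgM; [exact: cvg_cst|exact: cu].
Qed.

Lemma bdcont_cos r (k : 'rV[int]_r) (g : R) :
  bdcont (fun u => cos (dotp k u / s + g)).
Proof.
split; last by exists 1 => u; exact: cos_max.
move=> u_ u cu; apply: (@continuous_cvg _ _ _ _ _ _ cos); first exact: continuous_cos.
apply: cvgD; last exact: cvg_cst.
by apply: cvgM; [exact: dotp_cvg|exact: cvg_cst].
Qed.

Lemma nint_cos r (k : 'rV[int]_r) (g : R) :
  nint D (fun u => cos (dotp k u / s + g))
  = (2 * pi * s) ^+ r * (k == 0)%:R * cos g.
Proof.
elim: r k g => [|r IH] k g /=.
  by rewrite /dotp big_ord0 mul0r add0r [k]thinmx0 eqxx expr0 !mul1r.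
pose k' := \row_i k 0 (rshift 1 i) : 'rV[int]_r.
have -> : (fun u : 'rV[R]_r => Rintegral mu D (fun x => cos (dotp k (consv x u) / s + g)))
   = fun u => (2 * pi * s * (k 0 0 == 0)%:R) * cos (dotp k' u / s + g).
  apply/funext => u; rewrite -Rintegral_cos.
  by apply: eq_Rintegral => x _; rewrite dotp_consv mulrDl addrA.
rewrite nintZ; [|exact: box_measurable|exact: box_finite|exact: bdcont_cos].
rewrite IH exprS.
suff -> : ((k == 0)%:R : R) = (k 0 0 == 0)%:R * (k' == 0)%:R by ring.
rewrite -natrM mulnb; congr (nat_of_bool _)%:R.
apply/eqP/andP => [k0|[/eqP k0 /eqP k'0]].
  by rewrite k0 mxE eqxx; split => //; apply/eqP/rowP => i; rewrite !mxE k0 mxE.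
apply/rowP => i; rewrite mxE; case: (@split_ordP 1 r i) => j ->.
  by rewrite ord1 -[RHS]k0; congr (k _ _); exact/val_inj.
by have := congr1 (fun A : 'rV[int]_r => A 0 j) k'0; rewrite !mxE.
Qed.

End CosIntegral.

(** * Complex phases and one-dimensional characteristic functions *)

Local Notation normc := ComplexField.Normc.normc.

Section Cis.
Variable R : realType.
Implicit Types (x y : R) (z : R[i]).

Definition cis x : R[i] := cos x +i* sin x.

Lemma cisD x y : cis (x + y) = cis x * cis y.
Proof. by rewrite /cis cosD sinD; simpc; congr (_ +i* _); ring. Qed.

Lemma cis0 : cis 0 = 1. Proof. by rewrite /cis cos0 sin0. Qed.

Lemma normc_cis x : normc (cis x) = 1.
Proof. by rewrite /normc /cis cos2Dsin2 sqrtr1. Qed.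

Lemma cis_sum (I : Type) (s : seq I) (F : I -> R) :
  cis (\sum_(i <- s) F i) = \prod_(i <- s) cis (F i).
Proof. by elim/big_rec2: _ => [|i y z _ <-]; rewrite ?cis0 // cisD. Qed.

Lemma normc_ge0 z : 0 <= normc z.
Proof. by case: z => a b; exact: sqrtr_ge0. Qed.

Lemma normcX z n : normc (z ^+ n) = normc z ^+ n.
Proof.
elim: n => [|n IH]; first by rewrite !expr0 Normc.normc1.
by rewrite !exprS Normc.normcM IH.
Qed.

Lemma normc_real x : normc x%:C = `|x|.
Proof. by rewrite /= expr0n addr0 sqrtr_sqr. Qed.

Lemma normc_sum (I : Type) (s : seq I) (P : pred I) (F : I -> R[i]) :
  normc (\sum_(i <- s | P i) F i) <= \sum_(i <- s | P i) normc (F i).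
Proof.
elim/big_rec2: _ => [|i y z _ h]; first by rewrite Normc.normc0.
by rewrite (le_trans (le_normcD _ _)) // lerD2l.
Qed.

Lemma normc_ge_Re z : `|complex.Re z| <= normc z.
Proof.
by case: z => a b /=; rewrite -sqrtr_sqr ler_sqrt ?addr_ge0 ?sqr_ge0 // lerDl sqr_ge0.
Qed.

Lemma normc_ge_Im z : `|complex.Im z| <= normc z.
Proof.
by case: z => a b /=; rewrite -sqrtr_sqr ler_sqrt ?addr_ge0 ?sqr_ge0 // lerDr sqr_ge0.
Qed.

Lemma normc_le_ReIm z : normc z <= `|complex.Re z| + `|complex.Im z|.
Proof.
case: z => a b /=; rewrite -[leRHS]ger0_norm ?addr_ge0 // -sqrtr_sqr.
rewrite ler_sqrt ?sqr_ge0 // sqrrD !real_normK ?num_real // lerD2r lerDl.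
by rewrite mulrn_wge0 // mulr_ge0.
Qed.

Lemma normc_sqr z : normc z ^+ 2 = complex.Re z ^+ 2 + complex.Im z ^+ 2.
Proof. by case: z => a b /=; rewrite sqr_sqrtr // addr_ge0 ?sqr_ge0. Qed.

Lemma normc_subX (a b : R[i]) n : normc a <= 1 -> normc b <= 1 ->
  normc (a ^+ n - b ^+ n) <= n%:R * normc (a - b).
Proof.
move=> a1 b1; elim: n => [|n IH]; first by rewrite !expr0 subrr Normc.normc0 mul0r.
have -> : a ^+ n.+1 - b ^+ n.+1 = a * (a ^+ n - b ^+ n) + (a - b) * b ^+ n.
  by rewrite !exprS; ring.
apply: le_trans (le_normcD _ _) _.
rewrite -natr1 [leRHS]mulrDl mul1r !Normc.normcM normcX; apply: lerD.
  by apply: le_trans IH; rewrite ler_piMl // normc_ge0.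
by rewrite ler_piMr ?normc_ge0 // exprn_ile1 // normc_ge0.
Qed.

Lemma Re_sum (I : Type) (s : seq I) (P : pred I) (F : I -> R[i]) :
  complex.Re (\sum_(i <- s | P i) F i) = \sum_(i <- s | P i) complex.Re (F i).
Proof. by elim/big_rec2: _ => [//|i y z _ <-]; rewrite raddfD. Qed.

Lemma Im_sum (I : Type) (s : seq I) (P : pred I) (F : I -> R[i]) :
  complex.Im (\sum_(i <- s | P i) F i) = \sum_(i <- s | P i) complex.Im (F i).
Proof. by elim/big_rec2: _ => [//|i y z _ <-]; rewrite raddfD. Qed.

Lemma Re_realM x z : complex.Re (x%:C * z) = x * complex.Re z.
Proof. by case: z => a b; simpc. Qed.

Lemma Im_realM x z : complex.Im (x%:C * z) = x * complex.Im z.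
Proof. by case: z => a b; simpc. Qed.

End Cis.

Section CharFun.
Variables (R : realType) (J : finType) (p y : J -> R).
Hypotheses (p_gt0 : forall j, 0 < p j) (p_sum : \sum_j p j = 1).

Definition charfun (s : R) : R[i] := \sum_j (p j)%:C * cis (y j / s).

Let p_ge0 j : 0 <= p j. Proof. exact: ltW. Qed.

Lemma normc_wsum (P : pred J) s :
  normc (\sum_(j | P j) (p j)%:C * cis (y j / s)) <= \sum_(j | P j) p j.
Proof.
apply: le_trans (normc_sum _ _ _) _; apply: ler_sum => j _.
by rewrite Normc.normcM normc_cis mulr1 normc_real ger0_norm.
Qed.

Lemma normc_charfun_le1 s : normc (charfun s) <= 1.
Proof. by rewrite -p_sum; exact: normc_wsum. Qed.

(** The outcome [j0] contributes [p j0] with phase 1, and the rest [w] has modulus at most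
    [1 - p j0]. Expanding the square of the sum leaves [1 - 2 p0 (1 - p0 - Re w)], and the bracket
    is the sum on the right. *)
Lemma charfun_sqr_le (j0 : J) s : y j0 = 0 ->
  normc (charfun s) ^+ 2 <= 1 - 2 * p j0 * \sum_j p j * (1 - cos (y j / s)).
Proof.
move=> y0; rewrite /charfun (bigD1 j0) //= y0 mul0r cis0 mulr1.
set w := \sum_(j | j != j0) _.
have hw : normc w <= 1 - p j0.
  apply: le_trans (normc_wsum _ _) _.
  by rewrite -p_sum [in leRHS](bigD1 j0) //= addrAC subrr add0r.
have hw2 : complex.Re w ^+ 2 + complex.Im w ^+ 2 <= (1 - p j0) ^+ 2.
  rewrite -normc_sqr lerXn2r // nnegrE ?normc_ge0 //.
  exact: le_trans (normc_ge0 _) hw.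
have -> : \sum_j p j * (1 - cos (y j / s)) = 1 - p j0 - complex.Re w.
  rewrite (bigD1 j0) //= y0 mul0r cos0 subrr mulr0 add0r.
  under eq_bigr do rewrite mulrBr mulr1.
  rewrite sumrB -p_sum [in RHS](bigD1 j0) //= [p j0 + _]addrC addrK; congr (_ - _).
  by rewrite /w Re_sum; apply: eq_bigr => j _; rewrite Re_realM.
rewrite normc_sqr !raddfD /= add0r.
by have := p_gt0 j0; move: hw2; rewrite !expr2; nra.
Qed.

Hypothesis y_mean : \sum_j p j * y j = 0.
Let var := \sum_j p j * y j ^+ 2.

Let var_div_ge0 s : 0 <= var / (2 * s ^+ 2).
Proof.
apply: divr_ge0; last by apply: mulr_ge0 => //; exact: sqr_ge0.
by apply: sumr_ge0 => j _; apply: mulr_ge0 => //; exact: sqr_ge0.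
Qed.

Let c4 := \sum_j p j * y j ^+ 4.
Let c3 := \sum_j p j * `|y j| ^+ 3.

(** The real part agrees with the Gaussian to second order, leaving fourth-order errors. In the
    imaginary part centring removes the linear term, leaving the third absolute moment. *)
Lemma charfun_approx (s : R) : 0 < s ->
  normc (charfun s - (expR (- (var / (2 * s ^+ 2))))%:C) <=
  (c4 + (var / 2) ^+ 2) * s^-1 ^+ 4 + c3 * s^-1 ^+ 3.
Proof.
move=> s0.
apply: le_trans (normc_le_ReIm _) _; rewrite !raddfB /= subr0; apply: lerD.
  rewrite [leRHS]mulrDl.
  have -> : complex.Re (charfun s) - expR (- (var / (2 * s ^+ 2))) =
    (\sum_j p j * (cos (y j / s) - (1 - (y j / s) ^+ 2 / 2))) +
    ((1 - var / (2 * s ^+ 2)) - expR (- (var / (2 * s ^+ 2)))).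
    rewrite addrA; congr (_ - _).
    rewrite /charfun Re_sum.
    under eq_bigr do rewrite Re_realM /=.
    have -> : 1 - var / (2 * s ^+ 2) = \sum_j p j * (1 - (y j / s) ^+ 2 / 2).
      rewrite /var -{1}p_sum mulr_suml -sumrB; apply: eq_bigr => j _.
      by field; rewrite gt_eqF.
    by rewrite -big_split; apply: eq_bigr => j _ /=; ring.
  apply: le_trans (ler_normD _ _) _; apply: lerD.
    apply: le_trans (ler_norm_sum _ _ _) _; rewrite /c4 mulr_suml; apply: ler_sum => j _.
    rewrite normrM ger0_norm // -mulrA ler_wpM2l //.
    by apply: le_trans (cos_approx _) _; rewrite exprMn.
  rewrite distrC; apply: le_trans (expRN_approx _) _.
    exact: var_div_ge0.
  by rewrite le_eqVlt; apply/orP; left; apply/eqP; field; rewrite gt_eqF.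
rewrite /charfun Im_sum.
have -> : \sum_j complex.Im ((p j)%:C * cis (y j / s)) =
   \sum_j p j * (sin (y j / s) - y j / s).
  under [RHS]eq_bigr do rewrite mulrBr mulrA.
  rewrite sumrB -mulr_suml y_mean mul0r subr0.
  by apply: eq_bigr => j _; rewrite Im_realM.
apply: le_trans (ler_norm_sum _ _ _) _; rewrite /c3 mulr_suml; apply: ler_sum => j _.
rewrite normrM ger0_norm // -mulrA ler_wpM2l //.
by apply: le_trans (sin_approx _) _; rewrite normrM normfV (gtr0_norm s0) exprMn.
Qed.

(** The central limit theorem for characteristic functions: taking the power multiplies the error of
    [charfun_approx] by at most [n + 1 = s ^ 2], which leaves orders [s ^ -2] and [s ^ -1]. *)
Lemma charfun_pow_cvg :
  normc (charfun (Num.sqrt n.+1%:R) ^+ n.+1 - (expR (- (var / 2)))%:C) @[n --> \oo] --> (0 : R).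
Proof.
pose t n : R := (Num.sqrt n.+1%:R)^-1.
have ct : t n @[n --> \oo] --> (0 : R).
  have h : (fun n => n.+1%:R^-1 : R) @ \oo --> (0 : R) by exact: cvg_harmonic.
  have h2 : Num.sqrt (n.+1%:R^-1) @[n --> \oo] --> Num.sqrt (0 : R).
    by apply: (@continuous_cvg _ _ _ _ _ _ (@Num.sqrt R)); [exact: sqrt_continuous|exact: h].
  rewrite sqrtr0 in h2; rewrite (_ : t = fun n => Num.sqrt (n.+1%:R^-1)) //.
  by apply/funext => n; rewrite /t /= sqrtrV.
apply: (squeeze_cvgr (f := fun=> 0) (h := fun n => (c4 + (var / 2) ^+ 2) * t n ^+ 2 + c3 * t n)).
- near=> n; rewrite normc_ge0 /=.
  set s := Num.sqrt _; have s0 : 0 < s by rewrite sqrtr_gt0.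
  have s2 : s ^+ 2 = n.+1%:R by rewrite sqr_sqrtr.
  have -> : expR (- (var / 2)) = expR (- (var / (2 * s ^+ 2))) ^+ n.+1.
    by rewrite -expRM_natl -s2; congr expR; field; rewrite gt_eqF.
  rewrite rmorphXn.
  apply: le_trans (normc_subX _ _ _) _; first exact: normc_charfun_le1.
    rewrite normc_real ger0_norm ?expR_ge0 // -[leRHS]expR0 ler_expR oppr_le0.
    exact: var_div_ge0.
  rewrite -s2; apply: le_trans (ler_wpM2l _ (charfun_approx s0)) _; first exact: sqr_ge0.
  by rewrite le_eqVlt; apply/orP; left; apply/eqP; rewrite /t -/s; field; rewrite gt_eqF.
- exact: cvg_cst.
- have -> : (0 : R) = (c4 + (var / 2) ^+ 2) * 0 ^+ 2 + c3 * 0 by rewrite expr0n /= !mulr0 addr0.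
  apply: cvgD; apply: cvgM; [exact: cvg_cst| |exact: cvg_cst|exact: ct].
  by rewrite expr2; under eq_fun do rewrite expr2; apply: cvgM.
Unshelve. all: by end_near.
Qed.

End CharFun.

(** * Local limit theorem for lattice walks *)

Lemma intr_sum (R : pzRingType) (I : Type) (s : seq I) (P : pred I) (F : I -> int) :
  (\sum_(i <- s | P i) F i)%:~R = \sum_(i <- s | P i) (F i)%:~R :> R.
Proof. exact: rmorph_sum. Qed.

Section LatticeCharFun.
Variables (R : realType) (r : nat) (J : finType).
Variables (p : J -> R) (v : J -> 'rV[int]_r) (j0 : J) (a : 'I_r -> J -> int).
Hypotheses (p_gt0 : forall j, 0 < p j) (p_sum : \sum_j p j = 1).
Hypotheses (v0 : v j0 = 0)
  (v_gen : forall i l, \sum_j a i j * v j 0 l = (i == l)%:R).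
Let mu := @lebesgue_measure R.

(** Words label the product basis of a tensor power. Read as paths of a walk with steps [v], they
    make [latP] the law of its endpoint after [m] independent steps. *)
Definition wordP m (x : {ffun 'I_m -> J}) : R := \prod_i p (x i).
Definition wordV m (x : {ffun 'I_m -> J}) : 'rV[int]_r := \sum_i v (x i).
Definition latP m (k : 'rV[int]_r) : R :=
  \sum_(x : {ffun 'I_m -> J} | wordV x == k) wordP x.

Let dv (u : 'rV[R]_r) j := dotp (v j) u.
Let mean u := \sum_j p j * dv u j.
Let yc u j := dv u j - mean u.

Let p_ge0 j : 0 <= p j. Proof. exact: ltW. Qed.

Lemma dotpD (k l : 'rV[int]_r) (u : 'rV[R]_r) : dotp (k + l) u = dotp k u + dotp l u.
Proof. by rewrite /dotp -big_split; apply: eq_bigr => i _; rewrite mxE intrD mulrDl. Qed.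

Lemma dotpN (k : 'rV[int]_r) (u : 'rV[R]_r) : dotp (- k) u = - dotp k u.
Proof. by rewrite /dotp -sumrN; apply: eq_bigr => i _; rewrite mxE intrN mulNr. Qed.

Lemma dotp_sum (I : finType) (F : I -> 'rV[int]_r) (u : 'rV[R]_r) :
  dotp (\sum_i F i) u = \sum_i dotp (F i) u.
Proof.
elim/big_rec2: _ => [|i y z _ <-]; last by rewrite dotpD.
by rewrite /dotp big1 // => i _; rewrite mxE mul0r.
Qed.

Lemma charfun_pow m (k : 'rV[int]_r) (u : 'rV[R]_r) (s : R) :
  \sum_(x : {ffun 'I_m -> J}) wordP x * cos (dotp (wordV x - k) u / s)
  = complex.Re (charfun p (dv u) s ^+ m * cis (- (dotp k u / s))).
Proof.
have -> : charfun p (dv u) s ^+ m =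
    \sum_(x : {ffun 'I_m -> J}) (wordP x)%:C * cis (dotp (wordV x) u / s).
  rewrite -[in LHS](card_ord m) -prodr_const /charfun bigA_distr_bigA.
  apply: eq_bigr => x _; rewrite big_split /=; congr (_ * _).
    by rewrite /wordP rmorph_prod.
  by rewrite -cis_sum /wordV dotp_sum mulr_suml.
rewrite mulr_suml Re_sum; apply: eq_bigr => x _.
by rewrite -mulrA -cisD Re_realM /= dotpD dotpN mulrDl mulNr.
Qed.

(** Fourier inversion on the torus, rescaled by [s]: among all words, only those ending at [k]
    survive the integration. *)
Lemma nint_latP m (k : 'rV[int]_r) (s : R) : 0 < s ->
  nint `[- (pi * s), pi * s]
    (fun u => complex.Re (charfun p (dv u) s ^+ m * cis (- (dotp k u / s))))
  = (2 * pi * s) ^+ r * latP m k.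
Proof.
move=> s0; set D : set R := [set` _].
have bc (x : {ffun 'I_m -> J}) : bdcont (fun u : 'rV[R]_r => cos (dotp (wordV x - k) u / s)).
  have := bdcont_cos s (wordV x - k) 0.
  by congr bdcont; apply/funext => u; rewrite addr0.
have -> : (fun u => complex.Re (charfun p (dv u) s ^+ m * cis (- (dotp k u / s)))) =
   (fun u => \sum_(x : {ffun 'I_m -> J}) wordP x * cos (dotp (wordV x - k) u / s)).
  by apply/funext => u; rewrite charfun_pow.
have mD : measurable D by exact: box_measurable.
have fD : (mu D < +oo)%E by exact: box_finite.
rewrite (nint_sum mD fD); last by move=> x; exact: bdcontZ.
rewrite /latP mulr_sumr [RHS]big_mkcond; apply: eq_bigr => x _.
rewrite (nintZ mD fD) //.
have -> : nint D (fun u : 'rV[R]_r => cos (dotp (wordV x - k) u / s)) =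
   (2 * pi * s) ^+ r * (wordV x - k == 0)%:R.
  rewrite -[RHS]mulr1 -[X in _ = _ * X](cos0 R) -nint_cos //.
  by apply: eq_nint => u; rewrite addr0.
by rewrite subr_eq0; case: eqP => _; rewrite ?mulr0 // mulr1 mulrC.
Qed.

Lemma charfun_center (u : 'rV[R]_r) s :
  charfun p (dv u) s = charfun p (yc u) s * cis (mean u / s).
Proof.
rewrite /charfun mulr_suml; apply: eq_bigr => j _.
by rewrite -mulrA -cisD -mulrDl /yc subrK.
Qed.

Lemma yc_mean u : \sum_j p j * yc u j = 0.
Proof.
under eq_bigr do rewrite /yc mulrBr.
by rewrite sumrB -mulr_suml p_sum mul1r subrr.
Qed.

Definition covmx : 'M[R]_r := \matrix_(i, l) \sum_j p j *
  (((v j 0 i)%:~R - \sum_j' p j' * (v j' 0 i)%:~R) *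
   ((v j 0 l)%:~R - \sum_j' p j' * (v j' 0 l)%:~R)).

Lemma yc_coord u j : yc u j =
  \sum_i ((v j 0 i)%:~R - \sum_j' p j' * (v j' 0 i)%:~R) * u 0 i.
Proof.
rewrite /yc /mean /dv /dotp; under [RHS]eq_bigr do rewrite mulrBl.
rewrite sumrB; congr (_ - _).
under eq_bigr do rewrite mulr_sumr.
rewrite exchange_big; apply: eq_bigr => i _; rewrite mulr_suml.
by apply: eq_bigr => j' _; rewrite mulrA.
Qed.

Lemma qform_covmx u : qform covmx u = \sum_j p j * yc u j ^+ 2.
Proof.
rewrite /qform !mxE.
under eq_bigr => i _ do rewrite !mxE mulr_suml.
under [RHS]eq_bigr => j _ do
  rewrite yc_coord expr2 mulr_suml mulr_sumr.
rewrite [RHS]exchange_big /= exchange_big /=; apply: eq_bigr => i _.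
under [RHS]eq_bigr => j _ do rewrite !mulr_sumr.
rewrite [RHS]exchange_big /=; apply: eq_bigr => l _.
rewrite mxE mulr_sumr mulr_suml; apply: eq_bigr => j _; ring.
Qed.

(** Since the steps generate the lattice, their phases determine [u], and with integer coefficients;
    integrality is what later survives the reduction of phases modulo [2 pi]. *)
Lemma dotp_gen (u : 'rV[R]_r) i : u 0 i = \sum_j (a i j)%:~R * dv u j.
Proof.
rewrite /dv /dotp; under eq_bigr do rewrite mulr_sumr.
rewrite exchange_big /=.
rewrite (bigD1 i) //= [X in _ + X]big1 ?addr0 => [|l li].
  under eq_bigr do rewrite mulrA -intrM.
  by rewrite -mulr_suml -intr_sum v_gen eqxx mul1r.
under eq_bigr do rewrite mulrA -intrM.
by rewrite -mulr_suml -intr_sum v_gen eq_sym (negbTE li) mul0r.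
Qed.

(** Zero variance makes all phases equal to their mean. The phase of [j0] is zero, so all of them
    vanish, and then [u = 0] by [dotp_gen]. *)
Lemma posdef_covmx : posdefmx covmx.
Proof.
split.
  by apply/matrixP => i l; rewrite !mxE; apply: eq_bigr => j _; rewrite [X in p j * X]mulrC.
move=> u u0; rewrite qform_covmx lt_neqAle sumr_ge0 ?andbT; last first.
  by move=> j _; rewrite mulr_ge0 ?sqr_ge0.
apply: contra u0; rewrite eq_sym psumr_eq0; last first.
  by move=> j _; rewrite mulr_ge0 ?sqr_ge0.
move=> /allP h.
have yz j : yc u j = 0.
  have := h j (mem_index_enum _); rewrite mulf_eq0 gt_eqF //= expf_eq0 /=.
  by move/eqP.
have d0 : dv u j0 = 0 by rewrite /dv v0 /dotp big1 // => i _; rewrite mxE mul0r.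
have m0 : mean u = 0 by have := yz j0; rewrite /yc d0 sub0r => /eqP; rewrite oppr_eq0 => /eqP.
apply/eqP/rowP => i; rewrite mxE dotp_gen big1 // => j _.
by have := yz j; rewrite /yc m0 subr0 => ->; rewrite mulr0.
Qed.

(* v_gen says that the steps v j generate the lattice Z^r: this excludes the
   points where the characteristic function would again have modulus 1. *)
Lemma normc_charfun_le : exists2 c : R, 0 < c & forall (u : 'rV[R]_r) s, 0 < s ->
  (forall i, `|u 0 i| <= pi * s) ->
  normc (charfun p (dv u) s) ^+ 2 <= 1 - c * normsq u / s ^+ 2.
Proof.
pose A i := \sum_j `|a i j|%:~R / Num.sqrt (p j).
have A0 i : 0 <= A i.
  by apply: sumr_ge0 => j _; rewrite divr_ge0 ?sqrtr_ge0 // ler0z.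
pose B := 1 + \sum_i A i ^+ 2.
have B0 : 0 < B by rewrite ltr_wpDr // sumr_ge0 // => i _; rewrite sqr_ge0.
(* [2 * p j0] comes from [charfun_sqr_le], 128 from [cos_lower], and [B] bounds the cost of
   recovering [u] from its phases. *)
exists (2 * p j0 / (128 * B)); first by rewrite divr_gt0 // mulr_gt0.
move=> u s s0 us.
apply: le_trans (charfun_sqr_le p_gt0 p_sum (j0 := j0) _ _) _.
  by rewrite /dv v0 /dotp big1 // => i _; rewrite mxE mul0r.
rewrite lerD2l lerN2.
set T := \sum_j _.
suff h : normsq u / s ^+ 2 <= 128 * B * T.
  rewrite -!mulrA ler_wpM2l // ler_wpM2l // ler_pdivrMl ?mulr_gt0 //.
(* round each phase to the nearest multiple of 2 pi *)
pose n j : int := Num.floor (dv u j / s / (2 * pi) + 2^-1).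
pose z j := dv u j / s - (2 * pi) * (n j)%:~R.
have pi0 := @pi_gt0 R.
have zpi j : `|z j| <= pi.
  have h1 := floor_le (dv u j / s / (2 * pi) + 2^-1).
  have h2 := floorD1_gt (dv u j / s / (2 * pi) + 2^-1).
  rewrite -/(n j) intrD in h1 h2.
  have e : dv u j / s = (dv u j / s / (2 * pi)) * (2 * pi) by rewrite divfK // mulf_neq0 // gt_eqF.
  rewrite /z e ler_norml; apply/andP; split; nra.
have cz j : cos (dv u j / s) = cos (z j).
  have -> : dv u j / s = z j + (pi *+ 2) * (n j)%:~R by rewrite /z mulr2n; ring.
  by rewrite periodicz //; exact: cosD2pi.
pose Y := \sum_j p j * z j ^+ 2.
have Y0 : 0 <= Y by apply: sumr_ge0 => j _; rewrite mulr_ge0 ?sqr_ge0.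
have YT : Y <= 128 * T.
  rewrite /Y /T mulr_sumr; apply: ler_sum => j _; rewrite [leRHS]mulrCA ler_wpM2l // cz.
  by have := cos_lower (zpi j); lra.
have zY j : `|z j| <= Num.sqrt Y / Num.sqrt (p j).
  rewrite ler_pdivlMr ?sqrtr_gt0 // -sqrtr_sqr -sqrtrM ?sqr_ge0 // ler_sqrt //.
  rewrite /Y (bigD1 j) //= mulrC lerDl sumr_ge0 // => l _.
  by rewrite mulr_ge0 ?sqr_ge0.
have uz i : `|u 0 i / s| <= A i * Num.sqrt Y.
  have hz : `|\sum_j (a i j)%:~R * z j| <= A i * Num.sqrt Y.
    apply: le_trans (ler_norm_sum _ _ _) _; rewrite mulr_suml; apply: ler_sum => j _.
    by rewrite normrM -intr_norm -mulrA ler_wpM2l ?ler0z // [_^-1 * _]mulrC.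
  apply: le_trans hz.
  pose N : int := \sum_j a i j * n j.
  have e : \sum_j (a i j)%:~R * z j = u 0 i / s - 2 * pi * N%:~R.
    rewrite dotp_gen mulr_suml /N intr_sum mulr_sumr -sumrB.
    by apply: eq_bigr => j _; rewrite /z intrM; ring.
  have us' : `|u 0 i / s| <= pi.
    by rewrite normrM normfV (gtr0_norm s0) ler_pdivrMr.
  (* Rounding shifts the combination by [2 pi N]. As [u 0 i / s] lies within [pi] of zero, a nonzero
     [N] can only make the combination at least as large in modulus. *)
  rewrite e; case: (eqVneq N 0) => [->|N0]; first by rewrite mulr0 subr0.
  apply: (le_trans us').
  have N1 : 1 <= `|N%:~R| :> R.
    by rewrite -intr_norm -[1]/(1%:~R) ler_int -gtz0_ge1 normr_gt0.
  rewrite distrC; apply: le_trans (lerB_normD _ _); rewrite ?normrN.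
  rewrite normrM (gtr0_norm (_ : 0 < 2 * pi)) ?mulr_gt0 //.
  nra.
have -> : normsq u / s ^+ 2 = \sum_i `|u 0 i / s| ^+ 2.
  rewrite /normsq mulr_suml; apply: eq_bigr => i _.
  by rewrite real_normK ?num_real // expr_div_n.
apply: (@le_trans _ _ (\sum_i (A i * Num.sqrt Y) ^+ 2)).
  apply: ler_sum => i _; rewrite lerXn2r // nnegrE mulr_ge0 // sqrtr_ge0.
under eq_bigr do rewrite exprMn sqr_sqrtr //.
rewrite -mulr_suml.
have : \sum_i A i ^+ 2 <= B by rewrite /B lerDr.
have : 0 <= \sum_i A i ^+ 2 by apply: sumr_ge0 => i _; rewrite sqr_ge0.
nra.
Qed.

End LatticeCharFun.

Section LocalLimit.
Variables (R : realType) (r : nat) (J : finType).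
Variables (p : J -> R) (v : J -> 'rV[int]_r) (j0 : J) (a : 'I_r -> J -> int).
Hypotheses (p_gt0 : forall j, 0 < p j) (p_sum : \sum_j p j = 1).
Hypotheses (v0 : v j0 = 0)
  (v_gen : forall i l, \sum_j a i j * v j 0 l = (i == l)%:R).

Let dv (u : 'rV[R]_r) j := dotp (v j) u.
Let mean u := \sum_j p j * dv u j.
Let yc u j := dv u j - mean u.

Let s n : R := Num.sqrt n.+1%:R.
Let D n : set R := `[- (pi * s n), pi * s n].
Let lim : R := Num.sqrt ((2 * pi) ^+ r / \det (covmx p v)).

Let s_gt0 n : 0 < s n. Proof. by rewrite sqrtr_gt0. Qed.
Let s_sqr n : s n ^+ 2 = n.+1%:R. Proof. by rewrite sqr_sqrtr. Qed.

Lemma ler_dist_normc (x y : R[i]) : `|normc x - normc y| <= normc (x - y).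
Proof.
have h (z t : R[i]) : normc z - normc t <= normc (z - t).
  by rewrite lerBlDr; apply: le_trans (le_normcD _ _); rewrite subrK.
rewrite ler_norml h andbT lerNl opprB; apply: le_trans (h _ _) _.
by rewrite -normcN opprB.
Qed.

Lemma cisX (x : R) n : cis x ^+ n = cis (n%:R * x).
Proof.
elim: n => [|n IH]; first by rewrite expr0 mul0r cis0.
by rewrite exprS IH -cisD -natr1 mulrDl mul1r addrC.
Qed.

Let box_exhaust x : \forall n \near \oo, D n x.
Proof.
near=> n; rewrite /D /= in_itv /= -ler_norml.
have h : (Num.truncn (x ^+ 2) < n)%N by near: n; exact: nbhs_infty_gt.
have x2 : x ^+ 2 <= s n ^+ 2.
  rewrite s_sqr; apply: le_trans (ltW (truncnS_gt _)) _.
  by rewrite ler_nat ltnW.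
have xs : `|x| <= s n.
  by rewrite -sqrtr_sqr /s ler_sqrt ?ler0n // -s_sqr.
apply: le_trans xs _; rewrite ler_peMl ?ltW //.
by have := @pihalf_ge1 R; lra.
Unshelve. all: by end_near.
Qed.

Let bdcont_charfun n : bdcont (fun u => normc (charfun p (dv u) (s n)) ^+ n.+1).
Proof.
pose C (u : 'rV[R]_r) := \sum_j p j * cos (dotp (v j) u / s n + 0).
(* The sine is written as a cosine shifted by [pi / 2], so that [bdcont_cos] serves both parts. *)
pose S (u : 'rV[R]_r) := \sum_j p j * cos (dotp (v j) u / s n + - (pi / 2)).
have [cC _] : bdcont C by apply: bdcont_sum => j; apply: bdcontZ; exact: bdcont_cos.
have [cS _] : bdcont S by apply: bdcont_sum => j; apply: bdcontZ; exact: bdcont_cos.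
have E u : normc (charfun p (dv u) (s n)) = Num.sqrt (C u ^+ 2 + S u ^+ 2).
  rewrite -[LHS]ger0_norm ?normc_ge0 // -sqrtr_sqr normc_sqr.
  congr (Num.sqrt (_ ^+ 2 + _ ^+ 2)).
    by rewrite Re_sum; apply: eq_bigr => j _; rewrite Re_realM addr0.
  by rewrite Im_sum; apply: eq_bigr => j _; rewrite Im_realM cosBpihalf.
split; last first.
  exists 1 => u; rewrite ger0_norm ?exprn_ge0 ?normc_ge0 //.
  by rewrite exprn_ile1 ?normc_ge0 ?normc_charfun_le1.
move=> u_ u cu; under eq_fun do rewrite E.
rewrite E.
have h2 : Num.sqrt (C (u_ n0) ^+ 2 + S (u_ n0) ^+ 2) @[n0 --> \oo]
    --> Num.sqrt (C u ^+ 2 + S u ^+ 2).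
  apply: (@continuous_cvg _ _ _ _ _ _ (@Num.sqrt R)); first exact: sqrt_continuous.
  have sq (f : nat -> R) (l : R) : f m @[m --> \oo] --> l -> (f m) ^+ 2 @[m --> \oo] --> l ^+ 2.
    by move=> h; rewrite expr2; under eq_fun do rewrite expr2; apply: cvgM.
  by apply: cvgD; apply: sq; [exact: cC|exact: cS].
apply: (@continuous_cvg _ _ _ _ _ _ (fun x : R => x ^+ n.+1)); last exact: h2.
exact: exprn_continuous.
Qed.

(** From [1 - x <= exp (- x)]; the exponent [n + 1] cancels [s n ^ 2]. The rate is halved because
    [normc_charfun_le] bounds the square of the modulus. *)
Let charfun_dom : exists2 c : R, 0 < c & forall n (u : 'rV[R]_r),
  (forall i, D n (u 0 i)) ->
  normc (charfun p (dv u) (s n)) ^+ n.+1 <= expR (- (c * normsq u)).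
Proof.
have [c c0 hc] := normc_charfun_le p_gt0 p_sum v0 v_gen.
exists (c / 2); first by rewrite divr_gt0.
move=> n u Du.
have -> : expR (- (c / 2 * normsq u)) = expR (- (c / 2 * normsq u / s n ^+ 2)) ^+ n.+1.
  by rewrite -expRM_natl -s_sqr; congr expR; field; rewrite gt_eqF.
rewrite lerXn2r ?nnegrE ?normc_ge0 ?expR_ge0 //.
rewrite -(ler_pXn2r (n := 2)) ?nnegrE ?normc_ge0 ?expR_ge0 //.
apply: le_trans (hc u (s n) (s_gt0 n) _) _.
  by move=> i; have := Du i; rewrite /D /= in_itv /= -ler_norml.
rewrite -expRM_natl; apply: le_trans (expR_ge1Dx _) _.
by rewrite ler_expR le_eqVlt; apply/orP; left; apply/eqP; field; rewrite gt_eqF.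
Qed.

Let charfun_cvg (u : 'rV[R]_r) :
  normc (charfun p (yc u) (s n) ^+ n.+1 - (expR (- (2^-1 * qform (covmx p v) u)))%:C)
    @[n --> \oo] --> (0 : R).
Proof.
have := charfun_pow_cvg p_gt0 p_sum (yc_mean v p_sum u).
by rewrite qform_covmx [2^-1 * _]mulrC.
Qed.

Let gauss_lim : nint setT (fun u => expR (- (2^-1 * qform (covmx p v) u))) = lim.
Proof.
have [_] := nint_gauss 1 (posdef_covmx p_gt0 v0 v_gen); rewrite mul1r /lim => <-.
by congr nint; apply/funext => u; rewrite mul1r.
Qed.

Let charfun_normc u n : normc (charfun p (dv u) (s n)) = normc (charfun p (yc u) (s n)).
Proof. by rewrite charfun_center Normc.normcM normc_cis mulr1. Qed.

(** Taking the modulus of the integrand discards the phase, the only place where [k] enters; hence a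
    bound uniform in [k]. *)
Lemma latP_upper : exists G : nat -> R, G n @[n --> \oo] --> lim /\
  forall n k, (2 * pi * s n) ^+ r * latP p v n.+1 k <= G n.
Proof.
exists (fun n => nint (D n) (fun u => normc (charfun p (dv u) (s n)) ^+ n.+1)); split.
  have [c c0 hc] := charfun_dom.
  rewrite -gauss_lim; apply: (nint_cvg (c := c) (B := 1)) => //.
  - by move=> n; exact: box_measurable.
  - by move=> n; exact: box_finite.
  - move=> n u Du; rewrite mul1r ger0_norm ?exprn_ge0 ?normc_ge0 //; exact: hc.
  - move=> u; apply/cvgrPdist_le => e e0.
    have /cvgrPdist_le /(_ e e0) [N _ HN] := charfun_cvg u.
    exists N => // n /HN; rewrite /= sub0r normrN ger0_norm ?normc_ge0 // => h.
    apply: le_trans h; rewrite charfun_normc -normcX.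
    set E := expR _; have hE : normc E%:C = E by rewrite normc_real ger0_norm ?expR_ge0.
    by rewrite distrC -{1}hE; exact: ler_dist_normc.
move=> n k; rewrite -nint_latP //.
have mD := @box_measurable R (s n); have fD := box_finite (s_gt0 n).
apply: le_nint => //.
  have -> : (fun u => complex.Re (charfun p (fun j => dotp (v j) u) (s n) ^+ n.+1 *
       cis (- (dotp k u / s n)))) =
     (fun u => \sum_(x : {ffun 'I_n.+1 -> J}) wordP p x * cos (dotp (wordV v x - k) u / s n)).
    by apply/funext => u; rewrite charfun_pow.
  apply: bdcont_sum => x; apply: bdcontZ.
  have := bdcont_cos (s n) (wordV v x - k) 0.
  by congr bdcont; apply/funext => u; rewrite addr0.
move=> u _; apply: le_trans (ler_norm _) _; apply: le_trans (normc_ge_Re _) _.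
by rewrite Normc.normcM normc_cis mulr1 normcX.
Qed.

(** The hypothesis places [k_ n] within o(sqrt n) of the mean, so the phase left over after centring
    tends to 1 and the integrand to the Gaussian. *)
Lemma latP_cvg (k_ : nat -> 'rV[int]_r) :
  (forall u : 'rV[R]_r, (n.+1%:R * (\sum_j p j * dotp (v j) u) - dotp (k_ n) u) / s n
     @[n --> \oo] --> (0 : R)) ->
  (2 * pi * s n) ^+ r * latP p v n.+1 (k_ n) @[n --> \oo] --> lim.
Proof.
move=> hk; under eq_fun do rewrite -nint_latP //.
have [c c0 hc] := charfun_dom.
rewrite -gauss_lim; apply: (nint_cvg (D_ := D) (c := c) (B := 1)) => //.
- by move=> n; exact: box_measurable.
- by move=> n; exact: box_finite.
- move=> n.
  have -> : (fun u => complex.Re (charfun p (fun j => dotp (v j) u) (s n) ^+ n.+1 *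
       cis (- (dotp (k_ n) u / s n)))) =
     (fun u => \sum_(x : {ffun 'I_n.+1 -> J}) wordP p x * cos (dotp (wordV v x - k_ n) u / s n)).
    by apply/funext => u; rewrite charfun_pow.
  apply: bdcont_sum => x; apply: bdcontZ.
  have := bdcont_cos (s n) (wordV v x - k_ n) 0.
  by congr bdcont; apply/funext => u; rewrite addr0.
- move=> n u Du; rewrite mul1r; apply: le_trans (normc_ge_Re _) _.
  by rewrite Normc.normcM normc_cis mulr1 normcX; exact: hc.
- move=> u; set E := expR _.
  pose X n := charfun p (yc u) (s n) ^+ n.+1.
  (* The residual phase: that of the mean over [n + 1] steps, less that of the target point. *)
  pose d n := (n.+1%:R * mean u - dotp (k_ n) u) / s n.
  have cd : d n @[n --> \oo] --> (0 : R) by exact: hk.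
  have EX n : complex.Re (charfun p (fun j => dotp (v j) u) (s n) ^+ n.+1 *
       cis (- (dotp (k_ n) u / s n))) =
       complex.Re (X n) * cos (d n) - complex.Im (X n) * sin (d n).
    rewrite charfun_center exprMn cisX -mulrA -cisD -/(X n).
    have -> : n.+1%:R * (mean u / s n) + - (dotp (k_ n) u / s n) = d n.
      by rewrite /d mulrBl mulrA.
    by case: (X n) => x y; rewrite /cis; simpc.
  have cX := charfun_cvg u; rewrite -/E in cX.
  have cRe : complex.Re (X n) @[n --> \oo] --> E.
    apply/cvgrPdist_le => e e0; have /cvgrPdist_le /(_ e e0) [N _ HN] := cX.
    exists N => // n /HN; rewrite /= sub0r normrN ger0_norm ?normc_ge0 // => h.
    by apply: le_trans h; rewrite distrC; apply: le_trans (normc_ge_Re _); rewrite raddfB.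
  have cIm : complex.Im (X n) @[n --> \oo] --> (0 : R).
    apply/cvgrPdist_le => e e0; have /cvgrPdist_le /(_ e e0) [N _ HN] := cX.
    exists N => // n /HN; rewrite /= sub0r normrN ger0_norm ?normc_ge0 // => h.
    by apply: le_trans h; rewrite distrC; apply: le_trans (normc_ge_Im _); rewrite raddfB.
  under eq_fun do rewrite EX.
  have -> : E = E * cos 0 - 0 * sin 0 by rewrite cos0 mulr1 mul0r subr0.
  have ccos : cos (d n) @[n --> \oo] --> (cos 0 : R).
    by apply: (@continuous_cvg _ _ _ _ _ _ (@cos R)); [exact: continuous_cos|exact: cd].
  have csin : sin (d n) @[n --> \oo] --> (sin 0 : R).
    by apply: (@continuous_cvg _ _ _ _ _ _ (@sin R)); [exact: continuous_sin|exact: cd].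
  by apply: cvgB; apply: cvgM.
Qed.

End LocalLimit.

(** * Minors and minimal units *)

Section Minors.

(** [minors_gcd] ranges over increasing column choices only. Any other injective choice differs from
    one of them by a permutation, which changes the minor at most in sign. *)
Lemma sorted_reindex d1 r (f : 'I_r -> 'I_d1) : injective f ->
  exists s : {perm 'I_r}, forall i j : 'I_r, (i < j)%N -> (f (s i) < f (s j))%N.
Proof.
move=> injf; pose le := [rel x y : 'I_d1 | (x <= y)%N].
pose t := [tuple f i | i < r].
have h : perm_eq (sort le t) t by rewrite perm_sort.
have [s hs] := tuple_permP h.
exists s => i j ij.
have st : sorted le (sort le t).
  by apply: sort_sorted => x y; exact: leq_total.
have x0 : 'I_d1 := f i.
have sz : size (sort le t) = r by rewrite size_sort size_tuple.
have nthE k : nth x0 (sort le t) (nat_of_ord k) = f (s k).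
  rewrite hs -[nat_of_ord k]/(nat_of_ord k) (nth_map k) ?size_enum_ord // nth_ord_enum.
  by rewrite tnth_mktuple.
have tr : transitive le by move=> y x z; exact: leq_trans.
have re : reflexive le by move=> x; exact: leqnn.
have H : (f (s i) <= f (s j))%N.
  rewrite -!nthE; apply: (sorted_leq_nth tr re x0 st); rewrite ?inE ?sz //.
  exact: ltnW.
rewrite ltn_neqAle H.
rewrite andbT; apply/eqP => /val_inj /injf /perm_inj e.
by rewrite e ltnn in ij.
Qed.

Lemma minors_gcd_mul d1 r (B : 'M[int]_r) (K : 'M[int]_(r, d1)) :
  minors_gcd (B *m K) = (`|\det B|%N * minors_gcd K)%N.
Proof.
rewrite /minors_gcd; apply: (big_rec2 (fun x y => x = (`|\det B|%N * y)%N)).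
  by rewrite muln0.
move=> f x y _ ->; rewrite -mulmx_colsub det_mulmx abszM muln_gcdr //.
Qed.

(* A prime dividing all maximal minors would make K rank deficient modulo that
   prime, against the right inverse A. *)
Lemma minors_gcd_eq1 d1 r (K : 'M[int]_(r, d1)) (A : 'M[int]_(d1, r)) :
  K *m A = 1%:M -> minors_gcd K = 1%N.
Proof.
move=> KA; apply/eqP; apply: contraT => g1.
have [q pq qg] : exists2 q, prime q & (q %| minors_gcd K)%N.
  case: (posnP (minors_gcd K)) => [->|g0]; first by exists 2.
  exists (pdiv (minors_gcd K)); last exact: pdiv_dvd.
  by apply: pdiv_prime; rewrite ltn_neqAle eq_sym g1.
have hq (f : {ffun 'I_r -> 'I_d1}) :
    (forall i j : 'I_r, (i < j)%N -> (f i < f j)%N) -> (q %| `|\det (colsub f K)|)%N.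
  move=> mf; apply: dvdn_trans qg _; rewrite /minors_gcd (bigD1 f) /= ?dvdn_gcdl //.
  by apply/forallP => i; apply/forallP => j; apply/implyP; exact: mf.
pose Kq : 'M['F_q]_(r, d1) := map_mx intr K.
have fK : row_full Kq^T.
  rewrite -col_leq_rank mxrank_tr.
  have : row_free Kq.
    by apply/row_freeP; exists (map_mx intr A); rewrite -map_mxM KA map_mx1.
  by rewrite -row_leq_rank.
have [g U ginj] : exists2 g : 'I_r -> 'I_d1, rowsub g Kq^T \in unitmx & injective g.
  by exists (fullrankfun fK); [exact: fullrowsub_unit|exact: fullrankfun_inj].
have [s hs] := sorted_reindex ginj.
pose f : {ffun 'I_r -> 'I_d1} := [ffun i => g (s i)].
have /hq : forall i j : 'I_r, (i < j)%N -> (f i < f j)%N.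
  by move=> i j ij; rewrite !ffunE; exact: hs.
have -> : (q %| `|\det (colsub f K)|)%N = ((\det (colsub f K))%:~R == 0 :> 'F_q).
  by rewrite -(dvdz_pcharf (pchar_Fp pq)).
rewrite -[X in X == 0]det_map_mx.
have -> : map_mx intr (colsub f K) = (row_perm s (rowsub g Kq^T))^T.
  by apply/matrixP => i j; rewrite !mxE ffunE.
rewrite det_tr row_permE det_mulmx det_perm mulf_eq0 signr_eq0 /=.
by move: U; rewrite unitmxE unitfE => /negbTE ->.
Qed.

End Minors.

(** * Reduction to units that generate the integer lattice *)

Section Units.
Variables (R : realType) (d1 : nat).

Definition ratindep r (eps : 'I_r -> R) : Prop :=
  forall c : 'I_r -> rat, \sum_(l < r) ratr (c l) * eps l = 0 -> forall l, c l = 0.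

(** A rational relation [c] between the new units gives the relation [M c] between the old ones, and
    [M] is injective over the rationals. *)
Lemma ratindep_mul r r' (eps : 'I_r -> R) (M : 'M[int]_(r, r')) :
  (forall y : 'cV[rat]_r', map_mx intr M *m y = 0 -> y = 0) ->
  ratindep eps -> ratindep (fun k => \sum_l eps l * (M l k)%:~R).
Proof.
move=> injM ie c hc k.
pose y : 'cV[rat]_r' := \col_k c k.
suff : y = 0 by move/colP => /(_ k); rewrite !mxE.
apply: injM; apply/colP => l; rewrite [RHS]mxE.
pose x l := (map_mx intr M *m y) l 0; rewrite -[LHS]/(x l).
apply: (ie x); rewrite -[RHS]hc.
under [RHS]eq_bigr do rewrite mulr_sumr.
rewrite [RHS]exchange_big; apply: eq_bigr => i _ /=.
rewrite /x mxE rmorph_sum mulr_suml; apply: eq_bigr => j _.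
by rewrite !mxE rmorphM /= ratr_int; ring.
Qed.

(* Smith normal form; minimality of the number of units forces rank r. *)
Lemma minimal_units_reduce r (e : 'I_d1.+1 -> R) (eps : 'I_r -> R) (K : 'M[int]_(r, d1)) :
  minimal_units e eps K ->
  exists (eps' : 'I_r -> R) (B : 'M[int]_r) (K' : 'M[int]_(r, d1)) (A : 'M[int]_(d1, r)),
  [/\ K = B *m K', \det B != 0, K' *m A = 1%:M, ratindep eps' &
      forall j, e (lift ord0 j) = \sum_l eps' l * (K' l j)%:~R].
Proof.
move=> [[ie eK] min].
have [L uL [Q uQ [d _ KE]]] := int_Smith_normal_form K.
(* The rows of [Q], padded with zeros: nothing said so far excludes [r > d1]. *)
pose Rr (i : 'I_r) j : int := if insub (i : nat) is Some i' then Q (i' : 'I_d1) j else 0.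
have KEe l j : K l j = \sum_i L l i * d`_i * Rr i j.
  rewrite KE -mulmxA mxE; apply: eq_bigr => i _; rewrite -mulrA; congr (_ * _).
  rewrite mxE /Rr; case: insubP => [i' _ ii'|ni].
    rewrite (bigD1 i') //= mxE ii' eqxx mulr1n big1 ?addr0 // => k ki.
    rewrite mxE (_ : (i == k :> nat) = false) ?mulr0n ?mul0r //.
    by apply/negbTE; apply: contra ki => /eqP e0; apply/eqP/val_inj; rewrite /= ii'.
  rewrite mulr0 big1 // => k _; rewrite mxE.
  rewrite (_ : (i == k :> nat) = false) ?mulr0n ?mul0r //.
  by apply/negbTE; apply: contra ni => /eqP ->.
pose LQ : 'M[rat]_r := map_mx intr L.
have uLQ : LQ \in unitmx.
  by rewrite unitmxE det_map_mx rmorph_unit // -unitmxE.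
pose I := finset (fun i : 'I_r => (i < d1)%N && (d`_i != 0)).
have IE i : (i \in I) = (i < d1)%N && (d`_i != 0) by rewrite finset.inE.
have notI i j : i \notin I -> d`_i * Rr i j = 0.
  rewrite IE negb_and negbK => /orP[ni|/eqP ->]; last by rewrite mul0r.
  by rewrite /Rr insubF ?mulr0 //; exact: negbTE.
have allI : #|I| = r.
  have cI : (#|I| <= r)%N by rewrite -[X in (_ <= X)%N](card_ord r) max_card.
  apply/eqP; rewrite eqn_leq cI /=.
  (* The nonzero invariant factors alone already provide [#|I|] independent units that express all
     energies, so minimality gives [r <= #|I|]. *)
  pose M : 'M[int]_(r, #|I|) := \matrix_(l, k) (L l (enum_val k) * d`_(enum_val k)).
  apply: (min _ (fun k => \sum_l eps l * (M l k)%:~R) (\matrix_(k, j) Rr (enum_val k) j)).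
  split.
    apply: ratindep_mul => // y My.
    pose z : 'cV[rat]_r := \col_i \sum_k ((d`_i)%:~R * (i == enum_val k)%:R) * y k 0.
    have : LQ *m z = 0.
      rewrite -My; apply/colP => l; rewrite !mxE.
      under eq_bigr do rewrite !mxE mulr_sumr.
      rewrite exchange_big /=; apply: eq_bigr => k _.
      rewrite (bigD1 (enum_val k)) //= big1 ?addr0 => [|i ik].
        by rewrite eqxx mulr1 !mxE intrM mulrA.
      by rewrite (negbTE ik) mulr0 mul0r mulr0.
    move/(congr1 (mulmx (invmx LQ))); rewrite mulKmx // mulmx0 => z0.
    apply/colP => k; rewrite [RHS]mxE.
    have := congr1 (fun A : 'cV[rat]_r => A (enum_val k) 0) z0; rewrite !mxE.
    rewrite (bigD1 k) //= big1 ?addr0 => [|k' kk]; last first.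
      by rewrite (inj_eq enum_val_inj) eq_sym (negbTE kk) mulr0 mul0r.
    rewrite eqxx mulr1 => /eqP; rewrite mulf_eq0 intr_eq0.
    by have := enum_valP k; rewrite IE => /andP[_ /negbTE ->] /= /eqP.
  move=> j; rewrite eK.
  under eq_bigr do rewrite KEe intr_sum mulr_sumr.
  under [RHS]eq_bigr do rewrite mulr_suml.
  rewrite [RHS]exchange_big; apply: eq_bigr => l _ /=.
  rewrite (bigID (mem I)) /= [X in _ + X]big1 ?addr0 => [|i /notI ni]; last first.
    by rewrite -mulrA ni mulr0 mulr0.
  rewrite big_enum_val; apply: eq_bigr => k _.
  by rewrite !mxE !intrM !mulrA.
have inI i : i \in I.
  have /eqP -> : I == finset.setT by rewrite eqEcard finset.subsetT cardsT card_ord allI leqnn.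
  by rewrite finset.inE.
pose B : 'M[int]_r := \matrix_(l, i) (L l i * d`_i).
pose K' : 'M[int]_(r, d1) := \matrix_(i, j) Rr i j.
have BE : B = L *m diag_mx (\row_i d`_i).
  by apply/matrixP => l i; rewrite mul_mx_diag !mxE.
have detB : \det B != 0.
  rewrite BE det_mulmx mulf_neq0 //.
    by apply/eqP => L0; move: uL; rewrite unitmxE L0 unitr0.
  rewrite det_diag; apply/prodf_neq0 => i _; rewrite mxE.
  by have := inI i; rewrite IE => /andP[].
have KB : K = B *m K'.
  apply/matrixP => l j; rewrite KEe mxE; apply: eq_bigr => i _.
  by rewrite !mxE.
have ltd (i : 'I_r) : (i < d1)%N by have := inI i; rewrite IE => /andP[].
pose f i := Ordinal (ltd i).
have K'E : K' = rowsub f Q.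
  apply/matrixP => i j; rewrite !mxE /Rr; case: insubP => [i' _ ii'|]; last by rewrite ltd.
  by congr (Q _ j); apply: val_inj; rewrite /= ii'.
(* [K'] consists of the first [r] rows of the unimodular [Q], so the first [r] columns of its
   inverse form a right inverse. [B] is [L] with its columns scaled by the invariant factors. *)
exists (fun k => \sum_l eps l * (B l k)%:~R), B, K', (colsub f (invmx Q)); split => //.
- rewrite mulmx_colsub K'E mul_rowsub_mx mulmxV //.
  by apply/matrixP => i j; rewrite !mxE -!val_eqE.
- apply: ratindep_mul => // y By.
  have uB : (map_mx intr B : 'M[rat]_r) \in unitmx.
    by rewrite unitmxE det_map_mx unitfE intr_eq0.
  by rewrite -[y](mulKmx uB) By mulmx0.
- move=> j; rewrite eK.
  under eq_bigr do rewrite KEe intr_sum mulr_sumr.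
  under [RHS]eq_bigr do rewrite mulr_suml.
  rewrite [RHS]exchange_big; apply: eq_bigr => l _ /=; apply: eq_bigr => i _.
  by rewrite !mxE !intrM !mulrA.
Qed.

End Units.

(** * Energy distribution of clock states *)

Section WordCount.
Variable J : finType.

Definition occur m (x : {ffun 'I_m -> J}) : {ffun J -> nat} :=
  [ffun l => \sum_i (x i == l)]%N.

Definition consf m (u : J * {ffun 'I_m -> J}) : {ffun 'I_m.+1 -> J} :=
  [ffun i => if unlift ord0 i is Some k then u.2 k else u.1].

Lemma consf_bij m : bijective (@consf m).
Proof.
exists (fun x : {ffun 'I_m.+1 -> J} => (x ord0, [ffun k : 'I_m => x (lift ord0 k)])).
  move=> [j y]; rewrite /consf /= ffunE unlift_none; congr (_, _).
  by apply/ffunP => k; rewrite !ffunE liftK.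
move=> x; apply/ffunP => i; rewrite ffunE /=.
by case: unliftP => [k ->|->]; rewrite ?ffunE.
Qed.

Lemma occur_consf m (u : J * {ffun 'I_m -> J}) l :
  occur (consf u) l = ((u.1 == l) + occur u.2 l)%N.
Proof.
rewrite !ffunE big_ord_recl !ffunE unlift_none; congr (_ + _)%N.
by apply: eq_bigr => i _; rewrite ffunE liftK.
Qed.

Lemma sum_occur m (x : {ffun 'I_m -> J}) : (\sum_l occur x l = m)%N.
Proof.
under eq_bigr do rewrite ffunE.
rewrite exchange_big /= -[RHS]card_ord -sum1_card; apply: eq_bigr => i _.
by rewrite (bigD1 (x i)) //= eqxx big1 // => l; rewrite eq_sym => /negbTE ->.
Qed.

(** The multinomial coefficient, stated without division. The induction removes the first letter
    [j], and [(m + 1)!] splits as the sum of [c j * m!]. *)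
Lemma card_occur m (c : {ffun J -> nat}) : (\sum_l c l = m)%N ->
  ((\sum_(x : {ffun 'I_m -> J}) (occur x == c)) * \prod_l (c l)`! = m`!)%N.
Proof.
elim: m c => [|m IH] c hc.
  have c0 l : c l = 0%N.
    by apply/eqP; rewrite -leqn0 -hc (bigD1 l) //= leq_addr.
  have -> : (\prod_l (c l)`! = 1)%N by rewrite big1 // => l _; rewrite c0.
  rewrite muln1 (eq_bigr (fun=> 1%N)) => [|x _].
    by rewrite sum1_card card_ffun card_ord expn0.
  suff -> : occur x == c by [].
  by apply/eqP/ffunP => l; rewrite ffunE big_ord0 c0.
rewrite (reindex _ (onW_bij _ (@consf_bij m))) /=.
rewrite (eq_bigr (fun u => (occur (consf (u.1, u.2)) == c) : nat)); last by case.
rewrite -(pair_bigA _ (fun j y => (occur (consf (j, y)) == c) : nat)) /=.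
have -> : (m.+1`! = \sum_l c l * m`!)%N by rewrite -big_distrl /= hc factS.
rewrite big_distrl /=; apply: eq_bigr => j _.
case: (posnP (c j)) => [cj0|cj].
  rewrite cj0 mul0n big1 ?mul0n // => y _; apply/eqP; rewrite eqb0.
  by apply/eqP => /ffunP /(_ j); rewrite occur_consf /= eqxx cj0.
pose c' : {ffun J -> nat} := [ffun l => c l - (j == l)]%N.
have hc' : (\sum_l c' l = m)%N.
  apply/eqP; rewrite -eqSS -hc (bigD1 j) //= [X in _ == X](bigD1 j) //=.
  rewrite ffunE eqxx subn1 -addSn prednK //; apply/eqP; congr (_ + _)%N.
  by apply: eq_bigr => l; rewrite eq_sym ffunE => /negbTE ->; rewrite subn0.
rewrite -(IH _ hc') mulnCA; congr (_ * _)%N; last first.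
  rewrite (bigD1 j) //= [in RHS](bigD1 j) //= ffunE eqxx subn1 mulnA.
  rewrite -{1}(prednK cj) factS prednK //; congr (_ * _)%N.
  by apply: eq_bigr => l; rewrite eq_sym ffunE => /negbTE ->; rewrite subn0.
apply: eq_bigr => y _; congr nat_of_bool; apply/eqP/eqP => [h|e].
  by apply/ffunP => l; rewrite [RHS]ffunE -h occur_consf /= addKn.
apply/ffunP => l; rewrite occur_consf /= e ffunE.
by case: eqP => [<-|_]; rewrite ?subn0 // subnKC.
Qed.

End WordCount.

Section MultinomialWords.
Variables (R : realType) (d1 : nat) (e p : 'I_d1.+1 -> R).
Hypothesis e0 : e ord0 = 0.

Definition wordE m (x : {ffun 'I_m -> 'I_d1.+1}) : R := \sum_i e (x i).

Lemma prod_occur m (x : {ffun 'I_m -> 'I_d1.+1}) :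
  \prod_i p (x i) = \prod_l p l ^+ occur x l.
Proof.
under [RHS]eq_bigr do rewrite ffunE -prodrXr.
rewrite [RHS]exchange_big; apply: eq_bigr => i _ /=.
by rewrite (bigD1 (x i)) //= eqxx expr1 big1 ?mulr1 // => l; rewrite eq_sym => /negbTE ->.
Qed.

Lemma wordE_occur m (x : {ffun 'I_m -> 'I_d1.+1}) :
  wordE x = \sum_(j < d1) e (lift ord0 j) *+ occur x (lift ord0 j).
Proof.
transitivity (\sum_l e l *+ occur x l); last first.
  by rewrite big_ord_recl e0 mul0rn add0r.
under [RHS]eq_bigr do rewrite ffunE -sumrMnr.
rewrite [RHS]exchange_big; apply: eq_bigr => i _ /=.
by rewrite (bigD1 (x i)) //= eqxx mulr1n big1 ?addr0 // => l; rewrite eq_sym => /negbTE ->.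
Qed.

(** Grouping words by occupation numbers turns each multinomial weight into a count of equally
    likely words; level 0 drops out of the energy since [e ord0 = 0]. *)
Lemma pE_words m (E : R) :
  pE e p m E = \sum_(x : {ffun 'I_m -> 'I_d1.+1} | wordE x == E) \prod_i p (x i).
Proof.
have occle (x : {ffun 'I_m -> 'I_d1.+1}) l : (occur x l <= m)%N.
  by rewrite -{2}(sum_occur x) (bigD1 l) //= leq_addr.
pose occ (x : {ffun 'I_m -> 'I_d1.+1}) : {ffun 'I_d1 -> 'I_m.+1} :=
  [ffun j => inord (occur x (lift ord0 j))].
have occE x j : occ x j = occur x (lift ord0 j) :> nat by rewrite ffunE inordK ?ltnS.
have enE x : energy e (occ x) = wordE x.
  by rewrite wordE_occur /energy; apply: eq_bigr => j _; rewrite occE.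
have isocc x : is_occupation (occ x).
  rewrite /is_occupation -[X in (_ <= X)%N](sum_occur x) big_ord_recl.
  by rewrite (eq_bigr (fun j => occur x (lift ord0 j))) ?leq_addl // => j _; rewrite occE.
rewrite (partition_big occ (fun nn => is_occupation nn && (energy e nn == E))); last first.
  by move=> x; rewrite isocc enE.
rewrite /pE; apply: eq_bigr => nn /andP[on /eqP en].
pose c : {ffun 'I_d1.+1 -> nat} :=
  [ffun l => if unlift ord0 l is Some j then nn j : nat else (m - \sum_(j < d1) nn j)%N].
have c0 : c ord0 = (m - \sum_(j < d1) nn j)%N by rewrite ffunE unlift_none.
have cS j : c (lift ord0 j) = nn j by rewrite ffunE liftK.
have sc : (\sum_l c l = m)%N.
  by rewrite big_ord_recl c0; under [X in (_ + X)%N]eq_bigr do rewrite cS; rewrite subnK.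
have occc x : (occ x == nn) = (occur x == c).
  apply/eqP/eqP => [h|ox].
    apply/ffunP => l; rewrite [RHS]ffunE; case: unliftP => [j ->|->]; first by rewrite -h occE.
    rewrite -h; under eq_bigr do rewrite occE.
    by rewrite -[X in (X - _)%N](sum_occur x) big_ord_recl addnK.
  by apply/ffunP => j; apply: val_inj; rewrite /= occE ox cS.
rewrite (eq_bigl (fun x => occur x == c)); last first.
  move=> x; rewrite -occc; apply/andP/idP => [[]//|/eqP h]; split; last by rewrite h.
  by rewrite -enE h en.
rewrite (eq_bigr (fun=> \prod_l p l ^+ c l)); last first.
  by move=> x /eqP h; rewrite prod_occur h.
have fn0 k : (k`!%:R : R) != 0 by rewrite pnatr_eq0 -lt0n fact_gt0.
have C := congr1 (fun k => k%:R : R) (card_occur sc).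
rewrite /multinomial -C natrM natr_prod natr_sum.
rewrite -c0.
under [X in _ * (_ * X) = _]eq_bigr do rewrite -cS.
rewrite -(big_ord_recl d1 (fun l => p l ^+ c l / (c l)`!%:R)) prodf_div /=.
rewrite mulrA mulrAC mulfK; last by apply/prodf_neq0.
rewrite mulr_suml [RHS]big_mkcond; apply: eq_bigr => x _.
by case: eqP => _; rewrite ?mul1r ?mul0r.
Qed.

End MultinomialWords.

Section Braket.
Variable R : realType.
Local Notation C := R[i].
Implicit Types (N : nat) (a b : R).

Lemma realcM a b : (a * b)%:C = a%:C * b%:C. Proof. exact: rmorphM. Qed.

Lemma realc_sum (I : Type) (s : seq I) (P : pred I) (F : I -> R) :
  (\sum_(i <- s | P i) F i)%:C = \sum_(i <- s | P i) (F i)%:C.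
Proof. exact: rmorph_sum. Qed.

Lemma realc_inj : injective (fun a => a%:C). Proof. by move=> a b []. Qed.

Lemma conj_realc a : (a%:C)^* = a%:C.
Proof. by rewrite -[LHS]/(conjc _) /= oppr0. Qed.

Lemma conj_cis a : (cis a)^* = cis (- a).
Proof. by rewrite -[LHS]/(conjc _) /cis cosN sinN. Qed.

Lemma realc_ge0 a : (0 <= a%:C) = (0 <= a).
Proof. by rewrite lecE /= eqxx. Qed.

Lemma sqrtC_realc a : 0 <= a -> sqrtC a%:C = (Num.sqrt a)%:C.
Proof.
move=> a0; rewrite -{1}(sqr_sqrtr a0) rmorphXn sqrCK //.
by rewrite realc_ge0 sqrtr_ge0.
Qed.

Lemma cexp_im a : cexp (- 'i%C * a%:C) = cis (- a).
Proof. by rewrite /cexp /cis; simpc; rewrite expR0 mul1r; simpc. Qed.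

Lemma braketE N (u v : 'cV[C]_N) : braket u v = \sum_x (u x 0)^* * v x 0.
Proof. by rewrite /braket mxE; apply: eq_bigr => x _; rewrite !mxE. Qed.

Lemma braketDr N (u v w : 'cV[C]_N) : braket u (v + w) = braket u v + braket u w.
Proof. by rewrite /braket mulmxDr mxE. Qed.

Lemma braketZr N (u v : 'cV[C]_N) c : braket u (c *: v) = c * braket u v.
Proof. by rewrite /braket -scalemxAr mxE. Qed.

Lemma braketDl N (u v w : 'cV[C]_N) : braket (u + v) w = braket u w + braket v w.
Proof. by rewrite /braket linearD /= map_mxD mulmxDl mxE. Qed.

Lemma braketZl N (u v : 'cV[C]_N) c : braket (c *: u) v = c^* * braket u v.
Proof. by rewrite /braket linearZ /= map_mxZ -scalemxAl mxE. Qed.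

Lemma braket0r N (u : 'cV[C]_N) : braket u 0 = 0.
Proof. by rewrite /braket mulmx0 mxE. Qed.

Lemma braket0l N (u : 'cV[C]_N) : braket 0 u = 0.
Proof. by rewrite /braket trmx0 map_mx0 mul0mx mxE. Qed.

Lemma braket_sumr N (I : Type) (s : seq I) (P : pred I) (u : 'cV[C]_N) (F : I -> 'cV[C]_N) :
  braket u (\sum_(i <- s | P i) F i) = \sum_(i <- s | P i) braket u (F i).
Proof.
by elim/big_rec2: _ => [|i y z _ <-]; rewrite ?braket0r // braketDr.
Qed.

Lemma braket_suml N (I : Type) (s : seq I) (P : pred I) (u : 'cV[C]_N) (F : I -> 'cV[C]_N) :
  braket (\sum_(i <- s | P i) F i) u = \sum_(i <- s | P i) braket (F i) u.
Proof.
by elim/big_rec2: _ => [|i y z _ <-]; rewrite ?braket0l // braketDl.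
Qed.

Lemma braket_conj N (u v : 'cV[C]_N) : (braket u v)^* = braket v u.
Proof.
rewrite !braketE rmorph_sum; apply: eq_bigr => x _.
by rewrite rmorphM /= conjCK mulrC.
Qed.

Lemma ketbra_mul N (u v w : 'cV[C]_N) : ketbra u v *m w = braket v w *: u.
Proof.
apply/colP => x; rewrite /ketbra -mulmxA mxE [RHS]mxE big_ord1 mulrC.
by congr (_ * _); rewrite /braket.
Qed.

(** [spectralmx] picks an unspecified eigenbasis; this evaluates f(A) without knowing it. In that
    basis an eigenvector is supported where the diagonal equals [a], and there [f] of the diagonal
    is [f a]. *)
Lemma mxfun_eigen N (f : C -> C) (A : 'M[C]_N) (v : 'cV[C]_N) (a : C) :
  A \is normalmx -> A *m v = a *: v -> mxfun f A *m v = f a *: v.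
Proof.
move=> /orthomx_spectralP AE Av.
set P := spectralmx A in AE *; set D := spectral_diag A in AE *.
have uP : P \in unitmx := spectral_unit A.
have PAv : diag_mx D *m (P *m v) = a *: (P *m v).
  by rewrite scalemxAr -Av [in RHS]AE -!mulmxA mulKVmx.
rewrite /mxfun -/P -/D -!mulmxA.
have key (w : 'cV[C]_N) : diag_mx D *m w = a *: w ->
    diag_mx (map_mx f D) *m w = f a *: w.
  move=> h; apply/colP => i; rewrite mul_diag_mx !mxE.
  have := congr1 (fun w : 'cV[C]_N => w i 0) h; rewrite mul_diag_mx !mxE => /eqP.
  rewrite -subr_eq0 -mulrBl mulf_eq0 subr_eq0.
  by case/orP => /eqP ->; rewrite ?mulr0.
rewrite key //.
by rewrite -scalemxAr mulKmx.
Qed.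

Lemma eigenprojector_diag N (D : 'rV[C]_N) (a : C) (v : 'cV[C]_N) :
  eigenprojector (diag_mx D) a *m v = \col_x (if D 0 x == a then v x 0 else 0).
Proof.
apply: trmx_inj; rewrite trmx_mul /eigenprojector trmxK tr_diag_mx.
set V := eigenspace _ _.
pose v1 : 'rV[C]_N := \row_x (if D 0 x == a then v x 0 else 0).
pose v2 : 'rV[C]_N := \row_x (if D 0 x == a then 0 else v x 0).
have -> : v^T = v1 + v2.
  by apply/rowP => x; rewrite !mxE; case: eqP; rewrite ?addr0 ?add0r.
have -> : (\col_x (if D 0 x == a then v x 0 else 0))^T = v1.
  by apply/rowP => x; rewrite !mxE.
rewrite mulmxDl proj_ortho_id; last first.
  apply/eigenspaceP; apply/rowP => x; rewrite mul_mx_diag !mxE.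
  by case: eqP => [->|_]; rewrite ?mulr0 ?mul0r // mulrC.
rewrite proj_ortho_0 ?addr0 //.
apply/orthomx1P; apply/rowP => k; rewrite !mxE big1 // => x _.
rewrite !mxE; case: eqP => [_|/eqP Dx]; first by rewrite mul0r.
have /eigenspaceP h := submx_refl V.
have := congr1 (fun M : 'M[C]_N => M k x) h; rewrite mul_mx_diag !mxE.
move/eqP; rewrite mulrC -subr_eq0 -mulrBl mulf_eq0 subr_eq0 (negbTE Dx) /=.
by move/eqP => e; rewrite /V e conjC0 mulr0.
Qed.

End Braket.

Lemma selfadj_normalmx (R : realType) N (A : 'M[R[i]]_N) : A^t* = A -> A \is normalmx.
Proof. by move=> h; rewrite qualifE /= h. Qed.

Lemma sqrtr_prod (R : realType) (I : Type) (s : seq I) (F : I -> R) :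
  (forall i, 0 <= F i) ->
  Num.sqrt (\prod_(i <- s) F i) = \prod_(i <- s) Num.sqrt (F i).
Proof.
move=> F0; elim: s => [|i s IH]; first by rewrite !big_nil sqrtr1.
by rewrite !big_cons sqrtrM // IH.
Qed.

Lemma sum_pick (V : zmodType) (T : eqType) (s : seq T) (a : T) (F : T -> V) :
  uniq s -> a \in s -> \sum_(x <- s) (if a == x then F x else 0) = F a.
Proof.
move=> us sa; rewrite (bigD1_seq a) //= eqxx big1 ?addr0 // => x xa.
by rewrite eq_sym (negbTE xa).
Qed.

Lemma sum_tindex (V : zmodType) (d m : nat) (F : {ffun 'I_m -> 'I_d} -> V) :
  \sum_(x : 'I_(tdim d m)) F (tindex x) = \sum_w F w.
Proof. by rewrite [RHS](big_enum_val (A := predT)). Qed.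

(** * Clock states and filters in the energy basis *)

Section Clock.
Variables (R : realType) (d1 : nat) (e p : 'I_d1.+1 -> R).
Hypotheses (he0 : e ord0 = 0) (hp_gt0 : forall j, 0 < p j).
Local Notation C := R[i].
Local Notation d := d1.+1.
Implicit Types (m : nat) (E t : R).

Let p_ge0 j : 0 <= p j. Proof. exact: ltW. Qed.

Lemma psiE t : psi e p t = \col_j (cis (- (t * e j)) * (Num.sqrt (p j))%:C).
Proof.
set f := fun z : C => cexp (- 'i%C * t%:C * z).
have nH : hamiltonian e \is normalmx.
  apply: selfadj_normalmx; apply/matrixP => j k; rewrite !mxE eq_sym.
  by case: eqVneq => [->|_]; rewrite ?mulr1n ?mulr0n ?conjC0 // conj_realc.
have psi0E : psi0 p = \sum_j (Num.sqrt (p j))%:C *: delta_mx j 0.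
  apply/colP => k; rewrite mxE summxE (bigD1 k) //= big1 ?addr0 => [|j jk].
    by rewrite !mxE !eqxx mulr1.
  by rewrite !mxE eq_sym (negbTE jk) mulr0.
rewrite /psi -/f psi0E mulmx_sumr.
have eig j : mxfun f (hamiltonian e) *m delta_mx j 0 =
    cis (- (t * e j)) *: delta_mx j 0 :> 'cV[C]_d.
  rewrite (mxfun_eigen f nH (a := (e j)%:C)).
    by rewrite /f -mulrA -realcM cexp_im.
  apply/colP => k; rewrite mul_diag_mx !mxE andbT.
  by case: eqVneq => [->|_]; rewrite ?mulr0.
apply/colP => k; rewrite [RHS]mxE summxE (bigD1 k) //= big1 ?addr0 => [|j jk].
  by rewrite -scalemxAr eig !mxE !eqxx mulr1 mulrC.
by rewrite -scalemxAr eig !mxE eq_sym (negbTE jk) !mulr0.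
Qed.

Lemma wordP_gt0 m (x : {ffun 'I_m -> 'I_d}) : 0 < wordP p x.
Proof. by apply: prodr_gt0 => i _. Qed.

Lemma PsiE m t : Psi e p m t =
  \col_x (cis (- (t * wordE e (tindex x))) * (Num.sqrt (wordP p (tindex x)))%:C).
Proof.
apply/colP => x; rewrite /Psi /tensor_power !mxE psiE.
under eq_bigr do rewrite mxE.
rewrite big_split /= -cis_sum sqrtr_prod // rmorph_prod; congr (cis _ * _).
by rewrite sumrN /wordE mulr_sumr.
Qed.

Lemma tensor_psi0E m : tensor_power m (psi0 p) =
  \col_x (Num.sqrt (wordP p (tindex x)))%:C.
Proof.
apply/colP => x; rewrite /tensor_power !mxE sqrtr_prod // rmorph_prod.
by apply: eq_bigr => k _; rewrite mxE.
Qed.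

Lemma total_hamiltonianE m :
  total_hamiltonian e m = diag_mx (\row_x (wordE e (tindex x))%:C).
Proof.
apply/matrixP => x y; rewrite /total_hamiltonian summxE !mxE.
case: eqVneq => [<-|xy].
  rewrite mulr1n realc_sum; apply: eq_bigr => k _; rewrite !mxE eqxx mulr1n.
  by rewrite (_ : [forall _, _]) ?mulr1 //; apply/forallP => l; rewrite eqxx implybT.
rewrite mulr0n big1 // => k _; rewrite !mxE; case: eqVneq => [xyk|_]; last by rewrite mulr0n mul0r.
rewrite (_ : [forall _, _] = false) ?mulr0 //; apply/negbTE/negP => /forallP h.
case/eqP: xy; apply: enum_val_inj; apply/ffunP => l; rewrite -/(tindex x) -/(tindex y).
by have := h l; case: eqVneq => [->|_ /eqP].
Qed.

Definition ketw m E (x : {ffun 'I_m -> 'I_d}) : R :=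
  if wordE e x == E then Num.sqrt (wordP p x) / Num.sqrt (pE e p m E) else 0.

Lemma pE_ge0 m E : 0 <= pE e p m E.
Proof. by rewrite (pE_words p he0); apply: sumr_ge0 => x _; apply: ltW; exact: wordP_gt0. Qed.

Lemma ketE_col m E : ketE e p m E = \col_x (ketw E (tindex x))%:C.
Proof.
rewrite /ketE total_hamiltonianE eigenprojector_diag tensor_psi0E.
set v := \col__ _.
have vE x : v x 0 = (if wordE e (tindex x) == E then Num.sqrt (wordP p (tindex x)) else 0)%:C.
  by rewrite !mxE (inj_eq (@realc_inj R)); case: eqP.
have bv : braket v v = (pE e p m E)%:C.
  rewrite braketE (pE_words p he0) [in RHS]big_mkcond -sum_tindex realc_sum.
  apply: eq_bigr => x _; rewrite vE conj_realc -realcM; congr (_%:C).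
  case: eqP => _; last by rewrite mulr0.
  by rewrite -expr2 sqr_sqrtr // ltW // wordP_gt0.
apply/colP => x; rewrite /normalize bv sqrtC_realc ?pE_ge0 // mxE vE mxE /ketw.
case: eqP => _; last by rewrite mulr0.
by rewrite -fmorphV -realcM mulrC.
Qed.

Lemma pE_gt0 m E : (0 < pE e p m E) = (E \in Sp e m).
Proof.
have mg (nn : {ffun 'I_d1 -> 'I_m.+1}) : 0 < multinomial p nn.
  have f0 k : 0 < (k`!%:R : R) by rewrite ltr0n fact_gt0.
  rewrite /multinomial !mulr_gt0 ?invr_gt0 ?exprn_gt0 //.
  by apply: prodr_gt0 => j _; rewrite divr_gt0 // exprn_gt0.
rewrite /Sp mem_undup; apply/idP/mapP => [h|[nn]].
  have [nn hn|hn] := pickP (fun nn : {ffun 'I_d1 -> 'I_m.+1} => is_occupation nn && (energy e nn == E)).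
    by case/andP: hn => on /eqP <-; exists nn; rewrite ?mem_enum.
  by move: h; rewrite /pE big_pred0 ?ltxx.
rewrite mem_enum => on ->; rewrite /pE (bigD1 nn) /=; last by rewrite eqxx andbT.
by rewrite ltr_wpDr // sumr_ge0 // => k _; exact: ltW.
Qed.

Lemma wordE_Sp m (x : {ffun 'I_m -> 'I_d}) : wordE e x \in Sp e m.
Proof.
rewrite -pE_gt0 (pE_words p he0) (bigD1 x) //= ltr_wpDr ?wordP_gt0 //.
by apply: sumr_ge0 => y _; apply: ltW; exact: wordP_gt0.
Qed.

Lemma uniq_Sp m : uniq (Sp e m). Proof. exact: undup_uniq. Qed.

Lemma ketE_orth m E E' : E \in Sp e m ->
  braket (ketE e p m E) (ketE e p m E') = (E == E')%:R.
Proof.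
move=> SE; rewrite braketE !ketE_col.
under eq_bigr do rewrite !mxE conj_realc -realcM.
rewrite -realc_sum (sum_tindex (fun x => ketw E x * ketw E' x)).
case: eqVneq => [<-|EE'].
  rewrite -[RHS]/(1%:C); congr (_%:C).
  have q0 : 0 < pE e p m E by rewrite pE_gt0.
  rewrite -[RHS](divff (lt0r_neq0 q0)) {1}(pE_words p he0) [in RHS]big_mkcond mulr_suml.
  apply: eq_bigr => x _; rewrite /ketw; case: eqP => _; last by rewrite mulr0 mul0r.
  by rewrite mulrACA -expr2 sqr_sqrtr ?(ltW (wordP_gt0 _)) // -invfM -expr2 sqr_sqrtr // ltW.
rewrite big1 // => x _; rewrite /ketw; case: eqP => [->|_]; last by rewrite mul0r.
by rewrite (negbTE EE') mulr0.
Qed.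

(** The common form of [Psi], [guess], the filtered states and the measurement vectors: from here on
    each is known by its real amplitudes [c]. *)
Definition clockst m (c : R -> R) t : 'cV[C]_(tdim d m) :=
  \sum_(E <- Sp e m) (cis (- (t * E)) * (c E)%:C) *: ketE e p m E.

Lemma Psi_clockst m t : Psi e p m t = clockst m (fun E => Num.sqrt (pE e p m E)) t.
Proof.
apply/colP => x; rewrite PsiE mxE /clockst summxE.
set u := wordE e (tindex x).
have SE := wordE_Sp (tindex x); rewrite -/u in SE.
rewrite -(sum_pick (fun E => cis (- (t * E)) * (Num.sqrt (wordP p (tindex x)))%:C) (uniq_Sp m) SE).
apply: eq_big_seq => E SE'; rewrite ketE_col !mxE /ketw -/u.
case: eqP => _; last by rewrite mulr0.
rewrite -mulrA -realcM mulrCA mulfV ?mulr1 //.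
by rewrite gt_eqF // sqrtr_gt0 pE_gt0.
Qed.

Lemma guess_clockst m phat t : guess e p m phat t = clockst m (fun E => Num.sqrt (phat E)) t.
Proof.
apply: eq_bigr => E _; congr (_ * _ *: _).
by rewrite -mulrA -realcM cexp_im mulrC.
Qed.

Lemma braket_ket_clockst m c t E : E \in Sp e m ->
  braket (ketE e p m E) (clockst m c t) = cis (- (t * E)) * (c E)%:C.
Proof.
move=> SE; rewrite /clockst braket_sumr.
rewrite -(sum_pick (fun E => cis (- (t * E)) * (c E)%:C) (uniq_Sp m) SE).
apply: eq_bigr => E' _; rewrite braketZr ketE_orth //.
by case: eqP => _; rewrite ?mulr1 ?mulr0.
Qed.

Lemma braket_clockst m c c' t t' :
  braket (clockst m c t) (clockst m c' t') =
  \sum_(E <- Sp e m) cis ((t - t') * E) * (c E * c' E)%:C.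
Proof.
rewrite {1}/clockst braket_suml; apply: eq_big_seq => E SE.
rewrite braketZl braket_ket_clockst // [(_ * _)^*]rmorphM /= conj_cis conj_realc opprK.
by rewrite mulrACA -cisD -realcM -mulrBl.
Qed.

Section Filter.
Variables (n : nat) (w : R -> R).
Hypotheses (hw : forall E, E \in Sp e n -> 0 <= w E) (hPs : 0 < Psucc e p n w).
Let W := filter_op e p n w.

Lemma filter_ket E : E \in Sp e n -> W *m ketE e p n E = (w E)%:C *: ketE e p n E.
Proof.
move=> SE; rewrite /W /filter_op mulmx_suml.
have := sum_pick (fun E => (w E)%:C *: ketE e p n E) (uniq_Sp n) SE; move=> <-.
apply: eq_big_seq => E' SE'; rewrite -scalemxAl ketbra_mul ketE_orth // eq_sym.
by case: eqP => _; rewrite ?scale1r // scale0r scaler0.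
Qed.

Lemma filter_normal : W \is normalmx.
Proof.
apply: selfadj_normalmx; apply/matrixP => x y.
rewrite !mxE /W /filter_op !summxE rmorph_sum; apply: eq_bigr => E _.
rewrite !mxE !big_ord1 !mxE !rmorphM /= !conjCK conj_realc.
by rewrite [X in _ * X]mulrC.
Qed.

(** The amplitudes c_E of the overview; their squares sum to 1 by [sum_cc]. *)
Definition camp E := Num.sqrt (pE e p n E * (w E / Psucc e p n w)).

Lemma filteredE t : filtered e p n w t = clockst n camp t.
Proof.
rewrite /filtered -/W.
have Wst c : W *m clockst n c t = clockst n (fun E => w E * c E) t.
  rewrite /clockst mulmx_sumr; apply: eq_big_seq => E SE.
  rewrite -scalemxAr filter_ket // scalerA; congr (_ *: _).
  by rewrite realcM; ring.
have fst c : mxfun sqrtC W *m clockst n c t = clockst n (fun E => Num.sqrt (w E) * c E) t.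
  rewrite /clockst mulmx_sumr; apply: eq_big_seq => E SE.
  rewrite -scalemxAr (mxfun_eigen _ filter_normal (filter_ket SE)) scalerA; congr (_ *: _).
  by rewrite sqrtC_realc ?hw // realcM; ring.
rewrite Psi_clockst Wst braket_clockst fst.
have -> : \sum_(E <- Sp e n) cis ((t - t) * E) *
    (Num.sqrt (pE e p n E) * (w E * Num.sqrt (pE e p n E)))%:C = (Psucc e p n w)%:C.
  rewrite /Psucc realc_sum; apply: eq_big_seq => E SE.
  rewrite subrr mul0r cis0 mul1r; congr (_%:C).
  by rewrite mulrCA -expr2 sqr_sqrtr ?pE_ge0.
rewrite sqrtC_realc ?ltW // /clockst scaler_sumr; apply: eq_big_seq => E SE.
rewrite scalerA; congr (_ *: _).
rewrite -fmorphV mulrCA -realcM; congr (_ * _%:C).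
rewrite /camp sqrtrM ?pE_ge0 // sqrtrM ?hw // sqrtrV ?ltW //; ring.
Qed.

End Filter.

End Clock.

(** * Upper bound on the cloning fidelity *)

(* Replacing each time t by the pair t, t + pi / w multiplies the frequency-w sum
   by 1 + exp (i pi) = 0; finite time averages thus isolate the resonant terms. *)
Lemma exists_averaging_times (R : realType) (W : seq R) :
  exists T : seq R, (0 < size T)%N /\
    forall om, om \in W -> om != 0 -> \sum_(t <- T) cis (t * om) = 0.
Proof.
elim: W => [|w W [T [T0 hT]]]; first by exists [:: 0].
exists (T ++ [seq t + pi / w | t <- T]); split; first by rewrite size_cat ltn_addr.
move=> om; rewrite in_cons => omW om0.
rewrite big_cat big_map /=.
have -> : \sum_(t <- T) cis ((t + pi / w) * om) = (\sum_(t <- T) cis (t * om)) * cis (pi / w * om).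
  by rewrite mulr_suml; apply: eq_bigr => t _; rewrite mulrDl cisD.
rewrite -[X in X + _]mulr1 -mulrDr; case/orP: omW => [/eqP e|/hT -> //]; last by rewrite mul0r.
rewrite -e divfK // {2}/cis cospi sinpi.
by rewrite [1 + _](_ : _ = 0) ?mulr0 //; apply/eqP; rewrite eq_complex /= addrN addr0 eqxx.
Qed.

(** With symmetric weights, exchanging [x] and [y] shows that only [z x y + z y x] matters. *)
Lemma sym_sum_le (R : realDomainType) (T : Type) (s : seq T) (al z : T -> T -> R) (a : T -> R) :
  (forall x y, 0 <= al x y) -> (forall x y, al x y = al y x) ->
  (forall x y, z x y + z y x <= a x + a y) ->
  \sum_(x <- s) \sum_(y <- s) al x y * z x y <=
  \sum_(x <- s) \sum_(y <- s) al x y * a x.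
Proof.
move=> al0 alC za.
have sym (f : T -> T -> R) : \sum_(x <- s) \sum_(y <- s) al x y * f x y *+ 2 =
    \sum_(x <- s) \sum_(y <- s) al x y * (f x y + f y x).
  transitivity (\sum_(x <- s) \sum_(y <- s) al x y * f x y +
                \sum_(x <- s) \sum_(y <- s) al x y * f x y).
    rewrite -big_split; apply: eq_bigr => x _; rewrite -big_split.
    by apply: eq_bigr => y _; rewrite mulr2n.
  rewrite [X in _ + X]exchange_big -big_split; apply: eq_bigr => x _ /=.
  rewrite -big_split; apply: eq_bigr => y _ /=.
  by rewrite [al y x]alC mulrDr.
rewrite -(ler_pMn2r (n := 2)) // -!sumrMnl.
under eq_bigr do rewrite -sumrMnl.
under [leRHS]eq_bigr do rewrite -sumrMnl.
rewrite sym (sym (fun x _ => a x)).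
by apply: ler_sum => x _; apply: ler_sum => y _; rewrite ler_wpM2l.
Qed.

Lemma sum_ord2 (V : nmodType) (F : 'I_2 -> 'I_2 -> V) :
  \sum_i \sum_j F i j = F ord0 ord0 + F ord0 ord_max + (F ord_max ord0 + F ord_max ord_max).
Proof.
have E (G : 'I_2 -> V) : \sum_i G i = G ord0 + G ord_max.
  rewrite big_ord_recl big_ord1; congr (_ + G _); exact/val_inj.
by rewrite E !E.
Qed.

Section Positivity.
Variable R : realType.
Local Notation C := R[i].

Lemma ketbra_psd N (u : 'cV[C]_N) : psdmx (ketbra u u).
Proof.
move=> v; rewrite ketbra_mul braketZr mulrC -[braket v u]braket_conj mulrC.
by rewrite mul_conjC_ge0.
Qed.

Lemma adj_mxcol k N (u : 'I_k -> 'cV[C]_N) :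
  (\mxcol_i u i)^t* = \mxrow_i (u i)^t*.
Proof. by rewrite tr_mxcol; apply/matrixP => x y; rewrite !mxE. Qed.

Lemma braket_mxcol k N (u v : 'I_k -> 'cV[C]_N) :
  braket (\mxcol_i u i) (\mxcol_i v i) = \sum_i braket (u i) (v i).
Proof. by rewrite /braket adj_mxcol mul_mxrow_mxcol summxE. Qed.

(** Complete positivity tested on the rank-one operator of the stacked vector [u], whose blocks are
    the [ketbra (u i) (u j)]. *)
Lemma cp_form N N' (D : 'M[C]_N -> 'M[C]_N') k (u : 'I_k -> 'cV[C]_N) (v : 'I_k -> 'cV[C]_N') :
  completely_positive D ->
  0 <= \sum_i \sum_j braket (v i) (D (ketbra (u i) (u j)) *m v j).
Proof.
move=> cp.
have h : psdmx (ketbra (\mxcol_i u i) (\mxcol_i u i)) := ketbra_psd _.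
have := cp k _ h (\mxcol_i v i).
rewrite mul_mxblock_mxrow braket_mxcol.
congr (0 <= _); apply: eq_bigr => i _; rewrite braket_sumr; apply: eq_bigr => j _.
congr (braket _ (D _ *m _)).
by rewrite /ketbra adj_mxcol mul_mxcol_mxrow mxblockK.
Qed.

Lemma realc_Re_ge0 (z : C) : 0 <= z -> 0 <= complex.Re z.
Proof. by rewrite lecE => /andP[]. Qed.

Lemma adjZ N (a : C) (u : 'cV[C]_N) : (a *: u)^t* = a^* *: u^t*.
Proof. by rewrite linearZ /= map_mxZ. Qed.

Lemma adj_sum N (I : Type) (s : seq I) (F : I -> 'cV[C]_N) :
  (\sum_(i <- s) F i)^t* = \sum_(i <- s) (F i)^t*.
Proof. by rewrite linear_sum map_mx_sum. Qed.

Lemma braketNr N (u v : 'cV[C]_N) : braket u (- v) = - braket u v.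
Proof. by rewrite -scaleN1r braketZr mulN1r. Qed.

Lemma braketNl N (u v : 'cV[C]_N) : braket (- u) v = - braket u v.
Proof. by rewrite -scaleN1r braketZl rmorphN1 mulN1r. Qed.

Lemma ReD (x y : C) : complex.Re (x + y) = complex.Re x + complex.Re y.
Proof. exact: raddfD. Qed.

Lemma ReN (x : C) : complex.Re (- x) = - complex.Re x.
Proof. exact: raddfN. Qed.

Lemma cp_psd N N' (D : 'M[C]_N -> 'M[C]_N') (u : 'cV[C]_N) :
  completely_positive D -> psdmx (D (ketbra u u)).
Proof.
move=> cp v; have := cp_form (fun _ : 'I_1 => u) (fun _ => v) cp.
by rewrite !big_ord1.
Qed.

(* positivity of the 2 x 2 block form on (v, - v') *)
Lemma cp_offdiag N N' (D : 'M[C]_N -> 'M[C]_N') (u u' : 'cV[C]_N) (v v' : 'cV[C]_N') :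
  completely_positive D ->
  complex.Re (braket v (D (ketbra u u') *m v')) +
  complex.Re (braket v' (D (ketbra u' u) *m v)) <=
  complex.Re (braket v (D (ketbra u u) *m v)) +
  complex.Re (braket v' (D (ketbra u' u') *m v')).
Proof.
move=> cp.
have := cp_form (fun i : 'I_2 => if i == 0 then u else u')
  (fun i => if i == 0 then v else - v') cp.
move/realc_Re_ge0; rewrite sum_ord2 /=.
rewrite mulmxN !braketNr !braketNl mulmxN braketNr opprK !ReD !ReN.
by move: (complex.Re _) (complex.Re _) (complex.Re _) (complex.Re _) => x1 x2 x3 x4; lra.
Qed.

Section OrthonormalFamily.
Variables (N : nat) (T : eqType) (s : seq T) (f : T -> 'cV[C]_N).
Hypotheses (us : uniq s)
  (orth : forall x y, x \in s -> y \in s -> braket (f x) (f y) = (x == y)%:R).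

Definition compl_proj : 'M[C]_N := 1%:M - \sum_(x <- s) ketbra (f x) (f x).

Let P := \sum_(x <- s) ketbra (f x) (f x).

Let P_ket x : x \in s -> P *m f x = f x.
Proof.
move=> sx; rewrite /P mulmx_suml -[RHS](sum_pick f us sx).
apply: eq_big_seq => y sy; rewrite ketbra_mul orth // eq_sym.
by case: eqP => _; rewrite ?scale1r ?scale0r.
Qed.

Lemma compl_proj_ket x : x \in s -> compl_proj *m f x = 0.
Proof. by move=> sx; rewrite /compl_proj mulmxBl mul1mx P_ket // subrr. Qed.

Lemma compl_proj_selfadj : compl_proj^t* = compl_proj.
Proof.
apply/matrixP => i j; rewrite !mxE rmorphB !summxE rmorph_sum /=; congr (_ - _).
  by rewrite eq_sym; case: eqP => _; rewrite ?conjC0 ?conjC1.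
apply: eq_bigr => x _.
by rewrite !mxE !big_ord1 !mxE rmorphM /= conjCK mulrC.
Qed.

Lemma compl_proj_idem : compl_proj *m compl_proj = compl_proj.
Proof.
suff PP : P *m P = P.
  by rewrite /compl_proj -/P mulmxBl mul1mx mulmxBr mulmx1 PP subrr subr0.
transitivity (\sum_(x <- s) P *m ketbra (f x) (f x)); first by rewrite -mulmx_sumr.
apply: eq_big_seq => x sx.
by rewrite /ketbra mulmxA P_ket.
Qed.

(** What the family misses is the trace of [A] compressed to the orthogonal complement, which is
    nonnegative. *)
Lemma psd_trace_le (A : 'M[C]_N) : psdmx A ->
  \sum_(x <- s) complex.Re (braket (f x) (A *m f x)) <= complex.Re (\tr A).
Proof.
move=> pA.
have trP : \tr (A *m P) = \sum_(x <- s) braket (f x) (A *m f x).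
  rewrite /P mulmx_sumr linear_sum; apply: eq_bigr => x _ /=.
  by rewrite /ketbra mulmxA mxtrace_mulC /mxtrace big_ord1.
have trQ : 0 <= \tr (A *m compl_proj).
  rewrite -compl_proj_idem mulmxA mxtrace_mulC mulmxA /mxtrace; apply: sumr_ge0 => i _.
  have := pA (col i compl_proj); rewrite /braket.
  have -> : (col i compl_proj)^t* = row i compl_proj.
    by rewrite -[in RHS]compl_proj_selfadj; apply/matrixP => a b; rewrite !mxE.
  by rewrite colE rowE !mulmxA -colE -!mulmxA -rowE !mulmxA !mxE.
rewrite -Re_sum -trP.
have -> : \tr A = \tr (A *m P) + \tr (A *m compl_proj).
  by rewrite -mxtraceD -mulmxDr /compl_proj -/P addrC subrK mulmx1.
by rewrite raddfD lerDl realc_Re_ge0.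
Qed.

End OrthonormalFamily.

End Positivity.

Lemma ketbra_clockst (R : realType) (d1 : nat) (e p : 'I_d1.+1 -> R) n (c : R -> R) t :
  ketbra (clockst e p n c t) (clockst e p n c t) =
  \sum_(E <- Sp e n) \sum_(E' <- Sp e n)
    (cis (t * (E' - E)) * (c E * c E')%:C) *: ketbra (ketE e p n E) (ketE e p n E').
Proof.
rewrite /ketbra /clockst mulmx_suml; apply: eq_bigr => E _.
rewrite adj_sum mulmx_sumr; apply: eq_bigr => E' _ /=.
rewrite adjZ -scalemxAl -scalemxAr scalerA; congr (_ *: _).
rewrite [(_ * _)^*]rmorphM /= conj_cis conj_realc opprK mulrACA -cisD -realcM.
by congr (cis _ * _); ring.
Qed.

Section CloningBound.
Variables (R : realType) (d1 : nat) (e p : 'I_d1.+1 -> R).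
Hypotheses (he0 : e ord0 = 0) (hp_gt0 : forall j, 0 < p j).
Variables (n m : nat) (w : R -> R).
Hypotheses (hw : forall E, E \in Sp e n -> 0 <= w E) (hPs : 0 < Psucc e p n w).
Variable D : {linear 'M[R[i]]_(tdim d1.+1 n) -> 'M[R[i]]_(tdim d1.+1 m)}.
Hypothesis hD : is_channel D.
Variable qm : R.
Hypothesis hqm : forall F, pE e p m F <= qm.
Local Notation C := R[i].
Local Notation kn := (ketE e p n).
Local Notation km := (ketE e p m).

Let c := camp e p n w.
Let b F := Num.sqrt (pE e p m F).
Let c0 E : 0 <= c E. Proof. exact: sqrtr_ge0. Qed.
Let b0 F : 0 <= b F. Proof. exact: sqrtr_ge0. Qed.
(** An index [(E, F)] pairs an input with an output energy. [z] is a matrix element of the channel,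
    [al] its weight in the fidelity and [om] its frequency in time, zero exactly when
    [F - F' = E - E']. *)
Let z (x y : R * R) : C := braket (km x.2) (D (ketbra (kn x.1) (kn y.1)) *m km y.2).
Let s2 := [seq (E, F) | E <- Sp e n, F <- Sp e m].
Let al (x y : R * R) : R := c x.1 * c y.1 * (b x.2 * b y.2).
Let om (x y : R * R) : R := (x.2 - y.2) - (x.1 - y.1).

Lemma cl_fidelity_ge0 t : 0 <= cl_fidelity e p w D t.
Proof. by apply: realc_Re_ge0; apply: cp_psd; case: hD. Qed.

Lemma cl_fidelity_expand t : cl_fidelity e p w D t =
  \sum_(x <- s2) \sum_(y <- s2) complex.Re (cis (t * om x y) * (al x y)%:C * z x y).
Proof.
rewrite /cl_fidelity (Psi_clockst he0 hp_gt0) (filteredE he0 hp_gt0 hw hPs).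
have DZ a X : D (a *: X) = a *: D X by exact: linearZ.
rewrite -/c ketbra_clockst.
rewrite (linear_sum D) mulmx_suml braket_sumr Re_sum.
rewrite /s2 big_allpairs; apply: eq_bigr => E _.
under eq_bigr do rewrite big_allpairs.
rewrite [RHS]exchange_big /= (linear_sum D) mulmx_suml braket_sumr Re_sum.
apply: eq_bigr => E' _; rewrite DZ -scalemxAl braketZr.
rewrite {1}/clockst braket_suml mulr_sumr Re_sum; apply: eq_bigr => F _.
rewrite braketZl /clockst mulmx_sumr braket_sumr !mulr_sumr Re_sum.
apply: eq_bigr => F' _; congr complex.Re.
rewrite -scalemxAr braketZr /z /= [(_ * _)^*]rmorphM /= conj_cis conj_realc opprK.
rewrite /al /= -/(b F) -/(b F') /om /= !realcM.
have -> : cis (t * (F - F' - (E - E'))) = cis (t * (E' - E)) * cis (t * F) * cis (- (t * F')).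
  by rewrite -!cisD; congr cis; ring.
by ring.
Qed.

Lemma cl_fidelity_avg_bound (T : seq R) :
  (forall x y, x \in s2 -> y \in s2 -> om x y != 0 -> \sum_(t <- T) cis (t * om x y) = 0) ->
  \sum_(t <- T) cl_fidelity e p w D t <=
  (size T)%:R * (qm * (\sum_(E <- Sp e n) c E) ^+ 2).
Proof.
move=> hT.
have [cp tr] := hD.
pose N : R := (size T)%:R.
have N0 : 0 <= N by exact: ler0n.
pose del x y : R := (om x y == 0)%:R.
have -> : \sum_(t <- T) cl_fidelity e p w D t =
   N * \sum_(x <- s2) \sum_(y <- s2) del x y * al x y * complex.Re (z x y).
  under eq_bigr do rewrite cl_fidelity_expand.
  rewrite exchange_big mulr_sumr; apply: eq_big_seq => x sx.
  rewrite exchange_big mulr_sumr; apply: eq_big_seq => y sy.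
  rewrite -Re_sum -mulr_suml -mulr_suml /del.
  case: (eqVneq (om x y) 0) => [omz|omz].
    rewrite omz; under eq_bigr do rewrite mulr0 cis0.
    rewrite big_const_seq count_predT iter_addr_0.
    have -> : (1 *+ size T : C) = N%:C by rewrite rmorph_nat.
    by rewrite -mulrA !Re_realM mul1r.
  by rewrite hT // !mul0r mulr0.
apply: ler_wpM2l => //.
pose a (x : R * R) := complex.Re (z x x).
have a0 x : 0 <= a x by apply: realc_Re_ge0; apply: cp_psd.
have al0 x y : 0 <= al x y by rewrite /al !mulr_ge0.
have del0 x y : 0 <= del x y by exact: ler0n.
have delC x y : del x y = del y x.
  rewrite /del; congr (nat_of_bool _)%:R.
  by rewrite -[RHS]oppr_eq0; congr (_ == _); rewrite /om; ring.
have alC x y : al x y = al y x by rewrite /al; ring.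
(* Off-diagonal matrix elements are traded for diagonal ones, as [cp_offdiag] permits under
   symmetric weights. *)
apply: (@le_trans _ _ (\sum_(x <- s2) \sum_(y <- s2) del x y * al x y * a x)).
  apply: sym_sum_le => [x y|x y|x y]; first by rewrite mulr_ge0.
    by rewrite [del x y]delC [al x y]alC.
  exact: cp_offdiag.
have alq x y : al x y <= c x.1 * c y.1 * qm.
  rewrite /al ler_wpM2l ?mulr_ge0 //.
  have hq0 : 0 <= qm by apply: le_trans (hqm 0); exact: pE_ge0.
  have bq F : b F <= Num.sqrt qm by rewrite ler_sqrt.
  by rewrite -[qm]sqr_sqrtr // expr2 ler_pM.
apply: (@le_trans _ _ (\sum_(x <- s2) \sum_(y <- s2) del x y * (c x.1 * c y.1 * qm) * a x)).
  apply: ler_sum => x _; apply: ler_sum => y _.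
  by rewrite ler_wpM2r // ler_wpM2l.
have q0 : 0 <= qm by apply: le_trans (hqm 0); exact: pE_ge0.
apply: (@le_trans _ _ (\sum_(x <- s2) \sum_(E' <- Sp e n) c x.1 * c E' * qm * a x)).
  apply: ler_sum => x _; rewrite /s2 big_allpairs; apply: ler_sum => E' _ /=.
  under eq_bigr do rewrite -mulrA.
  rewrite -mulr_suml ler_piMl ?mulr_ge0 //.
  (* Once [E], [F] and [E'] are given, resonance forces [F' = F0], so the inner sum is at most 1. *)
  pose F0 := x.2 - (x.1 - E').
  rewrite (eq_bigr (fun F' => if F0 == F' then 1 else 0)) => [|F' _]; last first.
    rewrite /del /om /F0 /=; case: eqVneq => [h|h].
      by rewrite ifT //; apply/eqP; rewrite -[RHS]addr0 -[in RHS]h; ring.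
    by rewrite ifF //; apply: contraNF h => /eqP <-; apply/eqP; ring.
  case: (boolP (F0 \in Sp e m)) => FS.
    by rewrite (sum_pick (fun=> 1) (uniq_Sp e m) FS).
  rewrite big_seq big1 // => F' SF'; rewrite ifF //.
  by apply: contraNF FS => /eqP ->.
rewrite /s2 big_allpairs.
have -> : qm * (\sum_(E <- Sp e n) c E) ^+ 2 =
    \sum_(E <- Sp e n) \sum_(E' <- Sp e n) c E * c E' * qm.
  rewrite expr2 mulr_suml mulr_sumr; apply: eq_bigr => E _.
  by rewrite !mulr_sumr; apply: eq_bigr => E' _; ring.
rewrite big_seq [leRHS]big_seq; apply: ler_sum => E SE.
rewrite exchange_big /=; apply: ler_sum => E' _.
rewrite -mulr_sumr ler_piMr ?mulr_ge0 //.
(* For fixed [E], the diagonal elements over all [F] sum to at most the trace of the image of a pure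
   state, which is 1. *)
apply: le_trans (psd_trace_le (f := km) (uniq_Sp e m) _ (cp_psd (kn E) cp)) _.
  by move=> F F' SF _; exact: ketE_orth.
have -> : \tr (D (ketbra (kn E) (kn E))) = 1; last by [].
by rewrite tr /ketbra mxtrace_mulC /mxtrace big_ord1 -[LHS]/(braket _ _) ketE_orth // eqxx.
Qed.

Lemma cl_inf_le : inf (range (cl_fidelity e p w D)) <=
  qm * (\sum_(E <- Sp e n) camp e p n w E) ^+ 2.
Proof.
have [T [T0 hT]] := exists_averaging_times [seq om x y | x <- s2, y <- s2].
have h : (size T)%:R * inf (range (cl_fidelity e p w D)) <=
    \sum_(t <- T) cl_fidelity e p w D t.
  rewrite -sum1_size natr_sum mulr_suml; apply: ler_sum => t _; rewrite mul1r.
  apply: ge_inf; last by exists t.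
  by exists 0 => _ [u _ <-]; exact: cl_fidelity_ge0.
have := le_trans h (cl_fidelity_avg_bound _).
rewrite ler_pM2l ?ltr0n //; apply => x y sx sy; apply: hT.
by apply/allpairsP; exists (x, y).
Qed.

End CloningBound.

(** * Metrology as measure-and-prepare cloning *)

Section PsdMatrices.
Variable R : realType.
Local Notation C := R[i].

(** The factors 1 and i in [u + c w] separate the two cross terms, as complex scalars allow. *)
Lemma polarization N (A : 'M[C]_N) :
  (forall v : 'cV[C]_N, braket v (A *m v) = 0) -> A = 0.
Proof.
move=> h.
have key (u w : 'cV[C]_N) : braket u (A *m w) = 0.
  have E (c : C) : c * braket u (A *m w) + c^* * braket w (A *m u) = 0.
    have := h (u + c *: w); rewrite mulmxDr !braketDr !braketDl -scalemxAr !braketZr !braketZl !h.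
    by rewrite !mulr0 addr0 add0r addrC.
  have E1 := E 1; rewrite conjC1 !mul1r in E1.
  have /eqP := E 'i%C; rewrite -[('i%C)^*]/(conjc _) /=.
  have -> : (0 -i* 1 : C) = - 'i%C by apply/eqP; rewrite eq_complex /= oppr0 !eqxx.
  rewrite mulNr -mulrBr mulf_eq0 => /orP[|].
    by rewrite eq_complex /= eqxx oner_eq0 andbF.
  rewrite subr_eq0 => /eqP E2; move: E1; rewrite -E2 -mulr2n => /eqP.
  by rewrite mulrn_eq0 => /eqP.
apply/matrixP => x y; rewrite mxE -(key (delta_mx x 0) (delta_mx y 0)).
rewrite -colE braketE (bigD1 x) //= big1 ?addr0 => [|k kx].
  by rewrite !mxE !eqxx conjC1 mul1r.
by rewrite !mxE (negbTE kx) conjC0 mul0r.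
Qed.

Lemma mxtrace_ketbra N (u v : 'cV[C]_N) : \tr (ketbra u v) = braket v u.
Proof. by rewrite /ketbra mxtrace_mulC /mxtrace big_ord1. Qed.

Lemma braket_adj N N' (A : 'M[C]_(N, N')) (u : 'cV[C]_N') (v : 'cV[C]_N) :
  braket u (A^t* *m v) = braket (A *m u) v.
Proof. by rewrite /braket trmx_mul map_mxM mulmxA. Qed.

Lemma psd_selfadj N (A : 'M[C]_N) : psdmx A -> A^t* = A.
Proof.
move=> pA; apply/eqP; rewrite -subr_eq0; apply/eqP; apply: polarization => v.
rewrite mulmxBl braketDr braketNr braket_adj -braket_conj.
by rewrite conj_Creal ?subrr // ger0_real.
Qed.

(** In an eigenbasis of [M] the trace is a sum of nonnegative eigenvalues times diagonal entries of
    [Y]. *)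
Lemma psd_trace_mul_ge0 N (M Y : 'M[C]_N) : psdmx M -> psdmx Y -> 0 <= \tr (M *m Y).
Proof.
move=> pM pY; have /orthomx_spectralP ME := selfadj_normalmx (psd_selfadj pM).
set P := spectralmx M in ME; set D := spectral_diag M in ME.
have uP : P \in unitmx := spectral_unit M.
have PV : invmx P = P^t* by apply: invmx_unitary; exact: spectral_unitarymx.
have form (A : 'M[C]_N) i : (P *m A *m invmx P) i i = braket ((row i P)^t*) (A *m (row i P)^t*).
  rewrite PV /braket.
  have -> : ((row i P)^t*)^t* = row i P.
    by apply/matrixP => x y; rewrite !mxE conjCK.
  rewrite mulmxA !mxE; apply: eq_bigr => k _; rewrite !mxE; congr (_ * _).
  by apply: eq_bigr => l _; rewrite !mxE.
have D0 i : 0 <= D 0 i.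
  have := pM ((row i P)^t*); rewrite -form [X in P *m X]ME.
  rewrite !mulmxA mulmxV // mul1mx -mulmxA mulmxV // mulmx1.
  by rewrite mxE eqxx mulr1n.
rewrite ME -!mulmxA mxtrace_mulC -!mulmxA /mxtrace; apply: sumr_ge0 => i _.
by rewrite mul_diag_mx mxE !mulmxA form mulr_ge0.
Qed.

End PsdMatrices.

(** * Measure-and-prepare channels and integration against a POVM *)

Section MeasurePrepare.
Variables (R : realType) (N N' : nat) (K : finType).
Local Notation C := R[i].
Variables (M : K -> 'M[C]_N) (g : K -> 'cV[C]_N').

Definition mprep (X : 'M[C]_N) : 'M[C]_N' := \sum_k \tr (M k *m X) *: ketbra (g k) (g k).

Lemma mprep_is_linear : linear mprep.
Proof.
move=> a X Y; rewrite /mprep scaler_sumr -big_split; apply: eq_bigr => k _ /=.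
by rewrite mulmxDr -scalemxAr mxtraceD mxtraceZ scalerDl scalerA.
Qed.

HB.instance Definition _ :=
  GRing.isLinear.Build C 'M[C]_N 'M[C]_N' *:%R mprep mprep_is_linear.

Hypotheses (pM : forall k, psdmx (M k)) (sM : \sum_k M k = 1%:M).
Hypothesis (g1 : forall k, braket (g k) (g k) = 1).

Lemma mprep_channel : is_channel mprep.
Proof.
split; last first.
  move=> X; rewrite /mprep linear_sum /=.
  rewrite (eq_bigr (fun k => \tr (M k *m X))) => [|k _]; last first.
    by rewrite mxtraceZ mxtrace_ketbra g1 mulr1.
  by rewrite -linear_sum /= -mulmx_suml sM mul1mx.
move=> k X pX y.
rewrite -[y](submxcolK (p_ := fun _ : 'I_k => N')) mul_mxblock_mxrow braket_mxcol.
set v := submxcol y.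
(* [Y a] contracts the output side with [v] and the prepared state [g a]. Its form at [z] is the
   form of [X] at the stack of the vectors [braket (g a) (v i) *: z], so it is positive. *)
pose Y a := \sum_i \sum_j (braket (v i) (g a) * braket (g a) (v j)) *: submxblock X i j.
have -> : \sum_i braket (v i) (\sum_j mprep (submxblock X i j) *m v j) =
    \sum_a \tr (M a *m Y a).
  under eq_bigr => i _ do rewrite braket_sumr.
  rewrite /mprep.
  under eq_bigr => i _ do under eq_bigr => j _ do rewrite mulmx_suml braket_sumr.
  under eq_bigr => i _ do rewrite exchange_big /=.
  rewrite exchange_big /=; apply: eq_bigr => a _.
  rewrite /Y mulmx_sumr linear_sum; apply: eq_bigr => i _ /=.
  rewrite mulmx_sumr linear_sum; apply: eq_bigr => j _ /=.
  rewrite -scalemxAr mxtraceZ -scalemxAl braketZr ketbra_mul braketZr.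
  by rewrite mulrC [X in X * _ = _]mulrC.
apply: sumr_ge0 => a _; apply: psd_trace_mul_ge0 => // z.
have := pX (\mxcol_i (braket (g a) (v i) *: z)).
rewrite -{1}[X](submxblockK (p_ := fun _ : 'I_k => N) (q_ := fun _ : 'I_k => N)).
rewrite mul_mxblock_mxrow braket_mxcol; congr (0 <= _).
rewrite /Y mulmx_suml braket_sumr; apply: eq_bigr => i _.
rewrite mulmx_suml !braket_sumr; apply: eq_bigr => j _.
rewrite -scalemxAl braketZr -scalemxAr braketZl braketZr braket_conj.
by rewrite mulrA.
Qed.

End MeasurePrepare.

Section PovmMeasure.
Variables (R : realType) (N : nat).
Local Notation C := R[i].
Local Notation T := (measurableTypeR R).
Variables (M : set T -> 'M[C]_N) (hM : is_povm M) (v : 'cV[C]_N).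

(** Additivity along the constant sequence of empty sets makes [c *+ n] converge to [c]; consecutive
    terms differ by [c], so [c = 0]. *)
Let povm_dist0 : povm_dist M v set0 = 0%E.
Proof.
have [_ _ /(_ v) add] := hM.
set c := complex.Re (braket v (M set0 *m v)).
have := add (fun _ => set0) (fun=> measurable0) (@trivIset_set0 _ _ _).
rewrite bigcup0 // => /(_ measurable0) h.
have h1 : c *+ n @[n --> \oo] --> c.
  have -> : (fun n => c *+ n) = fine \o (fun n => \sum_(0 <= i < n) povm_dist M v set0)%E.
    apply/funext => n /=; rewrite /povm_dist -/c sumEFin /= big_const_nat subn0.
    by rewrite iter_addr_0.
  exact: fine_cvg h.
have h2 : c *+ n.+1 @[n --> \oo] --> c.
  by have := h1; rewrite -(cvg_shiftS (fun n => c *+ n)).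
have h3 : (c *+ n.+1 - c *+ n) @[n --> \oo] --> c - c by apply: cvgB.
have h4 : (c *+ n.+1 - c *+ n) @[n --> \oo] --> c.
  rewrite (_ : (fun n => _) = fun=> c); first exact: cvg_cst.
  by apply/funext => n; rewrite mulrS addrK.
by rewrite /povm_dist -/c -(cvg_unique _ h3 h4) // subrr.
Qed.

(* povm_dist is constrained on measurable sets only. *)
Definition povm_meas of is_povm M := fun B : set T =>
  if `[< measurable B >] then povm_dist M v B else 0%E.

Let povm_meas0 : povm_meas hM set0 = 0%E.
Proof. by rewrite /povm_meas povm_dist0; case: ifP. Qed.

Let povm_meas_ge0 B : (0 <= povm_meas hM B)%E.
Proof.
rewrite /povm_meas; case: ifP => [/asboolP mB|//].
have [/(_ B mB) pB _ _] := hM.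
by rewrite lee_fin; apply: realc_Re_ge0; exact: pB.
Qed.

Let povm_meas_sigma : semi_sigma_additive (povm_meas hM).
Proof.
have [_ _ /(_ v) add] := hM.
move=> F mF tF mU.
have -> : povm_meas hM (\bigcup_n F n) = povm_dist M v (\bigcup_n F n).
  by rewrite /povm_meas; case: asboolP.
have -> : (fun n => \sum_(0 <= i < n) povm_meas hM (F i))%E =
          (fun n => \sum_(0 <= i < n) povm_dist M v (F i))%E.
  by apply/funext => n; apply: eq_bigr => i _; rewrite /povm_meas; case: asboolP => // -[].
exact: add.
Qed.

HB.instance Definition _ := isMeasure.Build _ T R (povm_meas hM)
  povm_meas0 povm_meas_ge0 povm_meas_sigma.

Import HBNNSimple.

(** The integral against any set function is built from simple functions, whose level sets are
    measurable; there [povm_dist] and the genuine measure agree. *)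
Lemma integral_povm (f : T -> \bar R) :
  (\int[povm_dist M v]_x f x = \int[povm_meas hM]_x f x)%E.
Proof.
have E (h : {nnsfun T >-> R}) : sintegral (povm_dist M v) h = sintegral (povm_meas hM) h.
  have mh : measurable_fun setT h by exact: measurable_funP.
  apply: eq_fsbigr => x _; congr (_ * _)%E.
  have mx := mh measurableT _ (measurable_set1 x); rewrite setTI in mx.
  by rewrite /povm_meas (asboolT mx).
rewrite /integral; congr (ereal_sup _ - ereal_sup _)%E.
  by apply/seteqP; split => _ [h hh <-]; exists h => //; rewrite E.
by apply/seteqP; split => _ [h hh <-]; exists h => //; rewrite E.
Qed.

Lemma povm_measE B : measurable B -> povm_meas hM B = povm_dist M v B.
Proof. by move=> mB; rewrite /povm_meas; case: asboolP. Qed.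

End PovmMeasure.

Section Cells.
Variables (R : realType) (K : finType).
Local Notation T := (measurableTypeR R).
Variables (key : T -> K) (mkey : forall k, measurable [set x | key x = k]).
Variable (mu : {measure set T -> \bar R}).

Lemma integral_cells (g : K -> R) : (forall k, 0 <= g k) ->
  measurable_fun setT (fun x => (g (key x))%:E) /\
  (\int[mu]_x (g (key x))%:E = \sum_k (g k)%:E * mu [set x | key x = k])%E.
Proof.
move=> g0.
have E : (fun x => (g (key x))%:E) = (fun x => \sum_k (g k * \1_[set x | key x = k] x)%:E)%E.
  apply/funext => x; rewrite sumEFin (bigD1 (key x)) //= big1 ?addr0 => [|k kx].
    by rewrite indicE mem_set // mulr1.
  rewrite indicE memNset ?mulr0 // => /= h; by rewrite h eqxx in kx.
have mi k : measurable_fun setT (fun x : T => (g k * \1_[set x | key x = k] x)%:E).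
  apply/measurable_EFinP; apply: measurable_funM; first exact: measurable_cst.
  exact: measurable_indic.
rewrite E; split; first by apply: emeasurable_sum.
rewrite ge0_integral_sum //; last first.
  by move=> k x _; rewrite lee_fin mulr_ge0 // indicE ler0n.
apply: eq_bigr => k _; under eq_integral do rewrite EFinM.
rewrite ge0_integralZl_EFin //.
- by rewrite integral_indic ?setIT.
- by apply/measurable_EFinP; exact: measurable_indic.
Qed.

End Cells.

Section PhaseCells.
Variables (R : realType) (L : nat) (L0 : (0 < L)%N) (h : R -> R).
Hypotheses (hc : continuous h) (h1 : forall x, `|h x| <= 1).

(** Cells of width [1 / L] in the value of [h], not in [x]. Since [h] lies in [-1, 1] the levels run
    from 0 to [2 * L], the last one reached only at [h x = 1]. *)
Definition phase_cell (x : R) : 'I_(2 * L).+1 := inord (Num.truncn (L%:R * (1 + h x))).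

Let Lh0 x : 0 <= L%:R * (1 + h x).
Proof. by rewrite mulr_ge0 //; have := h1 x; rewrite ler_norml => /andP[]; lra. Qed.

Let truncn_le x : (Num.truncn (L%:R * (1 + h x)) <= 2 * L)%N.
Proof.
rewrite -(ler_nat R); apply: le_trans (proj1 (andP (truncn_itv (Lh0 x)))) _.
rewrite natrM mulrC ler_wpM2r //; have := h1 x; rewrite ler_norml => /andP[]; lra.
Qed.

Let phase_cellE x : phase_cell x = Num.truncn (L%:R * (1 + h x)) :> nat.
Proof. by rewrite /phase_cell inordK // ltnS. Qed.

Lemma measurable_phase_cell k :
  measurable ([set x | phase_cell x = k] : set (measurableTypeR R)).
Proof.
have -> : [set x | phase_cell x = k] =
    (fun x => L%:R * (1 + h x)) @^-1` `[(k : nat)%:R, (k : nat).+1%:R[.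
  apply/seteqP; split => x /=; rewrite in_itv /=.
    by move=> <-; rewrite phase_cellE; apply: truncn_itv.
  by move=> /truncn_def e; apply: val_inj; rewrite /= phase_cellE e.
rewrite -[X in measurable X]setTI.
have mf : measurable_fun setT (fun x : R => L%:R * (1 + h x)).
  apply: continuous_measurable_fun => x; apply: cvgM; first exact: cvg_cst.
  by apply: cvgD; [exact: cvg_cst|exact: hc].
by apply: mf => //; exact: measurable_itv.
Qed.

Lemma phase_cell_dist x y : phase_cell x = phase_cell y -> `|h x - h y| <= L%:R^-1.
Proof.
move=> /(congr1 (@nat_of_ord _)); rewrite !phase_cellE => e.
have := truncn_itv (Lh0 x); have := truncn_itv (Lh0 y); rewrite e.
set k := Num.truncn _; rewrite -natr1 => /andP[y1 y2] /andP[x1 x2].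
have LR : 0 < L%:R :> R by rewrite ltr0n.
rewrite -(ler_pM2l LR) divff ?gt_eqF // -(ger0_norm (ltW LR)) -normrM.
by rewrite ler_norml; apply/andP; split; rewrite mulrBr; nra.
Qed.

End PhaseCells.

Section Metrology.
Variables (R : realType) (d1 : nat) (e p : 'I_d1.+1 -> R).
Hypotheses (he0 : e ord0 = 0) (hp_gt0 : forall j, 0 < p j).
Variables (n m : nat) (w : R -> R).
Hypotheses (hw : forall E, E \in Sp e n -> 0 <= w E) (hPs : 0 < Psucc e p n w).
Local Notation C := R[i].
Local Notation TR := (measurableTypeR R).

Let c := camp e p n w.
Let Phi t := clockst e p n c t.

Section Fidelity.
Variable phat : R -> R.
Hypothesis hphat : is_distribution (Sp e m) phat.

Definition samp E := Num.sqrt (phat E) * Num.sqrt (pE e p m E).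

Let s0 E : 0 <= samp E. Proof. by rewrite mulr_ge0 ?sqrtr_ge0. Qed.

Definition overlap (t tau : R) : C := \sum_(E <- Sp e m) cis ((tau - t) * E) * (samp E)%:C.
Definition score t tau : R := normc (overlap t tau) ^+ 2.

Lemma scoreE t tau :
  complex.Re (`|braket (guess e p m phat tau) (Psi e p m t)| ^+ 2) = score t tau.
Proof.
rewrite guess_clockst (Psi_clockst he0 hp_gt0) (braket_clockst he0 hp_gt0).
by rewrite -add_Re2_Im2 /= -normc_sqr.
Qed.

Lemma score_ge0 t tau : 0 <= score t tau.
Proof. exact: sqr_ge0. Qed.

Lemma measurable_score t : measurable_fun (setT : set TR) (fun tau => (score t tau)%:E).
Proof.
apply/measurable_EFinP.
pose A tau := \sum_(E <- Sp e m) samp E * cos ((tau - t) * E).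
pose B tau := \sum_(E <- Sp e m) samp E * sin ((tau - t) * E).
have -> : score t = (fun tau => A tau ^+ 2 + B tau ^+ 2).
  apply/funext => tau; rewrite /score normc_sqr /overlap Re_sum Im_sum.
  congr (_ ^+ 2 + _ ^+ 2); apply: eq_bigr => E _.
    by rewrite mulrC Re_realM.
  by rewrite mulrC Im_realM.
have cm (f : R -> R) : continuous f -> continuous (fun tau => \sum_(E <- Sp e m) samp E * f ((tau - t) * E)).
  move=> cf tau; elim: (Sp e m) => [|E s IH].
    by under eq_fun do rewrite big_nil; exact: cvg_cst.
  under eq_fun do rewrite big_cons.
  rewrite ?big_cons; apply: cvgD; last exact: IH.
  apply: cvgM; first exact: cvg_cst.
  apply: (@continuous_cvg _ _ _ _ _ _ f); first exact: cf.
  by apply: cvgM; [apply: cvgB; [exact: cvg_id|exact: cvg_cst]|exact: cvg_cst].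
apply: continuous_measurable_fun => tau.
have sq (f : R -> R) : continuous f -> (fun x => f x ^+ 2) x @[x --> tau] --> f tau ^+ 2.
  move=> cf; rewrite expr2; rewrite (_ : (fun x => _) = fun x => f x * f x).
    by apply: cvgM; exact: cf.
  by apply/funext => x; rewrite expr2.
apply: cvgD; apply: sq; apply: cm; [exact: continuous_cos|exact: continuous_sin].
Qed.

Lemma pm_fidelityE (M : set TR -> 'M[C]_(tdim d1.+1 n)) t :
  pm_fidelity e p w m M phat t = fine (\int[povm_dist M (Phi t)]_tau (score t tau)%:E)%E.
Proof.
rewrite /pm_fidelity (filteredE he0 hp_gt0 hw hPs); congr (fine _).
by congr integral; apply/funext => tau; rewrite scoreE.
Qed.

Lemma guess_norm tau : braket (guess e p m phat tau) (guess e p m phat tau) = 1.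
Proof.
rewrite guess_clockst (braket_clockst he0 hp_gt0).
have [h0 h1] := hphat.
rewrite -[RHS]/(1%:C) -h1 realc_sum; apply: eq_big_seq => E SE.
by rewrite subrr mul0r cis0 mul1r -expr2 sqr_sqrtr // h0.
Qed.

Lemma sum_cc : \sum_(E <- Sp e n) c E * c E = 1.
Proof.
have P0 : Psucc e p n w != 0 by rewrite gt_eqF.
rewrite -(divff P0) {1}/Psucc mulr_suml; apply: eq_big_seq => E SE.
rewrite /c /camp -expr2 sqr_sqrtr; first by ring.
by rewrite mulr_ge0 ?pE_ge0 // divr_ge0 ?hw // ltW.
Qed.

Lemma Phi_norm t : braket (Phi t) (Phi t) = 1.
Proof.
rewrite /Phi (braket_clockst he0 hp_gt0) -[RHS]/(1%:C) -sum_cc realc_sum.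
by apply: eq_bigr => E _; rewrite subrr mul0r cis0 mul1r.
Qed.

Let stot := \sum_(E <- Sp e m) samp E.

Lemma overlap_le t tau : normc (overlap t tau) <= stot.
Proof.
apply: le_trans (normc_sum _ _ _) _; apply: ler_sum => E _.
by rewrite Normc.normcM normc_cis mul1r normc_real ger0_norm.
Qed.

Lemma overlap_dist t x y (del : R) :
  (forall E, E \in Sp e m -> `|cos (x * E) - cos (y * E)| <= del /\
                             `|sin (x * E) - sin (y * E)| <= del) ->
  normc (overlap t x - overlap t y) <= 2 * del * stot.
Proof.
move=> h; rewrite /overlap -sumrB.
apply: le_trans (normc_sum _ _ _) _; rewrite mulr_sumr.
rewrite big_seq [leRHS]big_seq; apply: ler_sum => E SE.
rewrite -mulrBl Normc.normcM normc_real ger0_norm // ler_wpM2r //.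
have -> : cis ((x - t) * E) - cis ((y - t) * E) = (cis (x * E) - cis (y * E)) * cis (- (t * E)).
  by rewrite [RHS]mulrBl -!cisD !mulrBl.
rewrite Normc.normcM normc_cis mulr1.
apply: le_trans (normc_le_ReIm _) _; rewrite !raddfB /=.
by have [h1 h2] := h E SE; rewrite mulr_natl mulr2n lerD.
Qed.

(** The 4 is one factor 2 for the real and imaginary parts of the overlap and another from
    [a ^ 2 - b ^ 2 = (a - b) (a + b)] with both moduli at most [stot]. *)
Lemma score_dist t x y (del : R) : 0 <= del ->
  (forall E, E \in Sp e m -> `|cos (x * E) - cos (y * E)| <= del /\
                             `|sin (x * E) - sin (y * E)| <= del) ->
  score t x <= score t y + 4 * del * stot ^+ 2.
Proof.
move=> d0 h; rewrite /score.
set a := normc (overlap t x); set b := normc (overlap t y).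
have ab : a <= b + 2 * del * stot.
  rewrite addrC -lerBlDr; apply: le_trans (overlap_dist t h).
  rewrite lerBlDr /a -{1}[overlap t x](subrK (overlap t y)).
  exact: le_normcD.
have a1 : a <= stot by exact: overlap_le.
have b1 : b <= stot by exact: overlap_le.
have a0 : 0 <= a by exact: normc_ge0.
have b0 : 0 <= b by exact: normc_ge0.
have -> : a ^+ 2 = b ^+ 2 + (a - b) * (a + b) by ring.
rewrite lerD2l.
have S0 : 0 <= stot by exact: le_trans a0 a1.
case: (leP (a - b) 0) => [ab0|ab0].
  apply: (@le_trans _ _ 0); first by rewrite mulr_le0_ge0 // addr_ge0.
  by rewrite !mulr_ge0 ?sqr_ge0.
apply: (@le_trans _ _ ((2 * del * stot) * (stot + stot))).
  by apply: ler_pM; [exact: ltW|exact: addr_ge0|rewrite lerBlDr addrC|exact: lerD].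
by rewrite le_eqVlt; apply/orP; left; apply/eqP; ring.
Qed.

(* The clones are the guesses attached to finitely many cells of estimated times,
   fine enough for the score to be almost constant on each cell. *)
Lemma pm_le_cl (M : set TR -> 'M[C]_(tdim d1.+1 n)) (eps : R) : is_povm M -> 0 < eps ->
  exists2 D : {linear 'M[C]_(tdim d1.+1 n) -> 'M[C]_(tdim d1.+1 m)}, is_channel D &
    forall t, pm_fidelity e p w m M phat t <= cl_fidelity e p w D t + eps.
Proof.
move=> hM eps0.
(* Makes the error of [score_dist] with [del = 1 / L] at most [eps]. *)
pose L := (Num.truncn (4 * stot ^+ 2 / eps)).+1.
have L0 : (0 < L)%N by [].
pose h (ib : 'I_(size (Sp e m)) * bool) (x : R) : R :=
  if ib.2 then cos (x * (Sp e m)`_ib.1) else sin (x * (Sp e m)`_ib.1).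
have hcont ib : continuous (h ib).
  move=> x; rewrite /h; case: ib.2.
    apply: (@continuous_cvg _ _ _ _ _ _ (@cos R)); first exact: continuous_cos.
    by apply: cvgM; [exact: cvg_id|exact: cvg_cst].
  apply: (@continuous_cvg _ _ _ _ _ _ (@sin R)); first exact: continuous_sin.
  by apply: cvgM; [exact: cvg_id|exact: cvg_cst].
have h1 ib x : `|h ib x| <= 1 by rewrite /h; case: ib.2; [exact: cos_max|exact: sin_max].
(* Times are sorted by the phases they produce at all output energies, so finitely many cells cover
   the unbounded line. *)
pose K := {ffun 'I_(size (Sp e m)) * bool -> 'I_(2 * L).+1}.
pose key (x : TR) : K := [ffun ib => phase_cell L (h ib) x].
have mkey k : measurable [set x : TR | key x = k].
  have -> : [set x : TR | key x = k] =
     \bigcap_(ib in [set` predT]) [set x | phase_cell L (h ib) x = k ib].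
    apply/seteqP; split => x /=; first by move=> <- ib _; rewrite /= ffunE.
    by move=> hx; apply/ffunP => ib; rewrite ffunE; exact: hx.
  apply: fin_bigcap_measurable; first exact: finite_finpred.
  by move=> ib _; exact: measurable_phase_cell.
(* A representative time of each cell; an empty cell gets the arbitrary time 0, which still yields a
   unit vector [g k]. *)
pose pt (k : K) : R := if pselect (exists x : TR, key x = k) is left ex then sval (cid ex) else 0.
have keypt x : key (pt (key x)) = key x.
  rewrite /pt; case: pselect => [ex|nex]; first by case: cid.
  by exfalso; apply: nex; exists x.
pose Mk k := M [set x : TR | key x = k].
pose g k := guess e p m phat (pt k).
have [psM totM addM] := hM.
have sMk : \sum_k Mk k = 1%:M.
  apply/eqP; rewrite -subr_eq0; apply/eqP; apply: polarization => v.
  have [_] := integral_cells mkey (povm_meas v hM) (fun _ : K => ler01).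
  rewrite integral_cst //= mul1e povm_measE // /povm_dist totM mul1mx.
  under eq_bigr do rewrite mul1e povm_measE // /povm_dist.
  rewrite sumEFin => /(congr1 fine) /= E1.
  have pr (A : 'M[C]_(tdim d1.+1 n)) : psdmx A -> braket v (A *m v) = (complex.Re (braket v (A *m v)))%:C.
    by move=> /(_ v); case: (braket v _) => a b; rewrite lecE /= => /andP[/eqP -> _].
  have vv : braket v v = (complex.Re (braket v v))%:C.
    rewrite -[X in braket v X]mul1mx -totM; apply: pr; exact: psM.
  rewrite mulmxBl mul1mx braketDr braketNr vv E1 realc_sum mulmx_suml braket_sumr.
  apply/eqP; rewrite subr_eq0; apply/eqP; apply: eq_bigr => k _.
  by apply: pr; exact: psM.
have pMk k : psdmx (Mk k) by exact: psM.
have g1 k : braket (g k) (g k) = 1 by exact: guess_norm.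
exists (mprep Mk g : {linear _ -> _}); first exact: mprep_channel.
move=> t.
have clE : cl_fidelity e p w (mprep Mk g) t =
    \sum_k complex.Re (braket (Phi t) (Mk k *m Phi t)) * score t (pt k).
  rewrite /cl_fidelity (filteredE he0 hp_gt0 hw hPs) -/c -/(Phi t) /mprep.
  rewrite mulmx_suml braket_sumr Re_sum; apply: eq_bigr => k _.
  rewrite -scalemxAl braketZr ketbra_mul braketZr.
  have -> : \tr (Mk k *m ketbra (Phi t) (Phi t)) = (complex.Re (braket (Phi t) (Mk k *m Phi t)))%:C.
    rewrite /ketbra mulmxA -/(ketbra _ _) mxtrace_ketbra.
    by have := pMk k (Phi t); case: (braket _ _) => a b; rewrite lecE /= => /andP[/eqP -> _].
  rewrite Re_realM; congr (_ * _).
  by rewrite -scoreE normCK braket_conj.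
rewrite pm_fidelityE (integral_povm hM).
pose G k := score t (pt k) + eps.
have G0 k : 0 <= G k by rewrite addr_ge0 ?score_ge0 ?ltW.
have [mG iG] := integral_cells mkey (povm_meas (Phi t) hM) G0.
have le1 : (\int[povm_meas (Phi t) hM]_tau (score t tau)%:E <=
            \int[povm_meas (Phi t) hM]_tau (G (key tau))%:E)%E.
  apply: ge0_le_integral => //.
  - by move=> x _; rewrite lee_fin score_ge0.
  - exact: measurable_score.
  move=> x _; rewrite lee_fin /G.
  have del0 : 0 <= (L%:R : R)^-1 by rewrite invr_ge0.
  apply: le_trans (score_dist (y := pt (key x)) t del0 _) _.
    move=> E SE; have iE : (index E (Sp e m) < size (Sp e m))%N by rewrite index_mem.
    have ke := keypt x.
    have kk b : phase_cell L (h (Ordinal iE, b)) (pt (key x)) = phase_cell L (h (Ordinal iE, b)) x.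
      by have := congr1 (fun f : K => f (Ordinal iE, b)) ke; rewrite !ffunE.
    have H b := phase_cell_dist L0 (h1 (Ordinal iE, b)) (esym (kk b)).
    by split; [have := H true|have := H false]; rewrite /h /= nth_index.
  have hL : 4 * stot ^+ 2 / eps < L%:R by exact: truncnS_gt.
  by rewrite lerD2l mulrAC ler_pdivrMr ?ltr0n // [leRHS]mulrC -ler_pdivrMr // ltW.
have intG : (\int[povm_meas (Phi t) hM]_tau (G (key tau))%:E = (cl_fidelity e p w (mprep Mk g) t + eps)%:E)%E.
  rewrite iG /=.
  under eq_bigr do rewrite povm_measE // /povm_dist -EFinM.
  rewrite sumEFin clE; congr (_%:E).
  under eq_bigr do rewrite /G mulrDl.
  rewrite big_split /= -mulr_sumr; congr (_ + _).
    by apply: eq_bigr => k _; rewrite mulrC.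
  rewrite -Re_sum -braket_sumr -mulmx_suml sMk mul1mx Phi_norm.
  by rewrite /= mulr1.
rewrite intG in le1.
have ge0 : (0 <= \int[povm_meas (Phi t) hM]_tau (score t tau)%:E)%E.
  by apply: integral_ge0 => x _; rewrite lee_fin score_ge0.
rewrite -lee_fin fineK //; apply/fin_numPlt; rewrite (lt_le_trans _ ge0) ?ltNyr //=.
exact: le_lt_trans le1 (ltry _).
Qed.

End Fidelity.

End Metrology.

(** * Lower bound on the metrology fidelity *)

Section Atomic.
Variable R : realType.
Local Notation TR := (measurableTypeR R).

Definition atomic (s : seq (R * R)) (B : set TR) : \bar R :=
  (\sum_(x <- s) x.1 * \1_B x.2)%:E.

Lemma atomic_measure (s : seq (R * R)) : (forall x, x \in s -> 0 <= x.1) ->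
  exists2 mu : {measure set TR -> \bar R}, atomic s = mu &
  forall f : TR -> R, (forall x, 0 <= f x) ->
    measurable_fun setT (fun x => (f x)%:E) ->
    (\int[mu]_x (f x)%:E = (\sum_(x <- s) x.1 * f x.2)%:E)%E.
Proof.
elim: s => [|[a y] s IH] hs.
  exists mzero; first by apply/funext => B; rewrite /atomic big_nil.
  by move=> f f0 mf; rewrite integral_measure_zero big_nil.
have [|mu muE muI] := IH; first by move=> x sx; apply: hs; rewrite in_cons sx orbT.
have a0 : 0 <= a by have := hs (a, y); apply; rewrite in_cons eqxx.
exists (measure_add (mscale (NngNum a0) (\d_(y : TR))) mu).
  apply/funext => B; rewrite [RHS]measure_addE -muE /atomic big_cons EFinD; congr (_ + _)%E.
move=> f f0 mf; rewrite ge0_integral_measure_add //; last by move=> x _; rewrite lee_fin.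
rewrite ge0_integral_mscale //; last by move=> x _; rewrite lee_fin.
rewrite integral_dirac // diracT mul1e muI // big_cons EFinD EFinM //.
Qed.

End Atomic.

Section MetrologyLower.
Variables (R : realType) (d1 : nat) (e p : 'I_d1.+1 -> R).
Hypotheses (he0 : e ord0 = 0) (hp_gt0 : forall j, 0 < p j).
Variables (n m : nat) (w : R -> R).
Hypotheses (hw : forall E, E \in Sp e n -> 0 <= w E) (hPs : 0 < Psucc e p n w).
Variable phat : R -> R.
Local Notation C := R[i].
Local Notation TR := (measurableTypeR R).
Local Notation N := (tdim d1.+1 n).
Local Notation kn := (ketE e p n).

Let c := camp e p n w.
Let Phi t := clockst e p n c t.
Let s2 := [seq (E, F) | E <- Sp e n, F <- Sp e m].
Let freq (x y : R * R) : R := (x.1 + x.2) - (y.1 + y.2).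
Let wt (x : R * R) : R := c x.1 * samp e p m phat x.2.

(** Measurement and guess contribute phases [(tau - t) * E] and [(tau - t) * F] that add up, so
    averaging over [tau] retains exactly the pairs of equal total energy [E + F]. *)
Definition pm_value : R :=
  \sum_(x <- s2) \sum_(y <- s2) (freq x y == 0)%:R * (wt x * wt y).

Let eta tau := clockst e p n (fun=> 1) tau.
Let Q := compl_proj (Sp e n) kn.

Let kn_orth E E' : E \in Sp e n -> E' \in Sp e n -> braket (kn E) (kn E') = (E == E')%:R.
Proof. by move=> SE _; exact: ketE_orth. Qed.

Let Q_psd : psdmx Q.
Proof.
move=> v; rewrite /Q -(compl_proj_idem (uniq_Sp e n) kn_orth) -mulmxA.
rewrite -{1}(compl_proj_selfadj (Sp e n) kn) braket_adj braketE.
by apply: sumr_ge0 => x _; rewrite mulrC mul_conjC_ge0.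
Qed.

Let Q_Phi t : Q *m Phi t = 0.
Proof.
rewrite /Phi /clockst mulmx_sumr big_seq big1 // => E SE.
by rewrite -scalemxAr (compl_proj_ket (uniq_Sp e n) kn_orth SE) scaler0.
Qed.

Let overlap_eta tau t : braket (eta tau) (Phi t) = \sum_(E <- Sp e n) cis ((tau - t) * E) * (c E)%:C.
Proof.
rewrite (braket_clockst he0 hp_gt0); apply: eq_bigr => E _.
by rewrite mul1r.
Qed.

Let normc_conj (z : C) : complex.Re (z * z^*) = normc z ^+ 2.
Proof. by rewrite normc_sqr; case: z => a b; rewrite -[_^*]/(conjc _) /=; ring. Qed.

Let conj_cisM (a b : R) : (cis a * b%:C)^* = cis (- a) * b%:C.
Proof. by rewrite rmorphM /= conj_cis conj_realc. Qed.

Let conj_sum (s : seq (R * R)) (a : R * R -> R) :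
  (\sum_(x <- s) cis (a x) * (wt x)%:C)^* = \sum_(x <- s) cis (- a x) * (wt x)%:C.
Proof. by rewrite rmorph_sum; apply: eq_bigr => x _; exact: conj_cisM. Qed.

Let joint tau t : normc (braket (eta tau) (Phi t)) ^+ 2 * score e p m phat t tau =
  \sum_(x <- s2) \sum_(y <- s2) complex.Re (cis ((tau - t) * freq x y)) * (wt x * wt y).
Proof.
rewrite /score -exprMn -Normc.normcM overlap_eta /overlap.
have -> : (\sum_(E <- Sp e n) cis ((tau - t) * E) * (c E)%:C) *
   (\sum_(E <- Sp e m) cis ((tau - t) * E) * (samp e p m phat E)%:C) =
   \sum_(x <- s2) cis ((tau - t) * (x.1 + x.2)) * (wt x)%:C.
  rewrite /s2 big_allpairs mulr_suml; apply: eq_bigr => E _; rewrite mulr_sumr.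
  by apply: eq_bigr => F _; rewrite mulrACA -cisD -realcM -mulrDr.
rewrite -normc_conj conj_sum mulr_suml Re_sum; apply: eq_bigr => x _.
rewrite mulr_sumr Re_sum; apply: eq_bigr => y _.
rewrite mulrACA -cisD -realcM mulrC Re_realM.
by rewrite mulrC /freq; congr (complex.Re (cis _) * _); ring.
Qed.

(* The covariant measurement along the ray of all-ones clock states, restricted to
   finitely many averaging times. *)
Lemma pm_value_attained : exists2 M : set TR -> 'M[C]_N, is_povm M &
  forall t, pm_fidelity e p w m M phat t = pm_value.
Proof.
(* Two kinds of frequencies must cancel: those of the joint score, and the input differences
   [E' - E], which makes the averaged [eta] resolve the identity on the span of the [kn]. *)
have [T [T0 hT]] := exists_averaging_times
  ([seq freq x y | x <- s2, y <- s2] ++ [seq E' - E | E <- Sp e n, E' <- Sp e n]).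
pose S : R := (size T)%:R.
have S0 : 0 < S by rewrite ltr0n.
have Sn0 : S != 0 by rewrite gt_eqF.
have hfreq x y : x \in s2 -> y \in s2 -> freq x y != 0 -> \sum_(t <- T) cis (t * freq x y) = 0.
  by move=> sx sy; apply: hT; rewrite mem_cat; apply/orP; left; apply/allpairsP; exists (x, y).
have hdiff E E' : E \in Sp e n -> E' \in Sp e n -> E != E' -> \sum_(t <- T) cis (t * (E' - E)) = 0.
  move=> SE SE' EE; apply: hT; last by rewrite subr_eq0 eq_sym.
  by rewrite mem_cat; apply/orP; right; apply/allpairsP; exists (E, E').
(* [Q] completes the resolution of the identity. It is assigned the outcome 0 and annihilates every
   filtered state, so it does not affect the fidelity. *)
pose M (B : set TR) : 'M[C]_N :=
  \sum_(tau <- T) (\1_B tau / S)%:C *: ketbra (eta tau) (eta tau) + (\1_B 0)%:C *: Q.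
pose at_ (v : 'cV[C]_N) : seq (R * R) :=
  rcons [seq (normc (braket (eta tau) v) ^+ 2 / S, tau) | tau <- T]
        (complex.Re (braket v (Q *m v)), 0).
have at_ge0 v x : x \in at_ v -> 0 <= x.1.
  rewrite mem_rcons in_cons => /orP[/eqP -> /=|/mapP[tau _ ->] /=].
    exact: realc_Re_ge0 (Q_psd v).
  by rewrite divr_ge0 ?sqr_ge0 // ltW.
have distE v : povm_dist M v = atomic (at_ v).
  apply/funext => B; rewrite /povm_dist /atomic /at_ big_rcons /= big_map; congr (_%:E).
  rewrite /M mulmxDl braketDr mulmx_suml braket_sumr ReD Re_sum; congr (_ + _); last first.
    by rewrite -scalemxAl braketZr Re_realM mulrC.
  apply: eq_bigr => tau _; rewrite -scalemxAl braketZr Re_realM ketbra_mul braketZr.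
  by rewrite -[braket v _]braket_conj normc_conj mulrC mulrA mulrAC.
have indic_ge0 (B : set TR) x : 0 <= \1_B x :> R by rewrite indicE ler0n.
have hM : is_povm M.
  split.
  - move=> B _ v; rewrite /M mulmxDl braketDr mulmx_suml braket_sumr; apply: addr_ge0.
      apply: sumr_ge0 => tau _; rewrite -scalemxAl braketZr mulr_ge0 //; last exact: ketbra_psd.
      by rewrite realc_ge0 divr_ge0 // ltW.
    by rewrite -scalemxAl braketZr mulr_ge0 // ?realc_ge0.
  - rewrite /M indicT scale1r.
    have -> : \sum_(tau <- T) (1 / S)%:C *: ketbra (eta tau) (eta tau) =
        \sum_(E <- Sp e n) ketbra (kn E) (kn E).
      under eq_bigr do rewrite ketbra_clockst scaler_sumr.
      rewrite exchange_big; apply: eq_big_seq => E SE /=.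
      under eq_bigr do rewrite scaler_sumr.
      rewrite exchange_big /= -[RHS](sum_pick (fun E' => ketbra (kn E) (kn E')) (uniq_Sp e n) SE).
      apply: eq_big_seq => E' SE'.
      under eq_bigr do rewrite scalerA mulr1.
      rewrite -scaler_suml -mulr_sumr; case: eqVneq => [<-|EE].
        under eq_bigr do rewrite subrr mulr0 cis0 mulr1.
        rewrite big_const_seq count_predT iter_addr_0.
        have -> : (1 *+ size T : C) = S%:C by rewrite rmorph_nat.
        by rewrite -realcM divfK // scale1r.
      under eq_bigr do rewrite mulr1.
      by rewrite hdiff // mulr0 scale0r.
    by rewrite /Q /compl_proj addrC subrK.
  - move=> v; rewrite distE; have [mu -> _] := atomic_measure (at_ge0 v).
    exact: measure_semi_sigma_additive.
exists M => // t.
rewrite (pm_fidelityE he0 hp_gt0 m hw hPs) distE.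
have [mu -> ->] := atomic_measure (at_ge0 (Phi t)); last 2 first.
- by move=> x; exact: score_ge0.
- exact: measurable_score.
rewrite /= /at_ big_rcons /= Q_Phi braket0r /= mul0r addr0 big_map /=.
under eq_bigr => tau _ do rewrite mulrAC joint mulr_suml.
rewrite exchange_big /pm_value; apply: eq_big_seq => x sx /=.
under eq_bigr do rewrite mulr_suml.
rewrite exchange_big; apply: eq_big_seq => y sy /=.
under eq_bigr do rewrite -mulrA.
rewrite -mulr_suml.
have -> : \sum_(tau <- T) cos ((tau - t) * freq x y) =
    complex.Re (\sum_(tau <- T) cis ((tau - t) * freq x y)) by rewrite Re_sum.
(* The true time factors out as a phase, which is 1 at frequency zero and multiplies a vanishing sum
   otherwise; hence the same fidelity for every [t]. *)
have -> : \sum_(tau <- T) cis ((tau - t) * freq x y) =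
   cis (- (t * freq x y)) * \sum_(tau <- T) cis (tau * freq x y).
  by rewrite mulr_sumr; apply: eq_bigr => tau _; rewrite -cisD; congr cis; ring.
case: eqVneq => [f0|f0]; last by rewrite hfreq // mulr0 !mul0r.
rewrite f0 mulr0 oppr0 cis0 mul1r.
under eq_bigr do rewrite mulr0 cis0.
rewrite big_const_seq count_predT iter_addr_0.
have -> : (1 *+ size T : C) = S%:C by rewrite rmorph_nat.
by rewrite /= mul1r mulrC divfK.
Qed.

End MetrologyLower.

Section Sandwich.
Variables (R : realType) (d1 : nat) (e p : 'I_d1.+1 -> R).
Hypotheses (he0 : e ord0 = 0) (hp_gt0 : forall j, 0 < p j).
Variables (n m : nat) (w : R -> R).
Hypotheses (hw : forall E, E \in Sp e n -> 0 <= w E) (hPs : 0 < Psucc e p n w).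
Local Notation S := (\sum_(E <- Sp e n) camp e p n w E).

(** Suprema and infima of reals need nonempty bounded sets: [cl_inf_le] bounds the cloning values,
    these bound the metrology values, and the averaging measurement with the given [phat] shows that
    protocols exist. *)
Lemma fidelity_sandwich (phat : R -> R) (qm : R) :
  is_distribution (Sp e m) phat -> (forall F, pE e p m F <= qm) ->
  [/\ pm_value e p n m w phat <= F_PM e p n w m,
      F_PM e p n w m <= F_CL e p n w m & F_CL e p n w m <= qm * S ^+ 2].
Proof.
move=> hphat hqm.
have cl_ub (D : {linear 'M[R[i]]_(tdim d1.+1 n) -> 'M[R[i]]_(tdim d1.+1 m)}) :
    is_channel D -> inf (range (cl_fidelity e p w D)) <= qm * S ^+ 2.
  by move=> hD; exact: cl_inf_le.
pose TR := measurableTypeR R.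
have cl_sup (D : {linear 'M[R[i]]_(tdim d1.+1 n) -> 'M[R[i]]_(tdim d1.+1 m)}) :
    is_channel D -> inf (range (cl_fidelity e p w D)) <= F_CL e p n w m.
  move=> hD; apply: ub_le_sup; last by exists D.
  by exists (qm * S ^+ 2) => _ [D' hD' ->]; exact: cl_ub.
have pm_ge0 (M : set TR -> 'M[R[i]]_(tdim d1.+1 n)) ph t : is_povm M ->
    0 <= pm_fidelity e p w m M ph t.
  move=> hM; rewrite (pm_fidelityE he0 hp_gt0 m hw hPs) (integral_povm hM).
  by apply: fine_ge0; apply: integral_ge0 => x _; rewrite lee_fin score_ge0.
have pm_inf_le (M : set TR -> 'M[R[i]]_(tdim d1.+1 n)) ph : is_povm M ->
    is_distribution (Sp e m) ph ->
    inf (range (pm_fidelity e p w m M ph)) <= F_CL e p n w m.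
  move=> hM hph; apply/ler_addgt0Pr => eps eps0.
  have [D hD le_D] := pm_le_cl he0 hp_gt0 hw hPs hph hM eps0.
  rewrite -lerBlDr; apply: le_trans (cl_sup D hD); apply: lb_le_inf.
    by exists (cl_fidelity e p w D 0); exists 0.
  move=> _ [t _ <-]; rewrite lerBlDr; apply: le_trans (le_D t).
  apply: ge_inf; last by exists t.
  by exists 0 => _ [u _ <-]; exact: pm_ge0.
have [M0 hM0 M0E] := pm_value_attained he0 hp_gt0 m hw hPs phat.
have M0inf : inf (range (pm_fidelity e p w m M0 phat)) = pm_value e p n m w phat.
  rewrite (_ : range _ = [set pm_value e p n m w phat]) ?inf1 //.
  apply/seteqP; split => [_ [t _ <-]|_ ->] /=; first exact: M0E.
  by exists 0.
split.
- rewrite -M0inf; apply: ub_le_sup; last by exists M0, phat.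
  by exists (F_CL e p n w m) => _ [M [ph [hM hph ->]]]; exact: pm_inf_le.
- apply: ge_sup; first by exists (inf (range (pm_fidelity e p w m M0 phat))); exists M0, phat.
  by move=> _ [M [ph [hM hph ->]]]; exact: pm_inf_le.
(* Only the existence of a channel matters here; the accuracy 1 is arbitrary. *)
have [D hD _] := pm_le_cl he0 hp_gt0 hw hPs hphat hM0 ltr01.
apply: ge_sup; first by exists (inf (range (cl_fidelity e p w D))); exists D.
by move=> _ [D' hD' ->]; exact: cl_ub.
Qed.

End Sandwich.

(** * Asymptotics *)

Section LatticeModel.
Variables (R : realType) (d1 r : nat) (e p : 'I_d1.+1 -> R).
Variables (eps : 'I_r -> R) (K : 'M[int]_(r, d1)).
Hypotheses (e0 : e ord0 = 0) (eps_free : ratindep eps).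
Hypothesis eK : forall j, e (lift ord0 j) = \sum_l eps l * (K l j)%:~R.

Definition jump (j : 'I_d1.+1) : 'rV[int]_r :=
  \row_l (if unlift ord0 j is Some j' then K l j' else 0).

Definition lenergy (k : 'rV[int]_r) : R := \sum_l eps l * (k 0 l)%:~R.

Lemma jump0 : jump ord0 = 0.
Proof. by apply/rowP => l; rewrite !mxE unlift_none. Qed.

Lemma jump_lift j l : jump (lift ord0 j) 0 l = K l j.
Proof. by rewrite mxE liftK. Qed.

Lemma lenergyD (k k' : 'rV[int]_r) : lenergy (k + k') = lenergy k + lenergy k'.
Proof. by rewrite /lenergy -big_split; apply: eq_bigr => l _; rewrite mxE intrD mulrDr. Qed.

Lemma lenergyN (k : 'rV[int]_r) : lenergy (- k) = - lenergy k.
Proof. by rewrite /lenergy -sumrN; apply: eq_bigr => l _; rewrite mxE intrN mulrN. Qed.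

(** Rational independence of the units: distinct lattice points never share an energy, so [pE] is a
    point probability of the walk. *)
Lemma lenergy_inj : injective lenergy.
Proof.
move=> k k' kk; apply/rowP => l; apply/eqP; rewrite -subr_eq0.
have h : \sum_(l < r) ratr ((k 0 l - k' 0 l)%:~R) * eps l = 0.
  rewrite -[RHS](subrr (lenergy k)) {2}kk -lenergyN -lenergyD.
  by apply: eq_bigr => i _; rewrite !mxE ratr_int mulrC.
by have /eqP := eps_free h l; rewrite intr_eq0.
Qed.

Lemma lenergy_jump j : lenergy (jump j) = e j.
Proof.
case: (unliftP ord0 j) => [j' ->|->].
  by rewrite eK; apply: eq_bigr => l _; rewrite jump_lift.
by rewrite e0 /lenergy big1 // => l _; rewrite jump0 mxE mulr0.
Qed.

Lemma wordE_lenergy m (x : {ffun 'I_m -> 'I_d1.+1}) : wordE e x = lenergy (wordV jump x).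
Proof.
rewrite /wordE /wordV; elim/big_rec2: _ => [|i y z _ ->].
  by rewrite /lenergy big1 // => l _; rewrite mxE mulr0.
by rewrite lenergyD lenergy_jump.
Qed.

Lemma pE_latP m (k : 'rV[int]_r) : pE e p m (lenergy k) = latP p jump m k.
Proof.
rewrite (pE_words p e0); apply: eq_bigl => x.
by rewrite wordE_lenergy (inj_eq lenergy_inj).
Qed.

Lemma jump_gen (A : 'M[int]_(d1, r)) : K *m A = 1%:M ->
  forall i l, \sum_j (if unlift ord0 j is Some j' then A j' i else 0) * jump j 0 l = (i == l)%:R.
Proof.
move=> KA i l; rewrite big_ord_recl unlift_none mul0r add0r.
have := congr1 (fun M : 'M[int]_r => M l i) KA; rewrite !mxE eq_sym => <-.
by apply: eq_bigr => j _; rewrite liftK jump_lift mulrC.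
Qed.

(** [Sigma p 1] is the covariance of the indicator vector of the level of a single clock, and [jump]
    is the image of that vector under [K]. *)
Lemma covmx_jump (p_sum : \sum_j p j = 1) :
  covmx p jump = map_mx intr K *m Sigma p 1 *m (map_mx intr K)^T.
Proof.
apply/matrixP => i l; rewrite !mxE.
pose mu i := \sum_j p j * (jump j 0 i)%:~R.
have -> : \sum_j p j * (((jump j 0 i)%:~R - mu i) * ((jump j 0 l)%:~R - mu l)) =
   \sum_j p j * ((jump j 0 i)%:~R * (jump j 0 l)%:~R) - mu i * mu l.
  rewrite (eq_bigr (fun j => p j * ((jump j 0 i)%:~R * (jump j 0 l)%:~R)
    - mu l * (p j * (jump j 0 i)%:~R) - mu i * (p j * (jump j 0 l)%:~R)
    + p j * (mu i * mu l))); last by move=> j _; ring.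
  rewrite big_split /= sumrB sumrB -!mulr_sumr -/(mu i) -/(mu l) -mulr_suml p_sum.
  by ring.
rewrite big_ord_recl jump0 mxE mulr0z mul0r mulr0 add0r.
have muE i' : mu i' = \sum_j p (lift ord0 j) * (K i' j)%:~R.
  rewrite /mu big_ord_recl jump0 mxE mulr0 add0r.
  by apply: eq_bigr => j _; rewrite jump_lift.
under eq_bigr do rewrite !jump_lift.
under [RHS]eq_bigr => j _ do rewrite !mxE mulr_suml.
rewrite exchange_big /=.
rewrite (muE i) mulr_suml -sumrB; apply: eq_bigr => j _.
rewrite (muE l) mulr_sumr.
rewrite (bigD1 j) //= [in RHS](bigD1 j) //= !mxE eqxx mul1r opprD addrA; congr (_ + _).
  by ring.
rewrite -sumrN; apply: eq_bigr => j' jj'; rewrite !mxE eq_sym (negbTE jj') mul1r.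
by ring.
Qed.

End LatticeModel.

Lemma bernoulli_le (R : realDomainType) (x : R) r : 0 <= x <= 1 -> 1 - r%:R * x <= (1 - x) ^+ r.
Proof.
move=> /andP[x0 x1]; elim: r => [|r IH]; first by rewrite expr0 mul0r subr0.
rewrite exprS; apply: (@le_trans _ _ ((1 - x) * (1 - r%:R * x))).
  have : 0 <= r%:R * (x * x) by rewrite !mulr_ge0.
  by rewrite -natr1; nra.
by rewrite ler_wpM2l // subr_ge0.
Qed.

Lemma sum_inj_le (R : realDomainType) (I : finType) (s : seq R) (f : I -> R) (g : R -> R) :
  injective f -> uniq s -> (forall i, f i \in s) -> (forall x, 0 <= g x) ->
  \sum_i g (f i) <= \sum_(x <- s) g x.
Proof.
move=> f_inj us fs g0; rewrite (eq_bigr (fun i => \sum_(x <- s) if f i == x then g x else 0)).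
  rewrite exchange_big; apply: ler_sum => x _ /=.
  have [i /eqP fi|fx] := pickP (fun i => f i == x); last by rewrite big1 // => i _; rewrite fx.
  rewrite (bigD1 i) //= fi eqxx big1 ?addr0 // => j ji.
  by rewrite -fi (inj_eq f_inj) (negbTE ji).
by move=> i _; rewrite sum_pick.
Qed.

Section Asymptotics.
Variables (R : realType) (d1 r : nat) (e p : 'I_d1.+1 -> R).
Hypotheses (he0 : e ord0 = 0) (hp_gt0 : forall j, 0 < p j) (hp_sum : \sum_j p j = 1).
Variables (eps : 'I_r -> R) (K : 'M[int]_(r, d1)) (A : 'M[int]_(d1, r)).
Hypotheses (eps_free : ratindep eps) (KA : K *m A = 1%:M).
Hypothesis eK : forall j, e (lift ord0 j) = \sum_l eps l * (K l j)%:~R.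
Variables (n : nat) (w : R -> R).
Hypotheses (hw : forall E, E \in Sp e n -> 0 <= w E) (hPs : 0 < Psucc e p n w).

Local Notation v := (jump K).
Local Notation val := (lenergy eps).
Local Notation S := (\sum_(E <- Sp e n) camp e p n w E).
Let c := camp e p n w.
Let s m : R := Num.sqrt m.+1%:R.
Let D m : R := (2 * pi * s m) ^+ r.
Let lim : R := Num.sqrt ((2 * pi) ^+ r / \det (covmx p v)).
Let gen := jump_gen KA.

Let s_gt0 m : 0 < s m. Proof. by rewrite sqrtr_gt0. Qed.
Let D_gt0 m : 0 < D m. Proof. by rewrite exprn_gt0 // !mulr_gt0 // pi_gt0. Qed.
Let det_gt0 : 0 < \det (covmx p v).
Proof. by have [] := nint_gauss 1 (posdef_covmx hp_gt0 (jump0 K) gen). Qed.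
Let lim_gt0 : 0 < lim.
Proof. by rewrite sqrtr_gt0 divr_gt0 // exprn_gt0 // mulr_gt0 // pi_gt0. Qed.

Let word_of m E : E \in Sp e m -> exists x : {ffun 'I_m -> 'I_d1.+1}, E = val (wordV v x).
Proof.
rewrite -(pE_gt0 e hp_gt0) (pE_words p he0) => h.
have [x /eqP <-|h0] := pickP (fun x : {ffun 'I_m -> 'I_d1.+1} => wordE e x == E).
  by exists x; rewrite -(wordE_lenergy he0 eK).
by move: h; rewrite big_pred0 ?ltxx.
Qed.

Let mui i : R := \sum_j p j * (v j 0 i)%:~R.
Let ctr m : 'rV[int]_r := \row_i Num.floor (m.+1%:R * mui i).
Let box (L : nat) (b : {ffun 'I_r -> 'I_L}) : 'rV[int]_r := \row_i ((b i : nat)%:Z).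

Let box_inj L : injective (@box L).
Proof.
move=> b b' /rowP h; apply/ffunP => i; apply: val_inj.
by have := h i; rewrite !mxE => -[].
Qed.

(** Rounding the mean and moving inside the box displace each coordinate by at most [1 + L], which
    is negligible against sqrt m. *)
Let latP_box L (b : {ffun 'I_r -> 'I_L}) :
  D m * latP p v m.+1 (ctr m + box b) @[m --> \oo] --> lim.
Proof.
apply: (latP_cvg hp_gt0 hp_sum (jump0 K) gen) => u.
pose B : R := \sum_i (1 + L%:R) * `|u 0 i|.
have cs : B / s m @[m --> \oo] --> (0 : R).
  have h : (fun m => m.+1%:R^-1 : R) @ \oo --> (0 : R) by exact: cvg_harmonic.
  have h2 : Num.sqrt (m.+1%:R^-1) @[m --> \oo] --> Num.sqrt (0 : R).
    by apply: (@continuous_cvg _ _ _ _ _ _ (@Num.sqrt R)); [exact: sqrt_continuous|exact: h].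
  rewrite sqrtr0 in h2; rewrite -[0](mulr0 B).
  rewrite (_ : (fun m => _) = fun m => B * Num.sqrt (m.+1%:R^-1)).
    by apply: cvgM; [exact: cvg_cst|exact: h2].
  by apply/funext => m; rewrite /s sqrtrV.
apply: (squeeze_cvgr (f := fun m => - (B / s m)) (h := fun m => B / s m)) => //; last first.
  by rewrite -oppr0; apply: cvgN.
near=> m; rewrite -ler_norml normrM normfV (gtr0_norm (s_gt0 m)) ler_pM2r ?invr_gt0 //.
have -> : m.+1%:R * (\sum_j p j * dotp (v j) u) - dotp (ctr m + box b) u =
   \sum_i ((m.+1%:R * mui i - (ctr m 0 i)%:~R) - (b i : nat)%:R) * u 0 i.
  have -> : \sum_j p j * dotp (v j) u = \sum_i mui i * u 0 i.
    under eq_bigr do rewrite /dotp mulr_sumr.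
    rewrite exchange_big; apply: eq_bigr => i _; rewrite /mui mulr_suml.
    by apply: eq_bigr => j _; rewrite mulrA.
  rewrite mulr_sumr /dotp -sumrB; apply: eq_bigr => i _.
  have -> : (ctr m + box b) 0 i = ctr m 0 i + (b i : nat)%:Z by rewrite !mxE.
  by rewrite intrD; ring.
apply: le_trans (ler_norm_sum _ _ _) _; apply: ler_sum => i _.
rewrite normrM ler_wpM2r //; apply: le_trans (ler_normB _ _) _; apply: lerD.
  rewrite mxE; set x := m.+1%:R * mui i.
  have := floor_le x; have := floorD1_gt x; rewrite intrD => h1 h2.
  by rewrite ger0_norm ?subr_ge0 //; lra.
by rewrite ger0_norm // ler_nat ltnW.
Unshelve. all: by end_near.
Qed.

(** Every input energy comes from one of finitely many words of length [n]; summing over all pairs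
    of words gives a crude common bound. *)
Let shift_bound : exists C : nat, forall E E', E \in Sp e n -> E' \in Sp e n ->
  exists2 dl : 'rV[int]_r, E - E' = val dl & forall i, (absz (dl 0%R i) <= C)%N.
Proof.
exists (\sum_(x : {ffun 'I_n -> 'I_d1.+1}) \sum_(y : {ffun 'I_n -> 'I_d1.+1})
  \sum_i absz ((wordV v x - wordV v y)%R 0%R i))%N.
move=> E E' /word_of[x ->] /word_of[y ->].
exists (wordV v x - wordV v y); first by rewrite lenergyD lenergyN.
move=> i; rewrite (bigD1 x) //= (bigD1 y) //= (bigD1 i) //=.
by rewrite -!addnA leq_addr.
Qed.

Lemma camp_sum_gt0 : 0 < S.
Proof.
rewrite lt_neqAle sumr_ge0 ?andbT => [|E _]; last exact: sqrtr_ge0.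
rewrite eq_sym; apply/negP => /eqP h.
have c00 E : E \in Sp e n -> c E = 0.
  move=> SE; apply/eqP; rewrite eq_le sqrtr_ge0 andbT -h (bigD1_seq E) ?uniq_Sp //=.
  by rewrite lerDl sumr_ge0 // => E' _; exact: sqrtr_ge0.
have := sum_cc he0 hp_gt0 hw hPs; rewrite big_seq big1 => [/eqP|E SE].
  by rewrite eq_sym oner_eq0.
by rewrite -/(c E) c00 // mul0r.
Qed.

Let upper : exists2 q : nat -> R, q m @[m --> \oo] --> lim &
  forall m F, pE e p m.+1 F <= q m / D m.
Proof.
have [q [q_lim qP]] := latP_upper hp_gt0 hp_sum (jump0 K) gen.
have pq m k : pE e p m.+1 (val k) <= q m / D m.
  by rewrite (pE_latP p he0 eps_free eK) ler_pdivlMr ?D_gt0 // mulrC; exact: qP.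
exists q => // m F; have [/word_of[x ->]|nF] := boolP (F \in Sp e m.+1); first exact: pq.
apply: (@le_trans _ _ 0); first by rewrite leNgt (pE_gt0 e hp_gt0).
by apply: le_trans (pq m 0); rewrite pE_ge0.
Qed.

Let phat L m F : R :=
  \sum_(b : {ffun 'I_r -> 'I_L}) if val (ctr m + box b) == F then ((L ^ r)%:R)^-1 else 0.

Let phat_distribution L m : (0 < L)%N ->
  (forall b : {ffun 'I_r -> 'I_L}, val (ctr m + box b) \in Sp e m.+1) ->
  is_distribution (Sp e m.+1) (phat L m).
Proof.
move=> L0 inSp; split=> [F _|].
  by rewrite sumr_ge0 // => b _; case: ifP => // _; rewrite invr_ge0.
rewrite exchange_big /=; under eq_bigr do rewrite sum_pick ?uniq_Sp //.
by rewrite sumr_const card_ffun !card_ord -[LHS]mulr_natl mulfV // pnatr_eq0 expn_eq0 eqn0Ngt L0.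
Qed.

Let phat_box L m (b : {ffun 'I_r -> 'I_L}) : ((L ^ r)%:R)^-1 <= phat L m (val (ctr m + box b)).
Proof.
rewrite /phat (bigD1 b) //= eqxx lerDl sumr_ge0 // => b' _.
by case: ifP => // _; rewrite invr_ge0.
Qed.

(** An inner box of side [M], set at offset [C] inside the box of side [L], stays inside under
    translation by [dl]. Each inner point and its translate form a resonant pair contributing at
    least [a / L ^ r]. *)
Let pair_bound M C m (a : R) (dl : 'rV[int]_r) E E' : 0 <= a ->
  let L := (M + C + C)%N in
  (forall b : {ffun 'I_r -> 'I_L}, val (ctr m + box b) \in Sp e m.+1) ->
  (forall b : {ffun 'I_r -> 'I_L}, a <= pE e p m.+1 (val (ctr m + box b))) ->
  E - E' = val dl -> (forall i, (absz (dl 0%R i) <= C)%N) ->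
  (M ^ r)%:R / (L ^ r)%:R * a <=
  \sum_(F <- Sp e m.+1) \sum_(F' <- Sp e m.+1)
    (E + F - (E' + F') == 0)%:R * (samp e p m.+1 (phat L m) F * samp e p m.+1 (phat L m) F').
Proof.
move=> a0 L inSp aP EE' dlC; set sp := samp _ _ _ _.
have sp0 F : 0 <= sp F by rewrite mulr_ge0 ?sqrtr_ge0.
have g0 F F' : 0 <= (E + F - (E' + F') == 0)%:R * (sp F * sp F') by rewrite mulr_ge0 ?mulr_ge0.
have sp_box (b : {ffun 'I_r -> 'I_L}) : Num.sqrt (((L ^ r)%:R)^-1 * a) <= sp (val (ctr m + box b)).
  rewrite /sp /samp -sqrtrM; last exact: le_trans (phat_box m b).
  by rewrite ler_wsqrtr // ler_pM ?invr_ge0 //; exact: phat_box.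
have lt1 (b : {ffun 'I_r -> 'I_M}) i : (b i + C < L)%N by rewrite /L; have := ltn_ord (b i); lia.
have lt2 (b : {ffun 'I_r -> 'I_M}) i : (absz ((b i + C)%N%:Z + dl 0%R i)%R < L)%N.
  by rewrite /L; have := ltn_ord (b i); have := dlC i; lia.
pose b1 (b : {ffun 'I_r -> 'I_M}) := [ffun i => Ordinal (lt1 b i)].
pose b2 (b : {ffun 'I_r -> 'I_M}) := [ffun i => Ordinal (lt2 b i)].
have b12 b : box (b2 b) = box (b1 b) + dl.
  by apply/rowP => i; rewrite !mxE !ffunE /=; have := dlC i; lia.
have inj1 : injective (fun b => val (ctr m + box (b1 b))).
  move=> b b' /(lenergy_inj eps_free)/addrI/box_inj/ffunP h; apply/ffunP => i.
  by have := congr1 (@nat_of_ord _) (h i); rewrite !ffunE /= => /addIn/val_inj.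
apply: le_trans (sum_inj_le (g := fun F => \sum_(F' <- Sp e m.+1) _) inj1 (uniq_Sp e m.+1) _ _);
  [|by move=> b|by move=> F; rewrite sumr_ge0].
have -> : (M ^ r)%:R / (L ^ r)%:R * a = \sum_(b : {ffun 'I_r -> 'I_M}) ((L ^ r)%:R)^-1 * a.
  by rewrite sumr_const card_ffun !card_ord -[RHS]mulr_natl mulrA.
apply: ler_sum => b _; rewrite (bigD1_seq (val (ctr m + box (b2 b)))) ?uniq_Sp //=.
apply: (@le_trans _ _ (sp (val (ctr m + box (b1 b))) * sp (val (ctr m + box (b2 b))))).
  rewrite -[leLHS]sqr_sqrtr ?mulr_ge0 ?invr_ge0 // expr2.
  by rewrite ler_pM ?sqrtr_ge0.
have -> : E + val (ctr m + box (b1 b)) - (E' + val (ctr m + box (b2 b))) = 0.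
  by rewrite b12 addrA [in X in _ - X]lenergyD -EE'; ring.
by rewrite eqxx mul1r lerDl sumr_ge0.
Qed.

Let pm_value_lower M C m (a : R) : 0 <= a ->
  let L := (M + C + C)%N in
  (forall b : {ffun 'I_r -> 'I_L}, val (ctr m + box b) \in Sp e m.+1) ->
  (forall b : {ffun 'I_r -> 'I_L}, a <= pE e p m.+1 (val (ctr m + box b))) ->
  (forall E E', E \in Sp e n -> E' \in Sp e n ->
    exists2 dl : 'rV[int]_r, E - E' = val dl & forall i, (absz (dl 0%R i) <= C)%N) ->
  (M ^ r)%:R / (L ^ r)%:R * a * S ^+ 2 <= pm_value e p n m.+1 w (phat L m).
Proof.
move=> a0 L inSp aP hC; rewrite /pm_value /= big_allpairs; under [leRHS]eq_bigr do under eq_bigr do rewrite big_allpairs.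
under [leRHS]eq_bigr do rewrite exchange_big /=.
rewrite expr2 mulr_suml mulr_sumr big_seq [leRHS]big_seq; apply: ler_sum => E SE.
rewrite !mulr_sumr big_seq [leRHS]big_seq; apply: ler_sum => E' SE'.
have [dl EE' dlC] := hC _ _ SE SE'.
have := pair_bound a0 inSp aP EE' dlC; set T := (X in _ <= X) => hT.
rewrite [leRHS](_ : _ = T * (c E * c E')).
  by rewrite ler_wpM2r // mulr_ge0 ?sqrtr_ge0.
rewrite /T mulr_suml; apply: eq_bigr => F _; rewrite mulr_suml; apply: eq_bigr => F' _.
by rewrite /c /=; ring.
Qed.

(** One factor [1 - eta] pays for the boundary layer of the box, the other for the distance of the
    point probabilities from their limit. *)
Lemma fidelity_asymptotic_bounds : exists2 q : nat -> R, q m @[m --> \oo] --> lim &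
  forall eta : R, 0 < eta < 1 -> \forall m \near \oo,
    [/\ (1 - eta) ^+ 2 * (lim / D m * S ^+ 2) <= F_PM e p n w m.+1,
        F_PM e p n w m.+1 <= F_CL e p n w m.+1 &
        F_CL e p n w m.+1 <= q m / D m * S ^+ 2].
Proof.
have [q q_lim qP] := upper; exists q => // eta /andP[eta0 eta1].
have [C hC] := shift_bound.
(* By Bernoulli the boundary costs at most [r * (C + C) / L], which this side keeps below [eta]. *)
pose M := (Num.bound (r%:R * (C + C)%:R / eta)).+1; pose L := (M + C + C)%N.
have L0 : 0 < L%:R :> R by rewrite ltr0n /L /M.
have ratio : 1 - eta <= (M ^ r)%:R / (L ^ r)%:R.
  rewrite !natrX -expr_div_n.
  have -> : M%:R / L%:R = 1 - (C + C)%:R / L%:R :> R.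
    apply: (mulIf (lt0r_neq0 L0)); rewrite mulrBl !divfK ?lt0r_neq0 // mul1r /L -addnA natrD.
    by ring.
  apply: le_trans (bernoulli_le r _); last first.
    by rewrite divr_ge0 //= ler_pdivrMr // mul1r ler_nat /L -addnA leq_addl.
  rewrite lerB // mulrA ler_pdivrMr //.
  have := archi_boundP (x := r%:R * (C + C)%:R / eta); rewrite divr_ge0 ?mulr_ge0 ?(ltW eta0) //.
  move=> /(_ isT); rewrite ltr_pdivrMr // => h; apply: le_trans (ltW h) _.
  by rewrite mulrC ler_wpM2l ?(ltW eta0) // ler_nat /L /M; lia.
(* The box has a fixed finite number of points, so pointwise convergence is uniform over it. *)
have near_box : \forall m \near \oo, forall b : {ffun 'I_r -> 'I_L},
    (1 - eta) * lim <= D m * latP p v m.+1 (ctr m + box b).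
  apply: filter_forall => b; have := latP_box b => /cvgr_ge; apply.
  by rewrite gtr_pMl // gtrBl.
near=> m.
have boxP (b : {ffun 'I_r -> 'I_L}) :
    (1 - eta) * (lim / D m) <= pE e p m.+1 (val (ctr m + box b)).
  rewrite (pE_latP p he0 eps_free eK) mulrA ler_pdivrMr ?D_gt0 // [leRHS]mulrC.
  by move: b; near: m.
have lD0 : 0 < lim / D m by rewrite divr_gt0.
have a0 : 0 < (1 - eta) * (lim / D m) by rewrite mulr_gt0 ?subr_gt0.
have inSp (b : {ffun 'I_r -> 'I_L}) : val (ctr m + box b) \in Sp e m.+1.
  by rewrite -(pE_gt0 e hp_gt0); exact: lt_le_trans (boxP b).
have hphat := phat_distribution (ltn0Sn _) inSp.
have [pmL pmcl clU] := fidelity_sandwich he0 hp_gt0 hw hPs hphat (qP m).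
split=> //; apply: le_trans pmL.
apply: le_trans (pm_value_lower (ltW a0) inSp boxP hC).
rewrite [leLHS](_ : _ = (1 - eta) * ((1 - eta) * (lim / D m) * S ^+ 2)); last by ring.
by rewrite -[leRHS]mulrA ler_wpM2r // mulr_ge0 ?exprn_ge0 ?(ltW a0) // ltW // camp_sum_gt0.
Unshelve. all: by end_near.
Qed.

(** [|det B|] appears once as the gcd and squared under the root, so it cancels; the remaining
    determinant scales as [(m + 1) ^ r], which is the power of [s m] in [D m]. *)
Lemma F_asymE (B : 'M[int]_r) m : \det B != 0 ->
  F_asym e p n w (B *m K) m.+1 = lim / D m * S ^+ 2.
Proof.
move=> B0; rewrite /F_asym; congr (_ * _).
rewrite minors_gcd_mul (minors_gcd_eq1 KA) muln1.
have SigmaE : Sigma p m.+1 = m.+1%:R *: Sigma p 1.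
  by apply/matrixP => i j; rewrite !mxE; case: eqP => _; ring.
have det_eq : \det (Sigma_tilde p (B *m K) m.+1) =
    `|(\det B)%:~R| ^+ 2 * (m.+1%:R ^+ r * \det (covmx p v)).
  rewrite real_normK ?num_real //.
  rewrite /Sigma_tilde map_mxM trmx_mul SigmaE (covmx_jump K hp_sum).
  have -> : forall (X : 'M[R]_r) (Y : 'M[R]_(r, d1)) (Z : 'M[R]_d1) a,
      X *m Y *m (a *: Z) *m (Y^T *m X^T) = X *m (a *: (Y *m Z *m Y^T)) *m X^T.
    by move=> X Y Z a; rewrite !(mulmxA, =^~ scalemxAr, =^~ scalemxAl).
  by rewrite !det_mulmx det_tr (det_map_mx intr) detZ; ring.
have B1 : 0 < `|(\det B)%:~R| :> R by rewrite normr_gt0 intr_eq0.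
have tp0 : 0 < (2 * pi) ^+ r :> R by rewrite exprn_gt0 // mulr_gt0 // pi_gt0.
have m0 : 0 < m.+1%:R ^+ r :> R by rewrite exprn_gt0.
rewrite det_eq mulrCA sqrtrM ?exprn_ge0 // sqrtr_sqr normr_id.
rewrite mulrCA sqrtrM ?(ltW m0) // sqrtrM ?(ltW tp0) //.
rewrite /lim sqrtrM ?(ltW tp0) // sqrtrV ?(ltW det_gt0) // /D (exprMn r (2 * pi)).
have -> : s m ^+ r = Num.sqrt (m.+1%:R ^+ r).
  by rewrite /s; elim: (r) => [|k IH]; rewrite ?expr0 ?sqrtr1 // !exprS IH sqrtrM.
have -> : (absz (\det B))%:R = `|(\det B)%:~R| :> R by rewrite -intr_norm -natr_absz.
have x0 : 0 < Num.sqrt ((2 * pi) ^+ r) :> R by rewrite sqrtr_gt0.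
have xx : (2 * pi) ^+ r = Num.sqrt ((2 * pi) ^+ r) * Num.sqrt ((2 * pi) ^+ r) :> R.
  by rewrite -expr2 sqr_sqrtr // ltW.
have y0 : 0 < Num.sqrt (m.+1%:R ^+ r) :> R by rewrite sqrtr_gt0.
have z0 : 0 < Num.sqrt (\det (covmx p v)) by rewrite sqrtr_gt0.
move: B1 x0 y0 z0 xx; move: `| _ | (Num.sqrt _) (Num.sqrt _) (Num.sqrt _) => b x y z b0 x0 y0 z0 ->.
by field; rewrite !lt0r_neq0.
Qed.

End Asymptotics.

(** [D m] belongs to [m + 1] clocks, so all comparisons are made at the shifted index, which leaves
    the limit unchanged. *)
Lemma squeeze_ratio_cvg (R : realType) (f g h q D : nat -> R) (l S : R) :
  0 < l -> 0 < S -> (forall m, 0 < D m) ->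
  q m @[m --> \oo] --> l -> (forall m, h m.+1 = l / D m * S) ->
  (forall eta : R, 0 < eta < 1 -> \forall m \near \oo,
    [/\ (1 - eta) ^+ 2 * (l / D m * S) <= f m.+1, f m.+1 <= g m.+1 & g m.+1 <= q m / D m * S]) ->
  (f m / h m @[m --> \oo] --> (1 : R)) /\ (g m / h m @[m --> \oo] --> (1 : R)).
Proof.
move=> l0 S0 D0 q_lim hE bounds.
have close (eta : R) : 0 < eta -> \forall m \near \oo,
    [/\ 1 - eta <= f m.+1 / h m.+1, f m.+1 / h m.+1 <= g m.+1 / h m.+1 &
        g m.+1 / h m.+1 <= 1 + eta].
  (* [(1 - z) ^ 2 >= 1 - 2 z >= 1 - eta]; the cap 1/2 keeps [z] below 1, as [bounds] demands. *)
  move=> eta0; pose z := Num.min (eta / 2) 2^-1.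
  have z0 : 0 < z by rewrite lt_min invr_gt0 ltr0n andbT divr_gt0.
  have z1 : z < 1 by rewrite gt_min; apply/orP; right; rewrite invf_lt1 ?ltr1n.
  have zeta : 2 * z <= eta by rewrite mulrC -ler_pdivlMr // ge_min lexx.
  near=> m.
  have h0 : 0 < h m.+1 by rewrite hE mulr_gt0 // divr_gt0.
  have [] : [/\ (1 - z) ^+ 2 * (l / D m * S) <= f m.+1, f m.+1 <= g m.+1 & g m.+1 <= q m / D m * S].
    by near: m; apply: bounds; rewrite z0.
  rewrite -hE => fL fg gU; split; last 2 first.
  - by rewrite ler_pM2r ?invr_gt0.
  - rewrite ler_pdivrMr //; apply: le_trans gU _; rewrite hE !mulrA ler_pM2r // ler_pM2r ?invr_gt0 //.
    by near: m; move/cvgr_le: q_lim; apply; rewrite ltr_pMl // ltrDl.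
  - rewrite ler_pdivlMr //; apply: le_trans fL; rewrite ler_pM2r //.
    rewrite -subr_ge0 (_ : _ - _ = (eta - 2 * z) + z ^+ 2); last by ring.
    by rewrite addr_ge0 ?sqr_ge0 // subr_ge0.
split; rewrite -cvg_shiftS; apply/cvgrPdist_le => eta /close; apply: filterS => m [a b c];
  by rewrite distrC ler_distl; apply/andP; split; [|apply: le_trans c] => //; apply: le_trans b.
Unshelve. all: by end_near.
Qed.

Theorem mainTheorem1 (R : realType) (d1 : nat) (hd : (1 <= d1)%N)
  (e p : 'I_d1.+1 -> R)
  (he_inj : injective e) (he0 : e ord0 = 0)
  (hp_gt0 : forall j, 0 < p j) (hp_sum : \sum_j p j = 1)
  (r : nat) (eps : 'I_r -> R) (K : 'M[int]_(r, d1))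
  (hK : minimal_units e eps K)
  (n : nat) (hn : (1 <= n)%N)
  (w : R -> R) (hw : forall E, E \in Sp e n -> 0 <= w E <= 1)
  (hPsucc : 0 < Psucc e p n w) :
  (F_PM e p n w m / F_asym e p n w K m @[m --> \oo] --> (1 : R)) /\
  (F_CL e p n w m / F_asym e p n w K m @[m --> \oo] --> (1 : R)).
Proof.
have hw0 E : E \in Sp e n -> 0 <= w E by case/hw/andP.
have [eps' [B [K' [A [-> B0 KA eps_free eK]]]]] := minimal_units_reduce hK.
have [q q_lim bounds] := fidelity_asymptotic_bounds he0 hp_gt0 hp_sum eps_free KA eK hw0 hPsucc.
apply: squeeze_ratio_cvg q_lim _ bounds.
- by rewrite sqrtr_gt0 divr_gt0 ?exprn_gt0 ?mulr_gt0 ?pi_gt0 // (nint_gauss 1 (posdef_covmx hp_gt0 (jump0 K') (jump_gen KA))).1.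
- by rewrite exprn_gt0 // (camp_sum_gt0 he0 hp_gt0 hw0 hPsucc).
- by move=> m; rewrite exprn_gt0 // !mulr_gt0 ?pi_gt0 // sqrtr_gt0.
- by move=> m; apply: (F_asymE e hp_gt0 hp_sum KA n w).
Qed.
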